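(* Let $H:T^*M\to\mathbb{R}$ be a Tonelli Hamiltonian. There exist positive constants $\lambda=\lambda_H$, $T=T_H$, $C=C_H$ such that for any weak KAM solution $\phi$ of $H(x,D\phi(x))=0$ on $M$, any $t\in(0,T]$ and any $x\in E(\phi,t)=\{x\in M:\tau_\phi(x)\geq t\}$ (at such $x$, $\phi$ is differentiable), $$|p-D\phi(x)|\leq\frac{C}{t}|y-x|,\qquad\forall y\in B(x,\lambda t),\ p\in D^+\phi(y).$$
   Context: $M$ is a smooth, compact, connected manifold without boundary with a Riemannian metric and distance $d$. Here $|y-x|=d(x,y)$, and the difference $p-D\phi(x)$ of covectors at the nearby points $y$ and $x$ is computed in local coordinates: fix a finite atlas whose charts have Euclidean balls as images and extend smoothly to neighbourhoods of their closures, such that nearby points lie in a common chart; the inequality is understood in any chart of this atlas containing both $x$ and $y$ (the constants may depend on the metric and the atlas as well as on $H$). $H$ is Tonelli if it is $C^2$, $H_{pp}>0$ everywhere and $H(x,\cdot)$ is superlinear uniformly in $x$; $L(x,v)=\sup_p\{\langle p,v\rangle-H(x,p)\}$. $A_t(x,y)=\inf\int_0^tL(\xi,\dot\xi)\,ds$ over absolutely continuous $\xi:[0,t]\to M$ with $\xi(0)=x$, $\xi(t)=y$. It is assumed that the Mañé critical value of $H$ is $0$; $\phi:M\to\mathbb{R}$ is a weak KAM solution of $H(x,D\phi)=0$ if $\phi(x)=\inf_{y\in M}\{\phi(y)+A_t(y,x)\}$ for all $t>0$, $x\in M$; such $\phi$ is semiconcave with linear modulus. $D^+\phi(x)=\{D\psi(x):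 r>0,\psi\in C^1(B_r(x)),\psi\geq\phi,\psi(x)=\phi(x)\}$. The cut time is $\tau_\phi(x)=\sup\{t\geq0:\exists\gamma\in C^1([0,t],M),\ \gamma(0)=x,\ \phi(\gamma(t))-\phi(x)=A_t(x,\gamma(t))\}$ (condition void for $t=0$). *)

(* Defs.v *)
From mathcomp Require Import all_boot all_order all_algebra.
From mathcomp Require Import all_classical all_reals all_analysis.

Set Implicit Arguments.
Unset Strict Implicit.
Unset Printing Implicit Defensive.

Import Order.TTheory GRing.Theory Num.Theory.
Import numFieldNormedType.Exports.

Local Open Scope classical_set_scope.
Local Open Scope ring_scope.

(* Meant for [A] open and [V] finite-dimensional. *)
Fixpoint Ck (R : realType) (V W : normedModType R) (k : nat) (A : set V)
    (f : V -> W) : Prop :=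
  if k is k'.+1 then
    (forall a, A a -> differentiable f a) /\ (forall v, Ck k' A ('D_v f))
  else forall a, A a -> {for a, continuous f}.

Definition enorm (R : realType) (n : nat) (v : 'rV[R]_n) : R :=
  Num.sqrt (\sum_i v 0 i ^+ 2).

Definition pairing (R : realType) (n : nat) (p v : 'rV[R]_n) : R :=
  (p *m v^T) 0 0.

(* [cinv] is only meaningful on [cimg]. *)
Record chart (R : realType) (n : nat) (T : topologicalType) := Chart {
  cdom : set T;
  cmap : T -> 'rV[R]_n;
  cinv : 'rV[R]_n -> T;
  cdom_open : open cdom;
  cimg_open : open (cmap @` cdom);
  cmapK : forall x, cdom x -> cinv (cmap x) = x;
  cmap_continuous : forall x, cdom x -> {for x, continuous cmap};
  cinv_continuous : forall q, (cmap @` cdom) q -> {for q, continuous cinv}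
}.

Definition cimg (R : realType) (n : nat) (T : topologicalType)
  (c : chart R n T) : set 'rV[R]_n := cmap c @` cdom c.

Definition smooth_transition (R : realType) (n : nat) (T : topologicalType)
    (c c' : chart R n T) : Prop :=
  forall k, Ck k (cmap c @` (cdom c `&` cdom c')) (cmap c' \o cinv c).

Definition compatible (R : realType) (n : nat) (T : topologicalType)
    (c c' : chart R n T) : Prop :=
  smooth_transition c c' /\ smooth_transition c' c.

(* A smooth structure is presented by a smooth atlas indexed by the points,
   [chart_at x] being a chart around [x]; [smooth_chart] below is membership in
   the maximal atlas it generates. *)
Record manifold (R : realType) (n : nat) := Manifold {
  carrier :> topologicalType;
  carrier_hausdorff : hausdorff_space carrier;
  chart_at : carrier -> chart R n carrier;
  chart_at_dom : forall x, cdom (chart_at x) x;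
  chart_at_compatible : forall x y, compatible (chart_at x) (chart_at y)
}.

Definition smooth_chart (R : realType) (n : nat) (M : manifold R n)
    (c : chart R n M) : Prop :=
  forall x, compatible c (chart_at x).

(* Tangent vectors and covectors at [x] are row vectors, namely their
   coordinates in the chart [chart_at x].  A tangent vector with coordinates
   [v] in [c] has coordinates [v *m trans c c' x] in [c']; covectors transform
   contragrediently. *)
Definition trans (R : realType) (n : nat) (T : topologicalType)
    (c c' : chart R n T) (x : T) : 'M[R]_n :=
  'J (cmap c' \o cinv c) (cmap c x).

Definition cov_in (R : realType) (n : nat) (M : manifold R n)
    (c : chart R n M) (x : M) (p : 'rV[R]_n) : 'rV[R]_n :=
  p *m (trans c (chart_at x) x)^T.

(* the inverse of [cov_in] *)
Definition cov_of (R : realType) (n : nat) (M : manifold R n)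
    (c : chart R n M) (x : M) (p : 'rV[R]_n) : 'rV[R]_n :=
  p *m (trans (chart_at x) c x)^T.

Definition gram_in (R : realType) (n : nat) (M : manifold R n)
    (gram : M -> 'M[R]_n) (c : chart R n M) (q : 'rV[R]_n) : 'M[R]_n :=
  let x := cinv c q in
  trans c (chart_at x) x *m gram x *m (trans c (chart_at x) x)^T.

Record riemannian_metric (R : realType) (n : nat) (M : manifold R n) :=
  RiemannianMetric {
  gram :> M -> 'M[R]_n;
  gram_sym : forall x, (gram x)^T = gram x;
  gram_pos : forall x (v : 'rV[R]_n), v != 0 -> 0 < (v *m gram x *m v^T) 0 0;
  gram_smooth : forall k (z : M) (i j : 'I_n),
    Ck k (cimg (chart_at z))
       ((fun q => gram_in gram (chart_at z) q i j) : 'rV[R]_n -> R^o)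
}.

Definition tnorm (R : realType) (n : nat) (M : manifold R n)
    (g : riemannian_metric M) (x : M) (v : 'rV[R]_n) : R :=
  Num.sqrt ((v *m g x *m v^T) 0 0).

Definition conorm (R : realType) (n : nat) (M : manifold R n)
    (g : riemannian_metric M) (x : M) (p : 'rV[R]_n) : R :=
  Num.sqrt ((p *m invmx (g x) *m p^T) 0 0).

Definition velocity (R : realType) (n : nat) (M : manifold R n)
    (gamma : R -> M) (s : R) : 'rV[R]_n :=
  'D_1 ((cmap (chart_at (gamma s)) \o gamma) : R^o -> 'rV[R]_n) s.

(* C^1 on the compact interval [0, t], in the sense of being defined and C^1
   around each of its points. *)
Definition C1_curve (R : realType) (n : nat) (M : manifold R n) (t : R)
    (gamma : R -> M) : Prop :=
  forall s, 0 <= s <= t ->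
    let f : R^o -> 'rV[R]_n := cmap (chart_at (gamma s)) \o gamma in
    [/\ {for s, continuous gamma},
        (\forall u \near s, derivable f u 1) &
        {for s, continuous ('D_1 f)}].

Definition rdist (R : realType) (n : nat) (M : manifold R n)
    (g : riemannian_metric M) (x y : M) : R :=
  inf [set \int[@lebesgue_measure R]_(s in `[0, 1])
             tnorm g (gamma s) (velocity gamma s) | gamma in
       [set gamma : R -> M |
         [/\ C1_curve 1 gamma, gamma 0 = x & gamma 1 = y]]].

Definition rball (R : realType) (n : nat) (M : manifold R n)
    (g : riemannian_metric M) (x : M) (r : R) : set M :=
  [set y | rdist g x y < r].

Definition abs_continuous_curve (R : realType) (n : nat) (M : manifold R n)
    (g : riemannian_metric M) (t : R) (xi : R -> M) : Prop :=
  forall e : R, 0 < e -> exists2 delta : R, 0 < delta &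
    forall (m : nat) (a b : 'I_m -> R),
      (forall k, [/\ 0 <= a k, a k <= b k & b k <= t]) ->
      (forall j k, j != k -> b j <= a k \/ b k <= a j) ->
      \sum_k (b k - a k) < delta ->
      \sum_k rdist g (xi (a k)) (xi (b k)) < e.

(* The closures are taken in the manifold; since the extended chart is a
   homeomorphism, on a compact manifold this says equally that its image
   contains the closed ball. *)
Record ball_atlas (R : realType) (n : nat) (M : manifold R n)
    (g : riemannian_metric M) := BallAtlas {
  aidx : finType;
  achart : aidx -> chart R n M;
  achart_smooth : forall i, smooth_chart (achart i);
  achart_cover : forall x, exists i, cdom (achart i) x;
  achart_ball : forall i, exists q r,
    0 < r /\ cimg (achart i) = [set q' | enorm (q' - q) < r];
  achart_extends : forall i, exists c : chart R n M,
    [/\ smooth_chart c,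
        closure (cdom (achart i)) `<=` cdom c &
        forall x, cdom (achart i) x -> cmap c x = cmap (achart i) x];
  achart_nearby : exists2 delta : R, 0 < delta &
    forall x y, rdist g x y < delta ->
      exists i, cdom (achart i) x /\ cdom (achart i) y
}.

Definition in_coords (R : realType) (n : nat) (M : manifold R n)
    (c : chart R n M) (f : M -> R) : 'rV[R]_n -> R^o := f \o cinv c.

Definition differentiable_at (R : realType) (n : nat) (M : manifold R n)
    (f : M -> R) (x : M) : Prop :=
  differentiable (in_coords (chart_at x) f) (cmap (chart_at x) x).

Definition Dfun (R : realType) (n : nat) (M : manifold R n)
    (f : M -> R) (x : M) : 'rV[R]_n :=
  \row_i 'D_(delta_mx 0 i) (in_coords (chart_at x) f) (cmap (chart_at x) x).

Definition C1_on (R : realType) (n : nat) (M : manifold R n)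
    (A : set M) (f : M -> R) : Prop :=
  forall z, Ck 1 (cmap (chart_at z) @` (cdom (chart_at z) `&` A))
                 (in_coords (chart_at z) f).

Definition Dplus (R : realType) (n : nat) (M : manifold R n)
    (g : riemannian_metric M) (phi : M -> R) (x : M) : set 'rV[R]_n :=
  [set p | exists (r : R) (psi : M -> R),
    [/\ 0 < r, C1_on (rball g x r) psi,
        (forall y, rball g x r y -> phi y <= psi y),
        psi x = phi x & p = Dfun psi x]].

(* A Hamiltonian is a function of [x] and of a covector at [x]. *)
Definition hamiltonian (R : realType) (n : nat) (M : manifold R n) : Type :=
  M -> 'rV[R]_n -> R^o.

Definition ham_in (R : realType) (n : nat) (M : manifold R n)
    (H : hamiltonian M) (c : chart R n M) (qp : 'rV[R]_n * 'rV[R]_n) : R^o :=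
  H (cinv c qp.1) (cov_of c (cinv c qp.1) qp.2).

Definition tonelli (R : realType) (n : nat) (M : manifold R n)
    (g : riemannian_metric M) (H : hamiltonian M) : Prop :=
  [/\ (forall z, Ck 2 (cimg (chart_at z) `*` setT) (ham_in H (chart_at z))),
      (forall x p v, v != 0 -> 0 < 'D_v ('D_v (H x)) p) &
      (forall K : R, exists r : R, forall x p,
         r <= conorm g x p -> K * conorm g x p <= H x p)].

Definition lagrangian (R : realType) (n : nat) (M : manifold R n)
    (H : hamiltonian M) (x : M) (v : 'rV[R]_n) : R :=
  sup [set pairing p v - H x p | p in [set: 'rV[R]_n]].

Definition action (R : realType) (n : nat) (M : manifold R n)
    (H : hamiltonian M) (t : R) (xi : R -> M) : \bar R :=
  (\int[@lebesgue_measure R]_(s in `[0%R, t])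
     (lagrangian H (xi s) (velocity xi s))%:E)%E.

Definition min_action (R : realType) (n : nat) (M : manifold R n)
    (g : riemannian_metric M) (H : hamiltonian M) (t : R) (x y : M) : \bar R :=
  ereal_inf [set action H t xi | xi in
    [set xi : R -> M |
      [/\ abs_continuous_curve g t xi, xi 0 = x & xi t = y]]].

Definition mane_critical_value (R : realType) (n : nat) (M : manifold R n)
    (g : riemannian_metric M) (H : hamiltonian M) : \bar R :=
  ereal_inf [set k%:E | k in
    [set k : R | forall (t : R) (xi : R -> M), 0 < t ->
      abs_continuous_curve g t xi -> xi 0 = xi t ->
      (0 <= action H t xi + (k * t)%:E)%E]].

Definition weak_kam (R : realType) (n : nat) (M : manifold R n)
    (g : riemannian_metric M) (H : hamiltonian M) (phi : M -> R) : Prop :=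
  forall (t : R) (x : M), 0 < t ->
    (phi x)%:E =
      ereal_inf [set ((phi y)%:E + min_action g H t y x)%E | y in [set: M]].

Definition cut_time (R : realType) (n : nat) (M : manifold R n)
    (g : riemannian_metric M) (H : hamiltonian M) (phi : M -> R) (x : M) :
    \bar R :=
  ereal_sup [set t%:E | t in
    [set t : R | t = 0 \/
      (0 < t /\ exists gamma : R -> M,
        [/\ C1_curve t gamma, gamma 0 = x &
            (phi (gamma t) - phi x)%:E = min_action g H t x (gamma t)])]].

Definition cut_set (R : realType) (n : nat) (M : manifold R n)
    (g : riemannian_metric M) (H : hamiltonian M) (phi : M -> R) (t : R) :
    set M :=
  [set x | (t%:E <= cut_time g H phi x)%E].

(* Main.v *)
(* The proof is local, in a chart around each point of [M].  There a near
   minimiser of the action ending at [y] is a calibrated curve [z] on [[0, t]].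
   Translating [z] by [(s / t) *: h] gives a competitor ending at [y + h], and the
   second order expansion of the Lagrangian along [z] yields
   [phi (y + h) <= phi y + <p, h> + K / t * |h|^2 + e] for all [y], with [K] and
   the bound on [p] depending only on [H].  If [t] is at most the cut time of [x],
   a minimiser leaves [x] as well, and the same argument with time reversed gives
   the opposite inequality at [x].  So [phi] lies between two paraboloids of
   opening [K / t] at [x], hence is differentiable there, and comparing with the
   upper paraboloids at nearby points bounds the distance of supergradients to
   [D phi x].  Only the Hamiltonian enters: the Lagrangian is handled through the
   covectors attaining the supremum which defines it. *)

From HB Require Import structures.
Require Import Defs.
From mathcomp Require Import all_boot all_order all_algebra.
From mathcomp Require Import all_classical all_reals all_analysis.
From mathcomp.analysis Require Import measurable_realfun.
From mathcomp Require Import ring lra zify.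

Set Implicit Arguments.
Unset Strict Implicit.
Unset Printing Implicit Defensive.

Import Order.TTheory GRing.Theory Num.Theory.
Import numFieldNormedType.Exports.

Local Open Scope classical_set_scope.
Local Open Scope ring_scope.

(** * Absolutely continuous functions of a real variable *)

(** The infima in [weak_kam] and [min_action] are not known to be attained, so the proof works with
    [near_minimiser] curves of arbitrarily small error and uses no regularity of minimisers. Such a
    curve has no pointwise velocity bound: playing its calibration against the Lipschitz bound of
    the solution controls increments only, up to the error. The comparison along it is therefore
    discretised. On a step of length [d], with error at most [d ^+ 2], the velocity is replaced by
    the mean velocity, which is bounded, and the errors are of order [d ^+ 2] per step, hence vanish
    as the steps shrink. Domination is then tested on straight chart segments and calibration
    against constant covectors, so that neither mentions a derivative of the curve. The price is a
    slack [e], and a covector depending on it, in [upper_quadratic]; compactness of a ball of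
    covectors removes both. A second obstacle is that the Lagrangian along a curve is not measurable
    for free: integrals are compared without measurability where possible, and a measurable
    representative is constructed where additivity is needed. *)

Definition sep_itv (R : realType) : rel (R * R) :=
  fun x y => (x.2 <= y.1) || (y.2 <= x.1).

(** The intervals form a sequence in any order, degenerate ones allowed, so that an interval can be
    replaced by a partition of it by mere concatenation. The condition is on the whole line;
    functions on a segment are brought to this form by [clamp]. *)
Definition abs_cont (R : realType) (f : R -> R) : Prop :=
  forall e : R, 0 < e -> exists2 d : R, 0 < d & forall s : seq (R * R),
    all (fun x => x.1 <= x.2) s -> pairwise (@sep_itv R) s ->
    \sum_(x <- s) (x.2 - x.1) < d -> \sum_(x <- s) `|f x.2 - f x.1| <= e.

Lemma sep_itvS (R : realType) (a b : R) (x y : R * R) :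
  a <= x.1 -> x.2 <= b -> sep_itv (a, b) y -> sep_itv x y.
Proof.
rewrite /sep_itv /= => ax xb /orP[by1|ya].
  by rewrite (le_trans xb by1).
by rewrite (le_trans ya ax) orbT.
Qed.

Lemma partition_zip (R : realType) (a b : R) (l : seq R) :
  itv_partition a b l ->
  let P := zip (a :: l) l in
  [/\ all (fun x => [&& a <= x.1, x.1 <= x.2 & x.2 <= b]) P,
      pairwise (@sep_itv R) P & \sum_(x <- P) (x.2 - x.1) = b - a].
Proof.
elim: l a => [|h t ih] a [].
  by move=> _ /eqP /= <-; split => //; rewrite big_nil subrr.
rewrite [path _ _ _]/= => /andP[ah pt] lt.
have /ih[h1 h2 h3] : itv_partition h b t by split.
have hb : h <= b.
  move: lt => /= /eqP <-; exact: unstable.path_lt_le_last pt.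
rewrite [zip _ _]/=; split.
- rewrite [all _ _]/= lexx (ltW ah) hb /=.
  apply/allP => x /(allP h1) /and3P[hx x12 xb].
  by rewrite x12 xb (le_trans (ltW ah) hx).
- rewrite pairwise_cons h2 andbT.
  by apply/allP => x /(allP h1) /and3P[hx x12 xb]; rewrite /sep_itv /= hx.
- by rewrite big_cons h3 /= addrC addrA subrK.
Qed.

(** Induction on [s]. The pieces of a partition of the head interval have the same total length as
    the interval, so they can be moved into [s'] without affecting the hypotheses; the supremum over
    all partitions then turns the head into its total variation. *)
Lemma abs_cont_sum_TV (R : realType) (f : R -> R) (d e : R) :
  (forall s : seq (R * R),
    all (fun x => x.1 <= x.2) s -> pairwise (@sep_itv R) s ->
    \sum_(x <- s) (x.2 - x.1) < d -> \sum_(x <- s) `|f x.2 - f x.1| <= e) ->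
  forall s s' : seq (R * R),
    all (fun x => x.1 <= x.2) (s ++ s') -> pairwise (@sep_itv R) (s ++ s') ->
    \sum_(x <- s ++ s') (x.2 - x.1) < d ->
    (\sum_(x <- s) total_variation x.1 x.2 f
      + (\sum_(x <- s') `|f x.2 - f x.1|)%:E <= e%:E)%E.
Proof.
move=> hf; elim => [|[a b] s ih] s' als pws ls.
  by rewrite big_nil add0e lee_fin; exact: hf.
rewrite big_cons /= -addeA.
set S := (X in (_ + X <= _)%E).
have Sge0 : (0 <= S)%E.
  apply: adde_ge0; last by rewrite lee_fin sumr_ge0.
  rewrite big_seq; apply: sume_ge0 => x xs; apply: total_variation_ge0.
  by move/allP : als; apply; rewrite /= in_cons mem_cat xs orbT.
have key (l : seq R) : itv_partition a b l ->
    ((variation a b f l)%:E + S <= e%:E)%E.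
  move=> pl; have [p1 p2 p3] := partition_zip pl.
  rewrite variation_zip// /S addeCA -EFinD.
  have -> : \sum_(x <- zip l (a :: l)) `|f x.1 - f x.2| =
            \sum_(x <- zip (a :: l) l) `|f x.2 - f x.1|.
    elim: l {pl p1 p2 p3} (a) => [|h t iht] a'; first by rewrite !big_nil.
    by rewrite [zip _ _]/= [X in _ = \sum_(_ <- X) _]/= !big_cons /= iht.
  rewrite -big_cat /=.
  move: als pws ls => /=; rewrite big_cons /= => /andP[ab als] /andP[/allP sab pws] ls.
  apply: ih.
  - rewrite all_cat all_cat; move: als; rewrite all_cat => /andP[-> ->].
    rewrite andbT /=; apply/allP => x /(allP p1) /and3P[//].
  - move: pws; rewrite !pairwise_cat => /and3P[ss' ps ps'].
    rewrite ps ps' p2 !andbT /=; apply/andP; split.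
      apply/allrelP => x y xs; rewrite mem_cat => /orP[yP|ys']; last first.
        exact: (allrelP ss').
      move/allP : p1 => /(_ _ yP) /and3P[ay _ yb].
      rewrite /sep_itv orbC; apply: (sep_itvS ay yb).
      by apply: sab; rewrite mem_cat xs.
    apply/allrelP => x y xP ys'; move/allP : p1 => /(_ _ xP) /and3P[ay _ yb].
    by apply: (sep_itvS ay yb); apply: sab; rewrite mem_cat ys' orbT.
  - move: ls; rewrite !big_cat /= p3 => ls; apply: le_lt_trans ls.
    by rewrite addrCA.
have ab : a <= b by move: als => /= /andP[].
(* Finiteness lets [S] be carried to the other side of the inequality. It comes from the bound for a
   single partition of [[a, b]], the empty one when [a = b]. *)
have Sfin : S \is a fin_num.
  rewrite ge0_fin_numE//.
  move: ab; rewrite le_eqVlt => /orP[/eqP ab|ab].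
    have : itv_partition a b [::] by split => //=; apply/eqP.
    move/key; rewrite variation_nil add0e => /le_lt_trans; apply; exact: ltry.
  have := key _ (itv_partition1 ab) => h.
  have : (S <= e%:E)%E by apply: le_trans h; rewrite leeDr// lee_fin variation_ge0.
  by move=> /le_lt_trans; apply; exact: ltry.
rewrite -leeBrDr//; apply: ge_ereal_sup => _ [_ [l /= pl <-] <-].
by rewrite leeBrDr//; exact: key.
Qed.

Lemma abs_cont_TV (R : realType) (f : R -> R) : abs_cont f ->
  forall e : R, 0 < e -> exists2 d : R, 0 < d & forall s : seq (R * R),
    all (fun x => x.1 <= x.2) s -> pairwise (@sep_itv R) s ->
    \sum_(x <- s) (x.2 - x.1) < d ->
    (\sum_(x <- s) total_variation x.1 x.2 f <= e%:E)%E.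
Proof.
move=> acf e e0; have [d d0 hd] := acf e e0; exists d => // s als ps ls.
have := @abs_cont_sum_TV _ f d e hd s [::].
by rewrite big_nil adde0 cats0; apply.
Qed.

(** The variation is at most [1] on intervals shorter than some [d], and finitely many steps of
    length [d / 2] cover [[a, b]]. *)
Lemma abs_cont_TV_fin (R : realType) (f : R -> R) (a b : R) : abs_cont f ->
  a <= b -> total_variation a b f \is a fin_num.
Proof.
move=> acf; have [d d0 hd] := abs_cont_TV acf ltr01.
have d20 : 0 < d / 2 by lra.
have fin x y : x <= y -> y - x < d -> total_variation x y f \is a fin_num.
  move=> xy yxd; rewrite ge0_fin_numE ?total_variation_ge0//.
  have := hd [:: (x, y)]; rewrite /= xy !big_seq1 => /(_ isT isT yxd).
  by move/le_lt_trans; apply; exact: ltry.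
move=> ab; have [N] : exists N, b - a < (d / 2) *+ N.
  exists (Num.bound ((b - a) / (d / 2))).
  rewrite -mulr_natr -ltr_pdivrMl// mulrC.
  by rewrite archi_boundP// divr_ge0 ?subr_ge0// ltW.
elim: N a ab => [|N ih] a ab abN.
  by move: abN; rewrite mulr0n subr_lt0 ltNge ab.
have [h|h] := ltP (b - a) d; first exact: fin.
have ad : a <= a + d / 2 by lra.
have db : a + d / 2 <= b by lra.
rewrite (total_variationD f ad db) fin_numD fin//=; last by lra.
by apply: ih => //; move: abN; rewrite mulrS; lra.
Qed.

Lemma abs_cont_continuous (R : realType) (f : R -> R) :
  abs_cont f -> continuous f.
Proof.
move=> acf x; apply/cvgrPdist_le => e e0; have [d d0 hd] := acf e e0.
near=> y.
have xyd : `|x - y| < d by near: y; apply: cvgr_dist_lt d0; exact: cvg_id.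
have [xy|yx] := leP x y.
  have := hd [:: (x, y)]; rewrite /= xy !big_seq1 /= distrC; apply => //.
  by rewrite -(ger0_norm (_ : 0 <= y - x)) ?subr_ge0// distrC.
have := hd [:: (y, x)]; rewrite /= (ltW yx) !big_seq1 /=; apply => //.
by rewrite -(ger0_norm (_ : 0 <= x - y)) ?subr_ge0// ltW.
Unshelve. all: by end_near. Qed.

(** Projection onto [[a, b]]. Composing with it extends a function from a segment to the line by
    constants and keeps absolute continuity. *)
Definition clamp (R : realType) (a b x : R) : R := Num.min b (Num.max a x).

Lemma clamp_id (R : realType) (a b x : R) : a <= x <= b -> clamp a b x = x.
Proof. by move=> /andP[ax xb]; rewrite /clamp (max_idPr ax) (min_idPr xb). Qed.

Lemma clamp_itv (R : realType) (a b x : R) : a <= b -> a <= clamp a b x <= b.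
Proof. by move=> ab; rewrite /clamp le_min ab le_max lexx ge_min lexx. Qed.

Lemma clamp_nd (R : realType) (a b x y : R) : x <= y -> clamp a b x <= clamp a b y.
Proof. by rewrite /clamp /Num.min /Num.max => xy; do ![case: ifPn => //]; lra. Qed.

Lemma clamp_contract (R : realType) (a b x y : R) : a <= b -> x <= y ->
  clamp a b y - clamp a b x <= y - x.
Proof. by rewrite /clamp /Num.min /Num.max => ab xy; do ![case: ifPn => //]; lra. Qed.

Lemma clamp_seq (R : realType) (a b : R) (s : seq (R * R)) : a <= b ->
  all (fun x => x.1 <= x.2) s -> pairwise (@sep_itv R) s ->
  let s' := [seq (clamp a b x.1, clamp a b x.2) | x <- s] in
  [/\ all (fun x => x.1 <= x.2) s', pairwise (@sep_itv R) s' &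
    \sum_(x <- s') (x.2 - x.1) <= \sum_(x <- s) (x.2 - x.1)].
Proof.
move=> ab als ps; split.
- by rewrite all_map; apply: sub_all als => x /=; exact: clamp_nd.
- rewrite pairwise_map; apply: sub_pairwise ps => x y /orP[h|h];
  by rewrite /sep_itv /= (clamp_nd _ _ h) ?orbT.
- rewrite big_map /= !big_seq; apply: ler_sum => x xs.
  by apply: clamp_contract => //; move/allP : als; exact.
Qed.

Lemma abs_cont_clamp (R : realType) (f : R -> R) (a b : R) : a <= b ->
  abs_cont f -> abs_cont (f \o clamp a b).
Proof.
move=> ab acf e e0; have [d d0 hd] := acf e e0; exists d => // s als ps ls.
have [h1 h2 h3] := clamp_seq ab als ps.
by have := hd _ h1 h2 (le_lt_trans h3 ls); rewrite big_map.
Qed.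

Lemma abs_contB (R : realType) (f g : R -> R) :
  abs_cont f -> abs_cont g -> abs_cont (f \- g).
Proof.
move=> acf acg e e0; have e20 : 0 < e / 2 by lra.
have [d d0 hd] := acf _ e20; have [d' d'0 hd'] := acg _ e20.
exists (Num.min d d'); first by rewrite lt_min d0.
move=> s als ps; rewrite lt_min => /andP[l1 l2].
have -> : e = e / 2 + e / 2 by lra.
apply: le_trans (lerD (hd s als ps l1) (hd' s als ps l2)).
rewrite -big_split /=; apply: ler_sum => x _.
rewrite (_ : (f \- g) x.2 - (f \- g) x.1 = (f x.2 - f x.1) - (g x.2 - g x.1)).
  exact: ler_normB.
by rewrite /=; lra.
Qed.

(** Jordan decomposition: [g1] is the variation of [f] from [a], and [g2] is [g1] minus [f].
    Clamping the argument makes both parts monotone and absolutely continuous on the whole line, so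
    that they define Stieltjes measures. *)
Lemma abs_cont_decomp (R : realType) (f : R -> R) (a b : R) : a <= b ->
  abs_cont f -> exists g1 g2 : R -> R,
  [/\ {homo g1 : x y / x <= y}, {homo g2 : x y / x <= y}, abs_cont g1, abs_cont g2 &
    forall x, a <= x <= b -> f x = g1 x - g2 x].
Proof.
move=> ab acf; pose g1 x := fine (total_variation a (clamp a b x) f).
have TVD x y : x <= y -> g1 y - g1 x =
    fine (total_variation (clamp a b x) (clamp a b y) f).
  move=> xy; have /andP[ax xb] := clamp_itv x ab; have cxy := clamp_nd a b xy.
  rewrite /g1 (total_variationD f ax cxy) fineD ?abs_cont_TV_fin//.
  by rewrite addrC addKr.
have TVge x y : x <= y -> `|f (clamp a b y) - f (clamp a b x)| <= g1 y - g1 x.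
  move=> xy; rewrite TVD// -lee_fin fineK ?abs_cont_TV_fin ?clamp_nd//.
  by apply: total_variation_ge; exact: clamp_nd.
have acg1 : abs_cont g1.
  move=> e e0; have [d d0 hd] := abs_cont_TV acf e0; exists d => // s als ps ls.
  have [h1 h2 h3] := clamp_seq ab als ps.
  have := hd _ h1 h2 (le_lt_trans h3 ls); rewrite big_map -lee_fin.
  apply: le_trans; rewrite -sumEFin !big_seq; apply: lee_sum => x xs.
  have x12 : x.1 <= x.2 by move/allP : als; exact.
  rewrite ger0_norm; last by apply: le_trans (TVge _ _ x12); exact: normr_ge0.
  by rewrite TVD// fineK// abs_cont_TV_fin// clamp_nd.
exists g1, (g1 \- (f \o clamp a b)); split => //.
- by move=> x y xy; rewrite -subr_ge0; apply: le_trans (TVge _ _ xy).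
- move=> x y xy /=; have := TVge _ _ xy.
  by move=> /(le_trans (ler_norm _)); lra.
- by apply: abs_contB => //; exact: abs_cont_clamp.
- by move=> x xab; rewrite /= clamp_id//; lra.
Qed.

Lemma stieltjes_itvoc (R : realType) (g : cumulative R R) (a b : R) : a <= b ->
  lebesgue_stieltjes_measure g `]a, b]%classic = (g b - g a)%:E.
Proof.
move=> ab; rewrite /lebesgue_stieltjes_measure /measure_extension /=.
rewrite measurable_mu_extE /=; last exact: is_ocitv.
by rewrite wlength_itv_bnd.
Qed.

(** The endpoints are finite because the measure is, and lie outside [J] because [J] is open. The
    half-open interval is the shape on which a Stieltjes measure is computed; the open one serves to
    separate the endpoints of disjoint components. *)
Lemma open_interval_length (R : realType) (J : set R) :
  open J -> is_interval J -> (lebesgue_measure J < +oo)%E ->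
  exists ab : R * R, [/\ ab.1 <= ab.2, J `<=` `]ab.1, ab.2]%classic,
    `]ab.1, ab.2[%classic `<=` J & lebesgue_measure J = (ab.2 - ab.1)%:E].
Proof.
move=> oJ iJ; have [->|/set0P[z Jz]] := eqVneq J set0.
  by exists (0, 0) => /=; split; rewrite ?lexx ?subrr ?measure0// => y /=; rewrite in_itv /= => /andP[]; lra.
have := RhullK (mem_set iJ); move: Jz oJ.
case: (Rhull J) => [] [b1 x|b1] [b2 y|b2] + + /esym JE; rewrite JE {J iJ JE} => /= Jz oJ;
  rewrite lebesgue_measure_itv /= => hJ; last first.
- by move: hJ; case: b1 {oJ} Jz; case: b2 => //=; rewrite in_itv.
- by move: hJ Jz {oJ}; case: b1; rewrite ?in_itv /= ?ltNyr ?ltry //=.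
- by move: hJ Jz {oJ}; case: b2; rewrite ?in_itv /= ?ltNyr ?ltry ?andbF //=.
have nx : ~ [set` Interval (BSide b1 x) (BSide b2 y)] x.
  move=> Jx; have /nbhs_ballP[e /= e0 he] := open_nbhs_nbhs (conj oJ Jx).
  have /he : ball x e (x - e / 2).
    by rewrite /ball /= opprB addrC subrK gtr0_norm; lra.
  by rewrite /= in_itv; case: b1 {oJ Jz hJ he Jx} => /= /andP[]; lra.
have xz : x <= z by move: Jz; rewrite in_itv; case: b1 {oJ hJ nx} => /= /andP[]; lra.
have zy : z <= y by move: Jz; rewrite in_itv; case: b2 {oJ hJ nx} => /= /andP[]; lra.
have xy : x <= y by lra.
exists (x, y) => /=; split => //.
- move=> u /= Ju; rewrite in_itv /= lt_neqAle; apply/andP; split; last first.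
    by move: Ju; rewrite in_itv; case: b2 {oJ hJ nx Jz} => /= /andP[]; lra.
  apply/andP; split; first by apply/eqP => xu; apply: nx; rewrite {2}xu.
  by move: Ju; rewrite in_itv; case: b1 {oJ hJ nx Jz} => /= /andP[]; lra.
- by move=> u /=; rewrite !in_itv /=; case: b1 {oJ hJ nx Jz}; case: b2 => /= /andP[h1 h2];
    rewrite ?h1 ?h2 ?(ltW h1) ?(ltW h2).
- by rewrite lte_fin; case: ltgtP xy => // -> _; rewrite subrr.
Qed.

(** A null set lies in an open set of measure below [d], which is a disjoint union of open
    intervals; absolute continuity bounds the increments of [g] over any finite number of them by
    [e]. *)
Lemma stieltjes_dominates (R : realType) (g : cumulative R R) : abs_cont g ->
  lebesgue_stieltjes_measure g `<< @lebesgue_measure R.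
Proof.
move=> acg; apply/null_content_dominatesP => N mN N0.
apply/eqP; rewrite eq_le measure_ge0 andbT; apply/lee_addgt0Pr => e e0.
rewrite add0e; have [d d0 hd] := acg e e0.
have [|U [oU NU UNd]] := lebesgue_regularity_outer mN _ d0.
  by rewrite N0.
have Ud : (lebesgue_measure U < d%:E)%E.
  rewrite (_ : U = (U `\` N) `|` N); last by rewrite setUC setDUK.
  apply: le_lt_trans (measureU2 _ _ _) _ => //; first by apply: measurableD => //; exact: open_measurable.
  by rewrite [X in (_ + X < _)%E](_ : _ = 0%E) ?adde0.
have mU : measurable U by exact: open_measurable.
pose I k := open_disjoint_itv oU k.
have mI k : measurable (I k) by apply: open_measurable; exact: open_disjoint_itv_open.
have tI : trivIset setT I .
  exact: open_disjoint_itv_trivIset.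
apply: (@le_trans _ _ (lebesgue_stieltjes_measure g U)).
  by apply: le_measure => //; rewrite inE//; exact: open_measurable.
rewrite (open_disjoint_itv_bigcup oU) measure_bigcup//; last by move=> k _; exact: mI.
have finI k : (lebesgue_measure (I k) < +oo)%E.
  apply: le_lt_trans (lt_trans Ud (ltry d)).
  apply: le_measure; rewrite ?inE; [exact: mI|exact: mU|].
  by rewrite [X in _ `<=` X](open_disjoint_itv_bigcup oU); exact: bigcup_sup.
have /choice[ab hab] k := open_interval_length (@open_disjoint_itv_open _ _ oU k)
  (@open_disjoint_itv_is_interval _ _ oU k) (finI k).
apply: lime_le; first by apply: is_cvg_nneseries => ? _ _; exact: measure_ge0.
near=> n.
have e1 : (\sum_(0 <= k < n | k \in setT) lebesgue_stieltjes_measure g (I k) <=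
   (\sum_(0 <= k < n) (g (ab k).2 - g (ab k).1))%:E)%E.
  rewrite -sumEFin (eq_bigl xpredT); last by move=> k; rewrite in_setT.
  apply: lee_sum => k _; have [ab1 Iab _ _] := hab k.
  by rewrite -stieltjes_itvoc//; apply: le_measure; rewrite ?inE//; exact: mI.
apply: le_trans e1 _; rewrite lee_fin.
(* Empty components are dropped: their two endpoints are equal but otherwise arbitrary, and such a
   point may fall inside another interval and break the separation. *)
pose s := [seq ab k | k <- index_iota 0 n & (ab k).1 < (ab k).2].
have big0 (h : R -> R) : \sum_(0 <= k < n) (h (ab k).2 - h (ab k).1) =
    \sum_(x <- s) (h x.2 - h x.1).
  rewrite /s big_map big_filter [RHS]big_mkcond /=; apply: eq_bigr => k _.
  case: ifPn => //; rewrite -leNgt => le21; have [le12 _ _ _] := hab k.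
  by have -> : (ab k).1 = (ab k).2; [apply/le_anti; rewrite le12 le21 | rewrite subrr].
rewrite big0; apply: le_trans (hd s _ _ _).
- by apply: ler_sum => x _; exact: ler_norm.
- rewrite all_map; apply/allP => k; rewrite mem_filter => /andP[/ltW]; exact.
- rewrite pairwise_map.
  have : pairwise ltn (index_iota 0 n) by rewrite -sorted_pairwise ?iota_ltn_sorted//; exact: ltn_trans.
  move=> /(pairwise_filter (fun k => (ab k).1 < (ab k).2)).
  apply: (sub_in_pairwise (P := fun k => (ab k).1 < (ab k).2)).
    move=> j k jP kP jk; have [_ _ Ij _] := hab j; have [_ _ Ik _] := hab k.
    move: jP kP; rewrite !unfold_in => jP kP.
    apply: contraT; rewrite /= /sep_itv negb_or -!ltNge => /andP[h1 h2].
    pose u := Num.max (ab j).1 (ab k).1; pose v := Num.min (ab j).2 (ab k).2.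
    have uv : u < v by rewrite lt_min !gt_max; apply/andP; split; apply/andP; split.
    have [ju ku] : (ab j).1 <= u /\ (ab k).1 <= u by split; rewrite le_max lexx ?orbT.
    have [vj vk] : v <= (ab j).2 /\ v <= (ab k).2 by split; rewrite ge_min lexx ?orbT.
    have Ijm : I j ((u + v) / 2) by apply: Ij; rewrite /= in_itv /=; lra.
    have Ikm : I k ((u + v) / 2) by apply: Ik; rewrite /= in_itv /=; lra.
    have jkE : j = k by apply: tI => //; exists ((u + v) / 2).
    by move: jk; rewrite jkE /= ltnn.
  by apply/allP => k; rewrite mem_filter => /andP[].
- rewrite -(big0 idfun) -lte_fin; apply: le_lt_trans Ud.
  rewrite (open_disjoint_itv_bigcup oU) measure_bigcup//; last by move=> k _; exact: mI.
  rewrite -sumEFin; rewrite (eq_bigr (fun k => lebesgue_measure (I k))); last by move=> k _; have [_ _ _ <-] := hab k.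
  rewrite (eq_bigl (fun k => k \in [set: nat])); last by move=> k; rewrite in_setT.
  by apply: nneseries_lim_ge => *; exact: measure_ge0.
Unshelve. all: by end_near. Qed.

(** The density is the Radon-Nikodym derivative of the Stieltjes measure of [g], restricted to []a,
    b]] to make it finite. *)
Lemma abs_cont_nd_density (R : realType) (g : R -> R) (a b : R) :
  {homo g : x y / x <= y} -> abs_cont g -> a < b ->
  exists h : R -> R, lebesgue_measure.-integrable setT (EFin \o h) /\
    forall x, a <= x <= b ->
      g x - g a = \int[lebesgue_measure]_(t in `]a, x]) h t.
Proof.
move=> ndg acg ab.
have rc : right_continuous g.
  by move=> x; apply: cvg_at_right_filter; exact: abs_cont_continuous.
pose G : cumulative R R := HB.pack_for (cumulative R R) g (isCumulative.Build R _ R g ndg rc).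
pose D : set (measurableTypeR R) := `]a, b]%classic.
have mD : measurable D by exact: measurable_itv.
have Doo : (lebesgue_stieltjes_measure G D < +oo)%E.
  by rewrite stieltjes_itvoc ?ltW//; exact: ltry.
pose nu : {finite_measure set (measurableTypeR R) -> \bar R} := mfrestr mD Doo.
have numu : nu `<< @lebesgue_measure R.
  apply/null_content_dominatesP => A mA A0; rewrite /nu /mfrestr /mrestr.
  have /null_content_dominatesP := @stieltjes_dominates R G acg.
  apply; first exact: measurableI.
  apply/eqP; rewrite eq_le measure_ge0 andbT -A0.
  by apply: le_measure; rewrite ?inE//; exact: measurableI.
pose f := Radon_Nikodym_SigmaFinite.f nu lebesgue_measure.
have ffin x : f x \is a fin_num by exact: Radon_Nikodym_SigmaFinite.f_fin_num.
have hf : EFin \o (fine \o f) = f by apply/funext => x /=; rewrite fineK.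
exists (fine \o f); split.
  by rewrite hf; exact: Radon_Nikodym_SigmaFinite.f_integrable.
move=> x /andP[ax xb]; rewrite /Rintegral.
have -> : (\int[lebesgue_measure]_(t in `]a, x]) ((fine \o f) t)%:E)%E =
    nu `]a, x]%classic.
  rewrite (Radon_Nikodym_SigmaFinite.f_integral numu)//.
  by apply: eq_integral => t _; rewrite -[RHS]fineK.
rewrite /nu /= /mfrestr /mrestr setIidl.
  by rewrite stieltjes_itvoc.
by move=> t /=; rewrite /D /= !in_itv /= => /andP[-> /le_trans->].
Qed.

Definition ftc_density (R : realType) (f h : R -> R) (a b : R) : Prop :=
  [/\ lebesgue_measure.-integrable setT (EFin \o h),
    (forall x y, a <= x -> x <= y -> y <= b ->
      f y - f x = \int[lebesgue_measure]_(t in `[x, y]) h t) &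
    {ae lebesgue_measure, forall x, a < x < b -> is_derive x (1 : R^o) (f : R^o -> R^o) (h x)}].

Lemma ftc_density_B (R : realType) (f g h k : R -> R) (a b : R) :
  ftc_density f h a b -> ftc_density g k a b ->
  ftc_density (f \- g) (h \- k) a b.
Proof.
move=> [ih hh dh] [ik hk dk]; split.
- by rewrite (_ : _ \o _ = (EFin \o h) \- (EFin \o k))%E; [exact: integrableB | exact/funext].
- move=> x y ax xy yb; rewrite RintegralB//; last 2 first.
    by apply: integrableS ih.
    by apply: integrableS ik.
  by rewrite -hh// -hk//=; lra.
- move: dh dk; apply: (@filterS2 _ _ (ae_filter_ringOfSetsType lebesgue_measure)) => x h1 h2 xab.
  have := h1 xab; have := h2 xab => ? ?; exact: is_deriveB.
Qed.

Lemma abs_cont_nd_ftc (R : realType) (g : R -> R) (a b : R) :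
  {homo g : x y / x <= y} -> abs_cont g -> a < b ->
  exists h : R -> R, ftc_density g h a b.
Proof.
move=> ndg acg ab; have [h [ih hg]] := abs_cont_nd_density ndg acg ab.
exists h; split => //.
- move=> x y ax xy yb.
  have ih' (i : interval R) : lebesgue_measure.-integrable [set` i] (EFin \o h).
    by apply: integrableS ih.
  have -> : g y - g x = (g y - g a) - (g x - g a) by lra.
  rewrite !hg ?ax//=; last 2 first.
    by rewrite (le_trans xy yb).
    by rewrite (le_trans ax xy) yb.
  by rewrite Rintegral_itvB ?bnd_simp// Rintegral_itv_obnd_cbnd.
- have ih' (i : interval R) : lebesgue_measure.-integrable [set` i] (EFin \o h).
    by apply: integrableS ih.
  have lh : locally_integrable setT h by exact: open_integrable_locally openT ih.
  have := @FTC1 R h (BRight a) (fun y => ih' _) lh.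
  apply: (@filterS _ _ (ae_filter_ringOfSetsType lebesgue_measure)) => x hx /andP[ax xb].
  have ax' : (BRight a < BRight x)%O by rewrite bnd_simp.
  have [] := hx ax'.
  set F := (F in derivable F _ _) => dF F'.
  have gF : \near x, (F : R^o -> R^o) x + g a = (g : R^o -> R^o) x.
    near=> y; rewrite /F -hg ?subrK//; apply/andP; split; apply/ltW; near: y.
      exact: lt_nbhsr.
    exact: lt_nbhsl.
  have dFx : is_derive x (1 : R^o) (F : R^o -> R^o) (h x).
    by apply: DeriveDef; [exact: dF | rewrite -derive1E; exact: F'].
  apply: (near_eq_is_derive gF); rewrite -[h x]addr0.
  exact: is_deriveD dFx (is_derive_cst (g a : R^o) x 1).
Unshelve. all: by end_near. Qed.

Lemma abs_cont_ftc (R : realType) (f : R -> R) (a b : R) : a < b ->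
  abs_cont f -> exists h : R -> R, ftc_density f h a b.
Proof.
move=> ab acf; have [g1 [g2 [nd1 nd2 ac1 ac2 fE]]] := abs_cont_decomp (ltW ab) acf.
have [h hh] := abs_cont_nd_ftc nd1 ac1 ab.
have [k hk] := abs_cont_nd_ftc nd2 ac2 ab.
exists (h \- k); have [i1 i2 i3] := ftc_density_B hh hk; split => //.
- by move=> x y ax xy yb; rewrite -i2//= !fE ?ax ?yb ?andbT ?(le_trans xy yb)// (le_trans ax xy).
- move: i3; apply: (@filterS _ _ (ae_filter_ringOfSetsType lebesgue_measure)) => x /= d0 xab; have := d0 xab.
  apply: near_eq_is_derive => //; move: xab => /andP[ax xb].
  near=> y; rewrite /= fE//; apply/andP; split; apply/ltW; near: y.
    exact: lt_nbhsr.
  exact: lt_nbhsl.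
Unshelve. all: by end_near. Qed.

(** * Integrals of almost everywhere measurable functions *)

Section nonmeasurable_integrands.
Import HBNNSimple.

(* No measurability is required: the integral of a nonnegative function is a
   supremum over the simple functions below it. *)
Lemma ge0_le_integral_ae d (T : measurableType d) (R : realType)
    (mu : {measure set T -> \bar R}) (D : set T) (f g : T -> \bar R) :
  (forall x, D x -> 0 <= f x)%E -> (forall x, D x -> 0 <= g x)%E ->
  {ae mu, forall x, D x -> (f x <= g x)%E} ->
  (\int[mu]_(x in D) f x <= \int[mu]_(x in D) g x)%E.
Proof.
move=> f0 g0 [N [mN N0 fgN]].
rewrite !ge0_integralE//; apply: ge_ereal_sup => _ [h /= hf <-].
(* Cutting [h] off on the null set [N] does not change its integral, and the product lies below [g]
   everywhere rather than almost everywhere. *)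
pose k := proj_nnsfun h (measurableC mN).
have kE x : k x = h x * \1_(~` N) x by [].
have -> : sintegral mu h = sintegral mu k.
  rewrite -!integralT_nnsfun; apply: ge0_ae_eq_integral => //.
  - exact/measurable_EFinP.
  - exact/measurable_EFinP.
  - by move=> x _; rewrite lee_fin.
  - by move=> x _; rewrite lee_fin.
  exists N; split => // x /= hk; apply: contrapT => Nx; apply: hk => _.
  rewrite (_ : mindic R _ x = 1) ?mulr1//.
  by rewrite [LHS]indicE mem_set.
apply: ereal_sup_ubound; exists k => // x; rewrite kE indicE.
case: (boolP (x \in ~` N)) => xN; last first.
  by rewrite mulr0 patchE; case: ifPn => // xD; apply: g0; rewrite inE in xD.
rewrite mulr1; apply: le_trans (hf x) _.
rewrite !patchE; case: ifPn => // xD; rewrite inE in xD; rewrite inE in xN.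
by apply: contrapT => fg; apply: xN; apply: fgN => /=; apply: contra_not fg; exact.
Qed.

Lemma le_integral_ae d (T : measurableType d) (R : realType)
    (mu : {measure set T -> \bar R}) (D : set T) (f g : T -> \bar R) :
  {ae mu, forall x, D x -> (f x <= g x)%E} ->
  (\int[mu]_(x in D) f x <= \int[mu]_(x in D) g x)%E.
Proof.
move=> fg; rewrite integralE [leRHS]integralE; apply: leeB.
- apply: ge0_le_integral_ae => //; move: fg.
  apply: (@filterS _ _ (ae_filter_ringOfSetsType mu)) => x + Dx => /(_ Dx) fg.
  by rewrite !funeposE ge_max !le_max fg lexx orbT.
- apply: ge0_le_integral_ae => //; move: fg.
  apply: (@filterS _ _ (ae_filter_ringOfSetsType mu)) => x + Dx => /(_ Dx) fg.
  by rewrite !funenegE ge_max !le_max leeN2 fg lexx orbT.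
Qed.

Lemma eq_integral_ae d (T : measurableType d) (R : realType)
    (mu : {measure set T -> \bar R}) (D : set T) (f g : T -> \bar R) :
  {ae mu, forall x, D x -> f x = g x} ->
  (\int[mu]_(x in D) f x = \int[mu]_(x in D) g x)%E.
Proof.
move=> fg; apply/eqP; rewrite eq_le; apply/andP; split; apply: le_integral_ae;
  move: fg; apply: (@filterS _ _ (ae_filter_ringOfSetsType mu)) => x + Dx;
  by move=> /(_ Dx) ->.
Qed.

End nonmeasurable_integrands.

(** * Translation of Lebesgue integrals *)

Section translation.
Variable R : realType.
Local Notation mu := (@lebesgue_measure R).

Lemma measurable_shift (a : R) :
  measurable_fun setT (fun s : R => s + a).
Proof. exact: measurable_funD. Qed.

Let shift a : measurableTypeR R -> measurableTypeR R := fun s : R => s + a.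

(** The translated measure agrees with the Lebesgue measure on half-open intervals, which determine
    it. *)
Lemma lebesgue_measure_shift (a : R) (A : set (measurableTypeR R)) : measurable A ->
  pushforward mu (shift a) A = mu A.
Proof.
have msh : measurable_fun setT (shift a) by exact: measurable_shift.
move=> mA; apply/esym/lebesgue_measure_unique => //= _ [[b c]] _ <-.
rewrite /pushforward.
have -> : shift a @^-1` `]b, c]%classic = `](b - a), (c - a)]%classic.
  by apply/seteqP; split => x /=; rewrite /shift !in_itv /= ltrBlDr lerBrDr.
rewrite !lebesgue_measure_itv /= !lte_fin ltrD2r.
by case: ifP => // _; rewrite -!EFinD; congr EFin; rewrite /=; lra.
Qed.

Lemma ae_shift (a : R) (P : R -> Prop) :
  {ae mu, forall s, P s} -> {ae mu, forall s, P (s + a)}.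
Proof.
move=> [N [mN N0 NP]]; exists (shift a @^-1` N); split.
- by have := @measurable_shift a measurableT _ mN; rewrite setTI; exact.
- by rewrite -[LHS]/(pushforward mu (shift a) N) lebesgue_measure_shift.
- by move=> s /= Ps; apply: NP.
Qed.

Lemma integral_shift (a b c : R) (k : R -> R) :
  mu.-integrable setT (EFin \o k) ->
  (\int[mu]_(s in `[b, c]) (k (s + a)%R)%:E =
   \int[mu]_(s in `[(b + a)%R, (c + a)%R]) (k s)%:E)%E.
Proof.
move=> ik; have msh : measurable_fun setT (shift a) by exact: measurable_shift.
have mk := measurable_int _ ik.
have pre : shift a @^-1` `[(b + a), (c + a)]%classic = `[b, c]%classic.
  by apply/seteqP; split => x /=; rewrite /shift !in_itv /= !lerD2r.
transitivity (\int[mu]_(x in shift a @^-1` `[(b + a)%R, (c + a)%R]) ((EFin \o k) \o shift a) x)%E.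
  by rewrite pre.
have int2 (mu2 : {measure set (measurableTypeR R) -> \bar R}) :
    (forall A, measurable A -> mu2 A = mu A) ->
    (\int[mu2]_(s in `[(b + a)%R, (c + a)%R]) (k s)%:E = \int[mu]_(s in `[(b + a)%R, (c + a)%R]) (k s)%:E)%E.
  by move=> h; apply: eq_measure_integral => A mA _; exact: h.
rewrite -integral_pushforward//.
  by apply: int2 => A mA; exact: lebesgue_measure_shift.
have mD : measurable (`[(b + a), (c + a)]%classic : set (measurableTypeR R)).
  exact: measurable_itv.
apply/integrableP; split.
  by apply: measurable_funTS; exact: measurableT_comp mk msh.
rewrite -[X in (X < _)%E]/(\int[mu]_(x in shift a @^-1` `[(b + a)%R, (c + a)%R])
  ((abse \o (EFin \o k)) \o shift a) x)%E.
rewrite -(@ge0_integral_pushforward _ _ _ _ _ _ msh)//; last 2 first.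
- by apply: measurable_funTS; apply: measurableT_comp.
- by move=> y _; rewrite /= lee_fin.
rewrite (eq_measure_integral mu); last by move=> A mA _; exact: lebesgue_measure_shift.
by have /integrableP[] : mu.-integrable `[(b + a), (c + a)] (EFin \o k) by exact: integrableS ik.
Qed.

End translation.

Definition ae_rep (R : realType) (G k : R -> R) (a b : R) : Prop :=
  {ae @lebesgue_measure R, forall s, a <= s <= b -> G s = k s}.

Lemma ae_rep_integral (R : realType) (G k : R -> R) (a b : R) : ae_rep G k a b ->
  (\int[@lebesgue_measure R]_(s in `[a, b]) (G s)%:E =
   \int[@lebesgue_measure R]_(s in `[a, b]) (k s)%:E)%E.
Proof.
move=> Gk; apply: eq_integral_ae; move: Gk.
apply: (@filterS _ _ (ae_filter_ringOfSetsType _)) => s h /=.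
by rewrite in_itv /= => /h ->.
Qed.

Definition ae_meas (R : realType) (G : R -> R) (a b : R) : Prop :=
  exists2 k : R -> R, measurable_fun setT k & ae_rep G k a b.

Lemma ae_meas_cat (R : realType) (G : R -> R) (a b c : R) :
  ae_meas G a b -> ae_meas G b c -> ae_meas G a c.
Proof.
move=> [k mk hk] [l ml hl].
exists (fun s => if s <= b then k s else l s).
  apply: measurable_fun_ifT => //.
  exact: measurable_fun_ler.
move: hk hl; apply: (@filterS2 _ _ (ae_filter_ringOfSetsType _)) => s h1 h2 /andP[as_ sc].
by have [sb|bs] := leP s b; [apply: h1; rewrite as_ | apply: h2; rewrite sc ltW].
Qed.

(** A lower bound on a bounded interval controls the negative part, and the finiteness hypothesis
    then controls the positive part. Truncating the representative at [B] makes the lower bound hold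
    everywhere instead of almost everywhere. *)
Lemma ae_meas_integrable (R : realType) (G : R -> R) (a b B : R) :
  ae_meas G a b -> (forall s, a <= s <= b -> B <= G s) ->
  (\int[@lebesgue_measure R]_(s in `[a, b]) (G s)%:E < +oo)%E ->
  exists2 k : R -> R, (@lebesgue_measure R).-integrable setT (EFin \o k) &
    ae_rep G k a b.
Proof.
move=> [k mk hk] GB Goo; pose f s := Num.max (k s) B.
have mf : measurable_fun setT f by apply: measurable_maxr.
have hf : ae_rep G f a b.
  move: hk; apply: (@filterS _ _ (ae_filter_ringOfSetsType _)) => s h sab.
  by rewrite /f -h//; apply/esym/max_idPl; exact: GB.
have mD : measurable (`[a, b]%classic : set R) by exact: measurable_itv.
have mfD : measurable_fun (`[a, b]%classic : set R) (EFin \o f).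
  by apply/measurable_EFinP; exact: measurable_funTS.
have fi : (@lebesgue_measure R).-integrable `[a, b] (EFin \o f).
  apply/integrableP; split; first exact: mfD.
  have negle : (\int[@lebesgue_measure R]_(s in `[a, b]) ((EFin \o f)^\- s) < +oo)%E.
    apply: (@le_lt_trans _ _ (\int[@lebesgue_measure R]_(s in `[a, b]) `|B|%:E)%E).
      apply: ge0_le_integral => //; first exact: measurable_funeneg.
      move=> s _; rewrite funenegE /= ge_max !lee_fin normr_ge0 andbT lerNl.
      by rewrite /f le_max orbC; apply/orP; left; rewrite lerNl -normrN ler_norm.
    rewrite integral_cst//= lebesgue_measure_itv /=.
    by case: ifP => _; rewrite -?EFinB -?EFinM ?mule0 ltry.
  have posle : (\int[@lebesgue_measure R]_(s in `[a, b]) ((EFin \o f)^\+ s) < +oo)%E.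
    move: Goo; rewrite (ae_rep_integral hf) integralE.
    rewrite lteBlDr ?addye//; last by rewrite ge0_fin_numE// integral_ge0.
    by rewrite gt_eqF//; apply: (@lt_le_trans _ _ 0%E) => //; exact: integral_ge0.
  under eq_integral do rewrite -/((abse \o (EFin \o f)) _) fune_abse.
  rewrite ge0_integralD//; [exact: lte_add_pinfty | exact: measurable_funepos | exact: measurable_funeneg].
exists (f \_ `[a, b]%classic).
  rewrite -restrict_EFin; apply/integrable_restrict => //.
  by rewrite setTI.
move: hf; apply: (@filterS _ _ (ae_filter_ringOfSetsType _)) => s h sab.
by rewrite patchE mem_set /= ?in_itv//= h.
Qed.

(** * Calibrated curves and one-sided paraboloids *)

Section pairing_theory.
Variables (R : realType) (n : nat).
Implicit Types (p q u v : 'rV[R]_n) (a : R).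

Lemma pairingE p v : pairing p v = \sum_i p 0 i * v 0 i.
Proof. by rewrite /pairing mxE; apply: eq_bigr => i _; rewrite mxE. Qed.

Lemma pairingDl p q v : pairing (p + q) v = pairing p v + pairing q v.
Proof. by rewrite /pairing mulmxDl mxE. Qed.

Lemma pairingDr p u v : pairing p (u + v) = pairing p u + pairing p v.
Proof. by rewrite /pairing linearD mulmxDr mxE. Qed.

Lemma pairingZl a p v : pairing (a *: p) v = a * pairing p v.
Proof. by rewrite /pairing -scalemxAl mxE. Qed.

Lemma pairingZr a p v : pairing p (a *: v) = a * pairing p v.
Proof. by rewrite /pairing linearZ /= -scalemxAr mxE. Qed.

Lemma pairingNl p v : pairing (- p) v = - pairing p v.
Proof. by rewrite -scaleN1r pairingZl mulN1r. Qed.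

Lemma pairingNr p v : pairing p (- v) = - pairing p v.
Proof. by rewrite -scaleN1r pairingZr mulN1r. Qed.

Lemma pairingBl p q v : pairing (p - q) v = pairing p v - pairing q v.
Proof. by rewrite pairingDl pairingNl. Qed.

Lemma pairingBr p u v : pairing p (u - v) = pairing p u - pairing p v.
Proof. by rewrite pairingDr pairingNr. Qed.

Lemma pairing0l v : pairing 0 v = 0.
Proof. by rewrite -(scale0r 0) pairingZl mul0r. Qed.

Lemma pairing0r p : pairing p 0 = 0.
Proof. by rewrite -(scale0r 0) pairingZr mul0r. Qed.

Lemma pairing_suml (N : nat) (u : nat -> 'rV[R]_n) v :
  pairing (\sum_(k < N) u k) v = \sum_(k < N) pairing (u k) v.
Proof.
elim: N => [|N ih]; first by rewrite !big_ord0 pairing0l.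
by rewrite !big_ord_recr /= pairingDl ih.
Qed.

Lemma coord_le_norm v i : `|v 0 i| <= `|v|.
Proof.
rewrite [leRHS]mx_normrE.
by apply: (le_bigmax _ (fun ij : 'I_1 * 'I_n => `|v ij.1 ij.2|) (0, i)).
Qed.

Lemma norm_le_coord v a : 0 <= a -> (forall i, `|v 0 i| <= a) -> `|v| <= a.
Proof.
move=> a0 h; rewrite [leLHS]mx_normrE; apply: bigmax_le => //= -[i j] _ /=.
by rewrite ord1; exact: h.
Qed.

Lemma norm_pairing p v : `|pairing p v| <= n%:R * `|p| * `|v|.
Proof.
rewrite pairingE; apply: le_trans (ler_norm_sum _ _ _) _.
rewrite -mulrA -[n in n%:R]card_ord mulr_natl -sumr_const.
by apply: ler_sum => i _; rewrite normrM ler_pM ?coord_le_norm.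
Qed.

Lemma pairing_le p v : pairing p v <= n%:R * `|p| * `|v|.
Proof. exact: le_trans (ler_norm _) (norm_pairing p v). Qed.

Lemma pairing_self u : `|u| ^+ 2 <= pairing u u.
Proof.
have ge0 i : 0 <= u 0 i * u 0 i by rewrite -expr2 sqr_ge0.
have [->|/mx_norm_neq0 [[i0 i] ui]] := eqVneq `|u| 0.
  by rewrite expr0n pairingE sumr_ge0.
rewrite /= ord1 in ui; rewrite -[`|u|]/(mx_norm u) ui -normrX ger0_norm ?sqr_ge0//.
by rewrite pairingE (bigD1 i) //= expr2 lerDl sumr_ge0.
Qed.

(** The norm on rows is the maximum norm, so it is attained by a signed coordinate covector. *)
Lemma norming_covector v : exists2 p, `|p| <= 1 & pairing p v = `|v|.
Proof.
have [v0|/mx_norm_neq0 [[i0 i] vi]] := eqVneq `|v| 0.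
  by exists 0; rewrite ?normr0// pairing0l v0.
rewrite /= ord1 in vi; rewrite -[`|v|]/(mx_norm v) vi.
have pE a : pairing (a *: delta_mx 0 i) v = a * v 0 i.
  rewrite pairingZl pairingE (bigD1 i) //= mxE !eqxx mul1r big1 ?addr0// => j ji.
  by rewrite mxE eqxx (negbTE ji) mul0r.
exists (Num.sg (v 0 i) *: delta_mx 0 i); last by rewrite pE normrEsg.
apply: norm_le_coord => // j; rewrite mxE mxE eqxx /= normrM.
have : `|Num.sg (v 0 i)| <= 1 by rewrite normr_sg lern1 leq_b1.
by case: (j == i); rewrite ?normr1 ?normr0 ?mulr1 ?mulr0 // => h; rewrite ler01.
Qed.

End pairing_theory.

(** * Comparison of calibrated curves with translated competitors *)

Section semiconcavity.
Variables (R : realType) (n : nat).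
Let V := 'rV[R]_n.
Implicit Types (f : V -> R) (F : V -> V -> R) (rho : R).

(* The only properties of a Tonelli Hamiltonian [F], read in a chart around
   [q0], on which the estimates depend.  In the last field [P] is the maximiser of
   [<., v> - F q .] and [- a] the derivative of [F] in [q]; the inequality is a
   second order upper bound for the Lagrangian, expressed through [F] only. *)
Record ham_bounds F (q0 : V) rho : Prop := HamBounds {
  ham_bnd : forall K : R, exists2 B : R, 0 <= B &
    forall q P : V, `|q - q0| < rho -> `|P| <= K -> `|F q P| <= B;
  ham_lip : forall K : R, exists2 C : R, 0 <= C &
    forall q q' P : V, `|q - q0| < rho -> `|q' - q0| < rho -> `|P| <= K ->
      `|F q P - F q' P| <= C * `|q - q'|;
  ham_lag : forall V0 : R, exists A C : R, [/\ 0 <= A, 0 <= C &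
    forall q v : V, `|q - q0| < rho -> `|v| <= V0 -> exists P a : V,
      [/\ `|P| <= A, `|a| <= A &
        forall h w Q : V, `|q + h - q0| < rho -> `|w| <= 1 ->
          pairing Q (v + w) - F (q + h) Q <=
          pairing P v - F q P + pairing P w - pairing a h
            + C * (`|h| ^+ 2 + `|w| ^+ 2)]]
}.

(** Domination by the action, tested only on straight segments run at constant velocity in time [d].
    Bounding every [<Q, v> - F] by [B] amounts to bounding the Lagrangian by [B] along the
    segment. *)
Definition dominated f F (q0 : V) rho : Prop :=
  forall (a b : V) (d B : R), `|a - q0| < rho -> `|b - q0| < rho -> 0 < d ->
    (forall (s : R) (Q : V), 0 <= s <= 1 ->
       pairing Q (d^-1 *: (b - a)) - F (a + s *: (b - a)) Q <= B) ->
    f b - f a <= d * B.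

(** The reverse inequality up to [e], with the Lagrangian bounded below by [<P, z'> - F (z s) P] for
    a constant covector [P]. The integral of the first term is an increment of [z], so neither
    derivative nor integral appears. *)
Definition calibrated f F (z : R -> V) (t e : R) : Prop :=
  forall (s1 s2 : R) (P : V) (B : R), 0 <= s1 -> s1 <= s2 -> s2 <= t ->
    (forall s, s1 <= s <= s2 -> F (z s) P <= B) ->
    pairing P (z s2 - z s1) - B * (s2 - s1) - e <= f (z s2) - f (z s1).

Lemma ball_segment rho (q0 a b : V) (s : R) : `|a - q0| < rho -> `|b - q0| < rho ->
  0 <= s <= 1 -> `|a + s *: (b - a) - q0| < rho.
Proof.
move=> ha hb /andP[s0 s1].
have -> : a + s *: (b - a) - q0 = (1 - s) *: (a - q0) + s *: (b - q0).
  by apply/rowP => i; rewrite !mxE; ring.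
apply: le_lt_trans (ler_normD _ _) _; rewrite !normrZ !ger0_norm ?subr_ge0//.
have [->|sn0] := eqVneq s 0; first by rewrite mul0r addr0 subr0 mul1r.
have s_gt0 : 0 < s by rewrite lt0r sn0.
have h1 : (1 - s) * `|a - q0| <= (1 - s) * rho by rewrite ler_wpM2l ?subr_ge0// ltW.
have h2 : s * `|b - q0| < s * rho by rewrite ltr_pM2l.
by lra.
Qed.

(** The segment is run at unit speed, and [ham_lag] with zero displacements bounds the Lagrangian at
    unit velocities. The constant depends on [F] but not on [f]. *)
Lemma dominated_lipschitz F (q0 : V) rho : ham_bounds F q0 rho ->
  exists2 K : R, 0 <= K & forall f, dominated f F q0 rho ->
    forall a b : V, `|a - q0| < rho -> `|b - q0| < rho -> f b - f a <= K * `|b - a|.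
Proof.
move=> hF; have [A [C [A0 C0 hl]]] := ham_lag hF 1.
have [B B0 hB] := ham_bnd hF A.
exists (n%:R * A + B); first by rewrite addr_ge0// mulr_ge0.
move=> f df a b ha hb.
have [->|ba] := eqVneq b a; first by rewrite !subrr normr0 mulr0.
have ba0 : 0 < `|b - a| by rewrite normr_gt0 subr_eq0.
rewrite mulrC; apply: df => // s Q s01.
have hs := ball_segment ha hb s01.
set v := `|b - a|^-1 *: (b - a).
have nv : `|v| <= 1 by rewrite normrZ normfV normr_id mulVf ?gt_eqF.
have [P [a' [hP ha' hh]]] := hl _ v hs nv.
have := hh 0 0 Q; rewrite !addr0 !pairing0r normr0 expr0n /= !addr0 mulr0 addr0 subr0.
move=> /(_ hs ler01) /le_trans; apply; apply: lerD.
  apply: le_trans (pairing_le _ _) _; rewrite -mulrA ler_wpM2l//.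
  by rewrite -[leRHS]mulr1 ler_pM.
by apply: le_trans (ler_norm _) _; rewrite normrN; exact: hB.
Qed.

(** Calibration against a norming covector scaled by [K + 1] bounds [(K + 1) * |z s2 - z s1|], of
    which the Lipschitz bound of [f] pays for [K * |z s2 - z s1|]; one copy of the increment
    remains. *)
Lemma calibrated_speed F (q0 : V) rho : ham_bounds F q0 rho ->
  exists2 V1 : R, 0 <= V1 & forall f, dominated f F q0 rho ->
    forall z t e s1 s2, calibrated f F z t e -> 0 <= s1 -> s1 <= s2 -> s2 <= t ->
      (forall s, s1 <= s <= s2 -> `|z s - q0| < rho) ->
      `|z s2 - z s1| <= V1 * (s2 - s1) + e.
Proof.
move=> hF; have [K K0 hK] := dominated_lipschitz hF.
have [B B0 hB] := ham_bnd hF (K + 1).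
exists B => // f df z t e s1 s2 cz s10 s12 s2t hz.
have [p p1 pE] := norming_covector (z s2 - z s1).
have := cz s1 s2 ((K + 1) *: p) B s10 s12 s2t.
rewrite pairingZl pE => h.
have {}h : (K + 1) * `|z s2 - z s1| - B * (s2 - s1) - e <= f (z s2) - f (z s1).
  apply: h => s s12'; apply: le_trans (ler_norm _) _; apply: hB; first exact: hz.
  by rewrite normrZ ger0_norm ?addr_ge0// ler_piMr// addr_ge0.
have := hK f df (z s1) (z s2); rewrite !hz ?lexx ?s12// => /(_ isT isT).
by lra.
Qed.

Lemma norm_diff_sqr (u v : V) (c : R) : `|u| <= c -> `|v + u| ^+ 2 <= 2 * `|v| ^+ 2 + 2 * c ^+ 2.
Proof.
move=> uc; have h := ler_normD v u.
have h1 : `|v + u| ^+ 2 <= (`|v| + c) ^+ 2.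
  by rewrite lerXn2r ?nnegrE ?addr_ge0 ?(le_trans _ uc)//; lra.
apply: le_trans h1 _; rewrite -subr_ge0.
have -> : 2 * `|v| ^+ 2 + 2 * c ^+ 2 - (`|v| + c) ^+ 2 = (`|v| - c) ^+ 2 by ring.
exact: sqr_ge0.
Qed.

(* One step of the discretised comparison: [zk] and [zk1] are consecutive nodes
   of a calibrated curve, translated by [th *: h] and [(th + d / t) *: h]. *)
Lemma comparison_step F (q0 : V) rho (V0 : R) : 0 <= V0 -> ham_bounds F q0 rho ->
  exists A C E : R, [/\ 0 <= A, 0 <= C, 0 <= E &
    forall f, dominated f F q0 rho -> forall (z : R -> V) (t e d s : R),
      calibrated f F z t e -> 0 < t -> 0 < d <= 1 -> e <= d ^+ 2 ->
      0 <= s -> s + d <= t ->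
      (forall u, s <= u <= s + d -> `|z u - q0| < rho) ->
      (forall u, s <= u <= s + d -> `|z u - z s| <= V0 * d) ->
      exists P a : V, [/\ `|P| <= A, `|a| <= A & forall (th : R) (h : V),
        0 <= th -> th + d / t <= 1 -> `|h| <= t ->
        `|z s - q0| + `|h| + (V0 + 1) * d < rho ->
        f (z (s + d) + (th + d / t) *: h) - f (z s + th *: h)
          - (f (z (s + d)) - f (z s)) <=
        d * (pairing (t^-1 *: P - th *: a) h + E * d
             + C * (2 * `|h| ^+ 2 + `|t^-1 *: h| ^+ 2))]].
Proof.
move=> V00 hF; have [A [C [A0 C0 hl]]] := ham_lag hF V0.
have [C' C'0 hL] := ham_lip hF A.
exists A, C, (n%:R * A * (V0 + 1) + 2 * C * (V0 + 1) ^+ 2 + C' * V0 + 1).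
split => //.
  by rewrite !addr_ge0// ?mulr_ge0// ?exprn_ge0// ?addr_ge0// ler0n.
move=> f df z t e d s cz t0 /andP[d0 d1] ed s0 sdt zB zV.
pose v := d^-1 *: (z (s + d) - z s).
have dv : d *: v = z (s + d) - z s by rewrite /v scalerA mulfV ?gt_eqF// scale1r.
have sd : s <= s + d by rewrite lerDl ltW.
have zsB : `|z s - q0| < rho by apply: zB; rewrite lexx.
have nv : `|v| <= V0.
  rewrite /v normrZ gtr0_norm ?invr_gt0// ler_pdivrMl// mulrC.
  by apply: zV; rewrite lexx sd.
have [P [a [hP ha hh]]] := hl _ v zsB nv.
exists P, a; split => // th h th0 th1 ht small.
(* The covector [P] is the one attached to the mean velocity [v]. Replacing [z u] by [z s] in [F]
   costs [C' * V0 * d], and the final [1] accounts for [e <= d ^+ 2]. *)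
have lower : d * (pairing P v - F (z s) P) - d ^+ 2 * (C' * V0 + 1) <= f (z (s + d)) - f (z s).
  have := cz s (s + d) P (F (z s) P + C' * (V0 * d)) s0 sd sdt.
  rewrite -dv pairingZr (_ : s + d - s = d); last by ring.
  move=> low; have {}low : d * pairing P v - (F (z s) P + C' * (V0 * d)) * d - e <= f (z (s + d)) - f (z s).
    apply: low => u us; have := hL _ _ P (zB u us) zsB hP.
    move=> /(le_trans (ler_norm _)) h1.
    have := ler_wpM2l C'0 (zV u us); by lra.
  by apply: le_trans low; lra.
pose w := t^-1 *: h.
have nw : `|w| <= 1 by rewrite /w normrZ gtr0_norm ?invr_gt0// ler_pdivrMl// mulr1.
pose a' := z s + th *: h; pose b' := z (s + d) + (th + d / t) *: h.
have ba : b' - a' = d *: (v + w).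
  rewrite /b' /a' scalerDr dv /w; apply/rowP => i; rewrite !mxE; field.
  by rewrite gt_eqF.
have thn : th * `|h| <= `|h|.
  rewrite ler_piMl//; apply: le_trans th1; rewrite lerDl divr_ge0//; exact: ltW.
have kb u : 0 <= u <= 1 -> `|u *: (b' - a')| <= (V0 + 1) * d.
  move=> /andP[u0 u1]; rewrite ba scalerA normrZ ger0_norm ?mulr_ge0// ?(ltW d0)//.
  rewrite [leRHS]mulrC; apply: ler_pM; rewrite ?mulr_ge0 ?(ltW d0)//.
    by rewrite ler_piMl// ltW.
  by apply: le_trans (ler_normD _ _) _; lra.
have inB u : 0 <= u <= 1 -> `|z s + (th *: h + u *: (b' - a')) - q0| < rho.
  move=> u01; apply: le_lt_trans small.
  have -> : z s + (th *: h + u *: (b' - a')) - q0 = (z s - q0) + th *: h + u *: (b' - a').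
    by apply/rowP => i; rewrite !mxE; ring.
  apply: le_trans (ler_normD _ _) _; apply: lerD (kb _ u01).
  apply: le_trans (ler_normD _ _) _; rewrite normrZ (ger0_norm th0).
  exact: lerD.
have a'B : `|a' - q0| < rho.
  by have := inB 0; rewrite scale0r addr0 lexx ler01; exact.
have b'B : `|b' - q0| < rho.
  have := inB 1; rewrite scale1r ler01 lexx /= => /(_ isT).
  by rewrite (_ : z s + _ = b')// addrA -/a' addrCA subrr addr0.
(* The competitor differs from [z s] by [th *: h] and a further displacement of size at most
   [(V0 + 1) * d]; the latter enters only terms that carry a factor [d] and end up in [E * d]. *)
pose bd := pairing P v - F (z s) P + pairing P w - th * pairing a h
  + n%:R * A * (V0 + 1) * d + C * (2 * `|h| ^+ 2 + 2 * ((V0 + 1) * d) ^+ 2 + `|w| ^+ 2).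
have upper : f b' - f a' <= d * bd.
  apply: df => // u Q u01.
  rewrite [d^-1 *: _](_ : _ = v + w); last by rewrite ba scalerA mulVf ?gt_eqF// scale1r.
  have -> : a' + u *: (b' - a') = z s + (th *: h + u *: (b' - a')) by rewrite addrA.
  apply: le_trans (hh _ _ _ (inB u u01) nw) _; rewrite /bd.
  rewrite pairingDr pairingZr.
  have h1 : - pairing a (u *: (b' - a')) <= n%:R * A * (V0 + 1) * d.
    rewrite -pairingNr; apply: le_trans (pairing_le _ _) _; rewrite normrN -!mulrA.
    rewrite ler_wpM2l//; apply: ler_pM => //; exact: kb.
  have h2 : `|th *: h + u *: (b' - a')| ^+ 2 <= 2 * `|h| ^+ 2 + 2 * ((V0 + 1) * d) ^+ 2.
    apply: le_trans (norm_diff_sqr _ (kb u u01)) _; rewrite lerD2r ler_wpM2l//.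
    by rewrite normrZ (ger0_norm th0) lerXn2r ?nnegrE ?mulr_ge0.
  have := ler_wpM2l C0 h2; by lra.
have dd : d ^+ 2 <= d by rewrite expr2 ler_piMl// ltW.
rewrite -/a' -/b'; apply: (@le_trans _ _ (d * bd - (d * (pairing P v - F (z s) P) - d ^+ 2 * (C' * V0 + 1)))); first by lra.
have wE : pairing P w = t^-1 * pairing P h by rewrite pairingZr.
rewrite /bd pairingBl !pairingZl -/w wE.
move: (pairing P v) => Pv.
have := ler_wpM2l (ltW d0) (ler_wpM2l (mulr_ge0 C0 (sqr_ge0 (V0 + 1))) dd).
by lra.
Qed.

(** The covector may depend on the slack [e], since each near minimiser yields its own; only the
    bound [A] is common. [upper_quadratic_limit] removes the slack. *)
Definition upper_quadratic f (y : V) (A K r : R) : Prop :=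
  forall e : R, 0 < e -> exists2 p : V, `|p| <= A &
    forall h : V, `|h| <= r -> f (y + h) <= f y + pairing p h + K * `|h| ^+ 2 + e.

(** The one-step comparison is summed over a uniform grid of [N] steps of length [d = t / N], and
    the left sides telescope. The covector is a Riemann sum of [P / t - (s / t) a] over time
    [t <= 1], hence bounded by [2 * A], and [t * (2 |h|^2 + |h|^2 / t^2) <= 3 |h|^2 / t] gives the
    opening. *)
Lemma calibrated_upper_quadratic F (q0 : V) rho : 0 < rho -> ham_bounds F q0 rho ->
  exists la T A K : R, [/\ 0 < la, 0 < T <= 1, 0 <= A, 0 < K &
    forall f, dominated f F q0 rho -> forall (y : V) (t : R),
      `|y - q0| < rho / 2 -> 0 < t <= T ->
      (forall e, 0 < e -> exists z : R -> V, [/\ z t = y,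
         (forall s, 0 <= s <= t -> `|z s - q0| < rho) & calibrated f F z t e]) ->
      upper_quadratic f y A (K / t) (la * t)].
Proof.
move=> rho0 hF; have [V1 V10 hV1] := calibrated_speed hF.
have V00 : 0 <= V1 + 1 by rewrite addr_ge0.
have [A [C [E [A0 C0 E0 hstep]]]] := comparison_step V00 hF.
(* Starting from [y] within [rho / 2] of the centre, the curve, the translation [la * t] and one
   further step of the competitor use at most [rho / 16] each. *)
pose T := Num.min 1 (rho / (16 * (V1 + 2))).
have V2 : 0 < 16 * (V1 + 2) by lra.
have T0 : 0 < T by rewrite lt_min ltr01 divr_gt0.
have T1 : T <= 1 by rewrite ge_min lexx.
have TV : T * (V1 + 2) <= rho / 16.
  have : T <= rho / (16 * (V1 + 2)) by rewrite ge_min lexx orbT.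
  by rewrite ler_pdivlMr//; lra.
pose la := Num.min 1 (rho / 16).
have la0 : 0 < la by rewrite lt_min ltr01 divr_gt0.
have la1 : la <= 1 by rewrite ge_min lexx.
have lar : la <= rho / 16 by rewrite ge_min lexx orbT.
exists la, T, (2 * A), (3 * C + 1); split => //.
- by rewrite T0.
- by rewrite mulr_ge0.
- by lra.
move=> f df y t yB /andP[t0 tT] hz e e0.
have t1 : t <= 1 by exact: le_trans tT T1.
(* The accumulated discretisation error is [E * d * t = E * t ^+ 2 / N], which this [N] brings below
   [e]. *)
have [N N0 NE] : exists2 N : nat, (0 < N)%N & E * t * t < e * N%:R.
  exists (Num.bound (E * t * t / e)).+1 => //.
  rewrite -ltr_pdivrMl// mulrC; apply: lt_trans (archi_boundP _) _.
    by rewrite divr_ge0// ?mulr_ge0// ltW.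
  by rewrite ltr_nat.
have N0' : 0 < N%:R :> R by rewrite ltr0n.
pose d := t / N%:R.
have d0 : 0 < d by rewrite divr_gt0.
have dt : d <= t by rewrite ler_pdivrMr// ler_peMr ?ler1n// ltW.
have d1 : d <= 1 by lra.
have Nd : N%:R * d = t by rewrite mulrC divfK ?gt_eqF.
have dd : d ^+ 2 <= d by rewrite expr2 ler_piMl// ltW.
have [z [zt zB cz]] := hz (d ^+ 2) (exprn_gt0 2 d0).
have itv (k : nat) (u : R) : (k < N)%N -> k%:R * d <= u <= k%:R * d + d -> 0 <= u <= t.
  move=> kN /andP[h1 h2]; apply/andP; split.
    by apply: le_trans h1; rewrite mulr_ge0// ltW.
  apply: le_trans h2 _; rewrite -Nd -{2}(mul1r d) -mulrDl ler_pM2r//.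
  by rewrite natr1 ler_nat.
have speed s1 s2 : 0 <= s1 -> s1 <= s2 -> s2 <= t -> `|z s2 - z s1| <= V1 * (s2 - s1) + d ^+ 2.
  move=> h0 h1 h2; apply: (hV1 f df z t _ _ _ cz) => // s /andP[h3 h4].
  by apply: zB; rewrite (le_trans h0 h3) (le_trans h4 h2).
have zy s : 0 <= s <= t -> `|z s - q0| < 5 / 8 * rho.
  move=> /andP[s0 st]; have := speed s t s0 st (lexx _); rewrite zt distrC => h1.
  have : `|z s - q0| <= `|z s - y| + `|y - q0|.
    by rewrite (_ : z s - q0 = (z s - y) + (y - q0)) ?ler_normD// addrA subrK.
  have : V1 * (t - s) <= V1 * t by rewrite ler_wpM2l// gerBl.
  have : V1 * t <= V1 * T by rewrite ler_wpM2l.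
  by lra.
have /choice[Pa hPa] (k : nat) : exists Pa : V * V, (k < N)%N ->
   [/\ `|Pa.1| <= A, `|Pa.2| <= A & forall h : V, `|h| <= la * t ->
    f (z (k.+1%:R * d) + k.+1%:R / N%:R *: h) - f (z (k%:R * d) + (k%:R / N%:R) *: h)
          - (f (z (k.+1%:R * d)) - f (z (k%:R * d))) <=
        d * (pairing (t^-1 *: Pa.1 - (k%:R / N%:R) *: Pa.2) h + E * d
             + C * (2 * `|h| ^+ 2 + `|t^-1 *: h| ^+ 2))].
  case: (ltnP k N) => kN; last by exists (0, 0).
  have kd : k.+1%:R * d = k%:R * d + d by rewrite -natr1 mulrDl mul1r.
  have kN1 : k.+1%:R / N%:R = k%:R / N%:R + d / t :> R.
    by rewrite -natr1 mulrDl mul1r /d; congr (_ + _); field; rewrite !gt_eqF.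
  have kdt : 0 <= k%:R * d + d <= t.
    by apply: (itv _ _ kN); rewrite lexx andbT lerDl ltW.
  have kd0 : 0 <= k%:R * d by rewrite mulr_ge0// ltW.
  have h1 u : k%:R * d <= u <= k%:R * d + d -> `|z u - q0| < rho.
    by move=> /(itv _ _ kN); exact: zB.
  have h2 u : k%:R * d <= u <= k%:R * d + d -> `|z u - z (k%:R * d)| <= (V1 + 1) * d.
    move=> /[dup] /(itv _ _ kN) /andP[u0 ut] /andP[ku uk].
    apply: le_trans (speed _ _ kd0 ku ut) _.
    have : V1 * (u - k%:R * d) <= V1 * d by rewrite ler_wpM2l//; clear -uk; lra.
    by clear -dd; lra.
  have d01 : 0 < d <= 1 by rewrite d0.
  have [P [a [hP ha hPa]]] := hstep f df z t (d ^+ 2) d (k%:R * d) cz t0 d01 (lexx _) kd0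
    (proj2 (andP kdt)) h1 h2.
  exists (P, a) => _; split => // h hh.
  rewrite kd kN1; apply: hPa.
  - by rewrite divr_ge0.
  - by rewrite -kN1 ler_pdivrMr// mul1r ler_nat.
  - by apply: le_trans hh _; rewrite ler_piMl// ltW.
  - have := zy (k%:R * d); rewrite kd0 /= (le_trans _ (proj2 (andP kdt))) ?lerDl ?(ltW d0)// => /(_ isT).
    have : la * t <= rho / 16 by apply: le_trans lar; rewrite ler_piMr// ltW.
    have : (V1 + 1 + 1) * d <= rho / 16.
      apply: le_trans TV; rewrite mulrC; apply: ler_pM; [exact: ltW|by clear -V10; lra|by lra|by clear; lra].
    by lra.
pose pk (k : nat) : V := d *: (t^-1 *: (Pa k).1 - (k%:R / N%:R) *: (Pa k).2).
pose p := \sum_(k < N) pk k.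
exists p.
  rewrite /p; apply: le_trans (ler_norm_sum _ _ _) _.
  apply: (@le_trans _ _ (\sum_(k < N) d * (2 * A / t))); last first.
    by rewrite sumr_const card_ord -[leLHS]mulr_natl mulrA Nd mulrC divfK ?gt_eqF.
  apply: ler_sum => k _; rewrite normrZ gtr0_norm// ler_wpM2l ?(ltW d0)//.
  have [hP ha _] := hPa k (ltn_ord k).
  apply: le_trans (ler_normB _ _) _; rewrite !normrZ !ger0_norm ?invr_ge0 ?(ltW t0)// ?divr_ge0//.
  have : t^-1 * `|(Pa k).1| <= t^-1 * A by rewrite ler_wpM2l// invr_ge0 ltW.
  have : k%:R / N%:R * `|(Pa k).2| <= t^-1 * A.
    apply: ler_pM => //.
    apply: (@le_trans _ _ 1); first by rewrite ler_pdivrMr// mul1r ler_nat ltnW.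
    by rewrite invf_ge1.
  by lra.
move=> h hr.
pose g (k : nat) := f (z (k%:R * d) + (k%:R / N%:R) *: h) - f (z (k%:R * d)).
have gN : g N - g 0 = f (y + h) - f y.
  rewrite /g Nd divff ?gt_eqF// !mul0r scale0r addr0 scale1r zt; ring.
have : g N - g 0 <= pairing p h + E * d * t + C * t * (2 * `|h| ^+ 2 + `|t^-1 *: h| ^+ 2).
  have -> : g N - g 0 = \sum_(0 <= k < N) (g k.+1 - g k) by rewrite telescope_sumr.
  rewrite /p (pairing_suml N pk h).
  rewrite [leRHS](_ : _ = \sum_(k < N)
     d * (pairing (t^-1 *: (Pa k).1 - (k%:R / N%:R) *: (Pa k).2) h + E * d
             + C * (2 * `|h| ^+ 2 + `|t^-1 *: h| ^+ 2))).
    rewrite big_mkord; apply: ler_sum => k _.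
    have [_ _ /(_ h hr)] := hPa k (ltn_ord k).
    by rewrite /g; lra.
  under [RHS]eq_bigr do rewrite -addrA mulrDr.
  have sumc c : \sum_(i < N) d * c = t * c.
    by rewrite sumr_const card_ord -[LHS]mulr_natl mulrA Nd.
  rewrite big_split /= sumc -addrA; congr (_ + _).
    by apply: eq_bigr => k _; rewrite pairingZl.
  by ring.
rewrite gN normrZ gtr0_norm ?invr_gt0// exprMn.
have -> : C * t * (2 * `|h| ^+ 2 + t^-1 ^+ 2 * `|h| ^+ 2) =
   C * `|h| ^+ 2 * (2 * t + t^-1) by field; rewrite gt_eqF.
have h1 : C * `|h| ^+ 2 * (2 * t + t^-1) <= C * `|h| ^+ 2 * (3 * t^-1).
  rewrite ler_wpM2l ?mulr_ge0 ?sqr_ge0//.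
  have : 1 <= t^-1 by rewrite invf_ge1.
  by clear -t1 t0; lra.
have h2 : E * d * t <= e.
  rewrite -(ler_pM2l N0') (_ : N%:R * (E * d * t) = E * (N%:R * d) * t); last by ring.
  by rewrite Nd [leRHS]mulrC ltW.
have h3 : 0 <= t^-1 * `|h| ^+ 2 by rewrite mulr_ge0 ?sqr_ge0// invr_ge0 ltW.
by clear -h1 h2 h3; lra.
Qed.

End semiconcavity.

(** * Supergradients of functions touched by paraboloids *)

Section superdifferential.
Variables (R : realType) (n : nat).
Let V := 'rV[R]_n.
Implicit Types (f : V -> R).

(** What is kept of a smooth function touching [f] from above at [y]: a first order upper bound
    along each ray, with no uniformity in the direction. *)
Definition ray_supergradient f (y p : V) : Prop :=
  forall (h : V) (e : R), 0 < e -> exists2 s0 : R, 0 < s0 &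
    forall s, 0 < s < s0 -> f (y + s *: h) <= f y + s * pairing p h + e * s.

(** A semiconcavity argument. The upper paraboloid at [y + s *: h], with an unknown covector [p'],
    is evaluated at both ends [y] and [y + h], and the value at [y + s *: h] is bounded by the
    supergradient [p]. *)
Lemma upper_quadratic_supergradient f (y p h : V) (A K r : R) : 0 <= K ->
  (forall s, 0 <= s <= 1 -> upper_quadratic f (y + s *: h) A K r) ->
  ray_supergradient f y p -> `|h| <= r ->
  f (y + h) <= f y + pairing p h + K * `|h| ^+ 2.
Proof.
move=> K0 uq rs hr; apply/ler_addgt0Pr => e e0; have e20 : 0 < e / 2 by lra.
have [s0 s00 hs0] := rs h _ e20.
pose s := Num.min (s0 / 2) (1 / 2).
have s_gt0 : 0 < s by rewrite lt_min !divr_gt0.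
have s1 : s < 1 by rewrite gt_min; apply/orP; right; lra.
have ss0 : s < s0 by rewrite gt_min; apply/orP; left; lra.
(* The slack is proportional to [s] because the final inequality is divided by [s]. *)
have e2s : 0 < e / 2 * s by rewrite mulr_gt0.
have s01 : 0 <= s <= 1 by rewrite !ltW.
have [p' _ hp'] := uq s s01 _ e2s.
have hn (c : R) : `|c| <= 1 -> `|c *: h| <= r.
  by move=> c1; rewrite normrZ; apply: le_trans hr; rewrite ler_piMl.
have h1 : f (y + h) <= f (y + s *: h) + (1 - s) * pairing p' h + K * ((1 - s) ^+ 2 * `|h| ^+ 2) + e / 2 * s.
  have := hp' ((1 - s) *: h).
  rewrite hn; last by rewrite ger0_norm; lra.
  rewrite -addrA -scalerDl (_ : s + (1 - s) = 1) ?scale1r; last by ring.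
  rewrite pairingZr normrZ exprMn (@ger0_norm _ (1 - s)); last by lra.
  by apply.
have h2 : f y <= f (y + s *: h) - s * pairing p' h + K * (s ^+ 2 * `|h| ^+ 2) + e / 2 * s.
  have := hp' (- s *: h).
  rewrite hn; last by rewrite normrN ger0_norm; lra.
  rewrite -addrA -scalerDl (_ : s + - s = 0) ?scale0r ?addr0; last by ring.
  rewrite pairingZr normrZ exprMn normrN (@ger0_norm _ s); last by lra.
  by rewrite mulNr; apply.
have h3 := hs0 s; rewrite s_gt0 ss0 in h3; have {}h3 := h3 isT.
(* The combination of [h1] with weight [s] and [h2] with weight [1 - s] eliminates [p']. *)
have h1' := ler_wpM2l (ltW s_gt0) h1.
have h2' : (1 - s) * f y <= (1 - s) * (f (y + s *: h) - s * pairing p' h + K * (s ^+ 2 * `|h| ^+ 2) + e / 2 * s).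
  by rewrite ler_wpM2l//; lra.
have Kh : 0 <= K * `|h| ^+ 2 by rewrite mulr_ge0// sqr_ge0.
have h4 : 0 <= K * `|h| ^+ 2 * (s * s) by rewrite !mulr_ge0// ltW.
have : s * (f (y + h) - (f y + pairing p h + K * `|h| ^+ 2 + e)) <= 0 by lra.
by rewrite pmulr_rle0// subr_le0.
Qed.

(** The covectors obtained for the slacks [1 / (m + 1)] lie in a compact ball; any cluster point of
    them works without slack. *)
Lemma upper_quadratic_limit f (y : V) (A K r : R) : upper_quadratic f y A K r ->
  exists2 p : V, `|p| <= A &
    forall h : V, `|h| <= r -> f (y + h) <= f y + pairing p h + K * `|h| ^+ 2.
Proof.
move=> uq; have A0 : 0 <= A by have [p pA _] := uq 1 ltr01; apply: le_trans pA.
have /choice[u hu] (m : nat) : exists p : V, `|p| <= A /\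
    forall h : V, `|h| <= r -> f (y + h) <= f y + pairing p h + K * `|h| ^+ 2 + m.+1%:R^-1.
  by have [|p pA hp] := uq m.+1%:R^-1; [rewrite invr_gt0 | exists p].
pose B : set V := [set p | `|p| <= A].
have cB : compact B.
  apply: bounded_closed_compact.
    exists A; split; first exact: num_real.
    by move=> M AM p /= pA; exact: le_trans pA (ltW AM).
  have -> : B = (fun p : V => `|p|) @^-1` [set x | x <= A] by [].
  apply: closed_comp; last exact: closed_le.
  by move=> p _; exact: norm_continuous.
have [|p [pB cp]] := cB (u @ \oo) _ _.
  by exists 0%N => // m _ /=; have [] := hu m.
exists p => // h hr; apply/ler_addgt0Pr => e e0.
have e20 : 0 < e / 2 by lra.
pose c := n%:R * `|h| + 1.
have c0 : 0 < c by rewrite ltr_wpDl// mulr_ge0.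
have ball_p : nbhs p (ball p (e / 2 / c)) by apply: nbhsx_ballx; rewrite divr_gt0.
have tail : (u @ \oo) [set u m | m in [set m | m.+1%:R^-1 < e / 2]].
  have : \forall m \near \oo, m.+1%:R^-1 < e / 2 :> R by exact: near_infty_natSinv_lt (PosNum e20).
  by apply: filterS => m hm; exists m.
have [q [[m /= hm <-] /= qb]] := cp _ _ tail ball_p.
have [_ /(_ h hr)] := hu m.
have : pairing (u m - p) h <= e / 2.
  apply: le_trans (pairing_le _ _) _.
  move: qb; rewrite -ball_normE /= distrC => /ltW qb.
  apply: (@le_trans _ _ (e / 2 / c * (n%:R * `|h|))).
    by rewrite -mulrA mulrCA; apply: ler_pM => //; rewrite mulr_ge0.
  rewrite mulrAC ler_pdivrMr//; apply: ler_pM => //; rewrite ?mulr_ge0//; first exact: ltW.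
  by rewrite /c lerDl.
rewrite pairingBl => h1 h2; apply: le_trans h2 _.
by move: hm h1; move: (m.+1%:R^-1) => c' hm h1; lra.
Unshelve. all: by end_near. Qed.

Lemma small_quadratic_eq (u : V) (K r : R) : 0 < r -> 0 <= K ->
  (forall h : V, `|h| <= r -> pairing u h <= K * `|h| ^+ 2) -> u = 0.
Proof.
move=> r0 K0 hu; apply: contrapT => /eqP u0.
have nu : 0 < `|u| by rewrite normr_gt0.
pose s := Num.min (r / `|u|) (1 / (2 * (K + 1))).
have K2 : 0 < 2 * (K + 1) by lra.
have s0 : 0 < s by rewrite lt_min !divr_gt0.
have sr : `|s *: u| <= r.
  by rewrite normrZ gtr0_norm// -ler_pdivlMr// ge_min lexx.
have sK : s * (2 * (K + 1)) <= 1 by rewrite -ler_pdivlMr// ge_min lexx orbT.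
have := hu _ sr; rewrite pairingZr normrZ gtr0_norm// exprMn.
have := ler_wpM2l (ltW s0) (pairing_self u).
have su : 0 < s * `|u| ^+ 2 by rewrite mulr_gt0// exprn_gt0.
have := ler_wpM2r (ltW su) sK.
have : 0 <= K * (s * (s * `|u| ^+ 2)) by rewrite !mulr_ge0// ltW.
have : 0 <= s * (s * `|u| ^+ 2) by rewrite !mulr_ge0// ltW.
by lra.
Qed.

(** At [x] the upper and lower covectors coincide, because their difference is dominated by a
    quadratic term. At [y] the supergradient gives an upper bound at [y + w], which is compared with
    the lower paraboloid at [x] in the direction where [p' - q] decreases fastest. *)
Lemma gradient_estimate f (x : V) (A K r : R) : 0 < r -> 0 <= K ->
  (forall y : V, `|y - x| <= 2 * r -> upper_quadratic f y A K (2 * r)) ->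
  upper_quadratic (fun y => - f y) x A K r ->
  exists q : V, [/\ `|q| <= A,
    (forall h : V, `|h| <= r -> `|f (x + h) - f x - pairing q h| <= K * `|h| ^+ 2) &
    forall y p : V, `|y - x| <= r / 2 -> ray_supergradient f y p ->
      `|p - q| <= 6 * K * `|y - x|].
Proof.
move=> r0 K0 up low.
have upx : upper_quadratic f x A K (2 * r) by apply: up; rewrite subrr normr0 mulr_ge0// ltW.
have [p pA hp] := upper_quadratic_limit upx.
have [q' qA hq'] := upper_quadratic_limit low.
pose q := - q'.
have hq (h : V) : `|h| <= r -> f x + pairing q h - K * `|h| ^+ 2 <= f (x + h).
  by move=> /hq' h1; rewrite /q pairingNl; lra.
have pq : p = q.
  apply/esym/eqP; rewrite -subr_eq0; apply/eqP.
  apply: (@small_quadratic_eq _ (2 * K) r) => //; first by lra.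
  move=> h hr; have := hq _ hr; have := hp h; rewrite (le_trans hr) => [/(_ isT)|]; last by lra.
  by rewrite pairingBl; lra.
exists q; split; first by rewrite /q normrN.
  move=> h hr; rewrite ler_norml; have := hq _ hr; have := hp h.
  rewrite (le_trans hr) => [/(_ isT)|]; last by lra.
  by rewrite pq => ? ?; apply/andP; split; lra.
move=> y p' yr rs.
have key (s : R) : 0 <= s <= r / 2 -> s * `|p' - q| <= K * ((`|y - x| + s) ^+ 2 + `|y - x| ^+ 2 + s ^+ 2).
  move=> /andP[s0 sr].
  have [->|u0] := eqVneq (p' - q) 0.
    by rewrite normr0 mulr0 mulr_ge0// !addr_ge0 ?sqr_ge0.
  have nu : 0 < `|p' - q| by rewrite normr_gt0.
  pose w := (s / `|p' - q|) *: (q - p').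
  have nw : `|w| = s.
    by rewrite /w normrZ ger0_norm ?divr_ge0// -[q - p']opprB normrN divfK ?gt_eqF.
  have h1 : f (y + w) <= f y + pairing p' w + K * `|w| ^+ 2.
    apply: (@upper_quadratic_supergradient f y p' w A K (2 * r)) => //; last by rewrite nw; lra.
    move=> c /andP[c0 c1]; apply: up.
    rewrite addrAC; apply: le_trans (ler_normD _ _) _.
    rewrite normrZ ger0_norm// nw.
    have : c * s <= s by rewrite ler_piMl.
    by lra.
  have h2 : f y <= f x + pairing q (y - x) + K * `|y - x| ^+ 2.
    have := hp (y - x); rewrite pq addrCA subrr addr0; apply; by lra.
  have nyw : `|y - x + w| <= `|y - x| + s by rewrite -nw ler_normD.
  have h3 : f x + pairing q (y - x + w) - K * `|y - x + w| ^+ 2 <= f (y + w).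
    have := hq (y - x + w); rewrite addrA addrCA subrr addr0; apply.
    by apply: le_trans nyw _; lra.
  have h4 : K * `|y - x + w| ^+ 2 <= K * (`|y - x| + s) ^+ 2.
    by rewrite ler_wpM2l// lerXn2r ?nnegrE// addr_ge0.
  have h5 : s * `|p' - q| <= pairing (q - p') w.
    rewrite /w pairingZr -mulrA; apply: ler_wpM2l => //.
    rewrite mulrC ler_pdivlMr// -expr2 -normrN opprB; exact: pairing_self.
  move: h1 h3 h5; rewrite pairingDr pairingBl nw => h1 h3 h5; lra.
(* For [y] different from [x] the choice [s = |y - x|] produces [4 + 1 + 1 = 6]. For [y = x] the
   bound reads [s * |p' - q| <= 2 * K * s ^+ 2], and small [s] force [p' = q]. *)
have [yx0|yx0] := eqVneq `|y - x| 0.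
  rewrite yx0 mulr0; apply/ler_addgt0Pr => e e0; rewrite add0r.
  pose s := Num.min (r / 2) (e / (2 * (K + 1))).
  have K2 : 0 < 2 * (K + 1) by lra.
  have s0 : 0 < s by rewrite lt_min !divr_gt0.
  have sr : 0 <= s <= r / 2 by rewrite (ltW s0) ge_min lexx.
  have se : s * (2 * (K + 1)) <= e by rewrite -ler_pdivlMr// ge_min lexx orbT.
  have := key _ sr; rewrite yx0 add0r expr0n /= addr0 => hk; rewrite -(ler_pM2l s0); move: hk.
  have := ler_wpM2l (ltW s0) se.
  have : 0 <= s * s by rewrite mulr_ge0// ltW.
  by lra.
have yx : 0 < `|y - x| by rewrite lt0r yx0 /=.
have := key `|y - x|; rewrite (ltW yx) yr => /(_ isT).
by move=> h; rewrite -(ler_pM2l yx); lra.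
Qed.

End superdifferential.

(** * Second order bounds for a Tonelli Hamiltonian *)

Lemma compact_ge_pos (T : topologicalType) (R : realType) (K : set T) (g : T -> R) :
  compact K -> (forall x, K x -> {for x, continuous g}) -> (forall x, K x -> 0 < g x) ->
  exists2 c : R, 0 < c & forall x, K x -> c <= g x.
Proof.
move=> cK cg g0; have [->|/set0P K0] := eqVneq K set0; first by exists 1.
have [|x Kx hx] := compact_EVT_min K0 cK (f := g).
  by apply: continuous_in_subspaceT => x /set_mem; exact: cg.
exists (g x); first by apply: g0; exact: set_mem.
by move=> y Ky; apply: hx; exact: mem_set.
Qed.

Lemma compact_norm_le (T : topologicalType) (R : realType) (K : set T) (g : T -> R) :
  compact K -> (forall x, K x -> {for x, continuous g}) ->
  exists2 M : R, 0 <= M & forall x, K x -> `|g x| <= M.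
Proof.
move=> cK cg; have [->|/set0P K0] := eqVneq K set0; first by exists 0.
have [|x Kx hx] := compact_EVT_max K0 cK (f := fun x => `|g x|).
  apply: continuous_in_subspaceT => x /set_mem /cg cgx.
  by apply: continuous_comp => //; exact: norm_continuous.
exists `|g x| => // y Ky; apply: hx; exact: mem_set.
Qed.

Section lines.
Variables (R : realType) (V : normedModType R).
Implicit Types (F : V -> R^o) (z u : V).

Lemma is_derive_line (W : normedModType R) (F : V -> W) z u (s : R) : derivable F (z + s *: u) u ->
  is_derive s (1 : R^o) ((fun s => F (z + s *: u)) : R^o -> W) ('D_u F (z + s *: u)).
Proof.
have E : (fun h : R^o => h^-1 *: (((fun s => F (z + s *: u)) \o shift s) (h *: (1 : R^o)) - F (z + s *: u))) =
   (fun h => h^-1 *: ((F \o shift (z + s *: u)) (h *: u) - F (z + s *: u))).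
  apply/funext => h /=; congr (_ *: (F _ - _)).
  by rewrite -[h *: 1]/(h * 1) mulr1 scalerDl addrCA.
by move=> dF; apply: DeriveDef; rewrite /derivable /derive /= E.
Qed.

Lemma mvt_line F z u : (forall s : R, 0 <= s <= 1 -> derivable F (z + s *: u) u) ->
  exists2 s : R, 0 < s < 1 & F (z + u) - F z = 'D_u F (z + s *: u).
Proof.
move=> dF; pose g := (fun s => F (z + s *: u)) : R^o -> R^o.
have dg (s : R) : 0 <= s <= 1 -> is_derive s (1 : R^o) g ('D_u F (z + s *: u)).
  by move=> s01; apply: is_derive_line; exact: dF.
have [s||s] := @MVT R g (fun s => 'D_u F (z + s *: u)) 0 1 ltr01.
- by rewrite in_itv /= => /andP[s0 s1]; apply: dg; rewrite !ltW.
- apply: continuous_in_subspaceT => s; rewrite inE /= in_itv /= => /dg dgs.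
  apply: differentiable_continuous; apply/derivable1_diffP.
  exact: ex_derive.
- by rewrite in_itv /= => s01; rewrite /g scale1r scale0r addr0 subr0 mulr1 => ->; exists s.
Qed.

(** [k] is [F] along the segment minus its tangent and the parabola of curvature [m]. Its derivative
    is nonnegative by the mean value theorem applied to ['D_u F]. *)
Lemma taylor2_ge F z u (m : R) :
  (forall s : R, 0 <= s <= 1 -> derivable F (z + s *: u) u) ->
  (forall s : R, 0 <= s <= 1 -> derivable ('D_u F) (z + s *: u) u) ->
  (forall s : R, 0 <= s <= 1 -> m <= 'D_u ('D_u F) (z + s *: u)) ->
  F z + 'D_u F z + m / 2 <= F (z + u).
Proof.
move=> dF ddF hm.
pose g := (fun s => F (z + s *: u)) : R^o -> R^o.
pose g' := (fun s => 'D_u F (z + s *: u)) : R^o -> R^o.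
have dg (s : R) : 0 <= s <= 1 -> is_derive s (1 : R^o) g (g' s).
  by move=> s01; apply: is_derive_line; exact: dF.
have dg' (s : R) : 0 <= s <= 1 -> is_derive s (1 : R^o) g' ('D_u ('D_u F) (z + s *: u)).
  by move=> s01; apply: is_derive_line; exact: ddF.
have g'ge (s : R) : 0 < s <= 1 -> m * s <= g' s - g' 0.
  move=> /andP[s0 s1].
  have [c||c] := @MVT R g' (fun s => 'D_u ('D_u F) (z + s *: u)) 0 s s0.
  - by rewrite in_itv /= => /andP[c0 cs]; apply: dg'; rewrite ltW//= ltW// (lt_le_trans cs).
  - apply: continuous_in_subspaceT => c; rewrite inE /= in_itv /= => /andP[c0 cs].
    apply: differentiable_continuous; apply/derivable1_diffP.
    have := dg' c; rewrite c0 (le_trans cs s1) => /(_ isT) h; exact: ex_derive.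
  - rewrite in_itv /= => /andP[c0 cs] ->; rewrite subr0 ler_pM2r//; apply: hm.
    by rewrite !ltW// (lt_le_trans cs).
pose k := (fun s => g s - s * g' 0 - m / 2 * s ^+ 2) : R^o -> R^o.
have dk (s : R) : 0 <= s <= 1 -> is_derive s (1 : R^o) k (g' s - g' 0 - m * s).
  move=> s01; have := dg s s01 => dgs.
  have did : is_derive s (1 : R^o) (fun s : R^o => s : R^o) (1 : R^o) by exact: is_derive_id.
  have d2 := is_deriveZ (g' 0) did.
  have d3 := is_deriveZ (m / 2) (is_deriveM did did).
  have d4 := is_deriveB (is_deriveB dgs d2) d3.
  have kE : k = g - g' 0 \*: id - (m / 2) \*: ((id : R^o -> R^o) * id).
    apply/funext => x; change (g x - x * g' 0 - m / 2 * x ^+ 2 = g x - g' 0 * x - (m / 2) * (x * x)).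
    by ring.
  rewrite kE (_ : g' s - g' 0 - m * s = g' s - (g' 0)%:A - (m / 2) *: (s%:A + s%:A))//.
  by change (g' s - g' 0 - m * s = g' s - g' 0 * 1 - (m / 2) * (s * 1 + s * 1)); lra.
have [s||s] := @MVT R k (fun s => g' s - g' 0 - m * s) 0 1 ltr01.
- by rewrite in_itv /= => /andP[s0 s1]; apply: dk; rewrite !ltW.
- apply: continuous_in_subspaceT => s; rewrite inE /= in_itv /= => /dk dks.
  apply: differentiable_continuous; apply/derivable1_diffP.
  exact: ex_derive.
- rewrite in_itv /= subr0 mulr1 => /andP[s0 s1] h.
  have : 0 <= k 1 - k 0 by rewrite h subr_ge0 g'ge// s0 ltW.
  by rewrite /k /g /g' scale1r scale0r addr0 expr1n expr0n /= ; lra.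
Qed.

End lines.

Lemma continuous_at_fst (T U W : topologicalType) (f : T -> W) (x : T * U) :
  {for x.1, continuous f} -> {for x, continuous (fun y => f y.1)}.
Proof. by move=> cf; apply: (@continuous_comp _ _ _ fst f) => //; exact: cvg_fst. Qed.

Lemma continuous_at_snd (T U W : topologicalType) (f : U -> W) (x : T * U) :
  {for x.2, continuous f} -> {for x, continuous (fun y => f y.2)}.
Proof. by move=> cf; apply: (@continuous_comp _ _ _ snd f) => //; exact: cvg_snd. Qed.

Lemma continuous_at_sum (R : realType) (T : topologicalType) (I : finType)
    (f : I -> T -> R) (x : T) :
  (forall i, {for x, continuous (f i)}) -> {for x, continuous (fun y => \sum_i f i y)}.
Proof.
move=> cf; have -> : (fun y => \sum_i f i y) = \sum_i f i by apply/funext => y; rewrite fct_sumE.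
elim/big_ind : _ => [|g h cg ch|i _]; [exact: cst_continuous | exact: cvgD | exact: cf].
Qed.

(** * Uniform bounds on first and second derivatives over compact sets *)

Section second_order.
Variables (R : realType) (V : normedModType R) (I : finType) (b : I -> V) (c : I -> V -> R).
Hypothesis bE : forall u : V, u = \sum_i c i u *: b i.
Hypothesis c_le : forall i u, `|c i u| <= `|u|.
Variables (A : set V) (F : V -> R^o).
Hypothesis oA : open A.
Hypothesis C2F : Ck 2 A F.

Let dF z : A z -> differentiable F z. Proof. by case: C2F => h _; exact: h. Qed.
Let ddF u z : A z -> differentiable ('D_u F) z.
Proof. by case: C2F => _ /(_ u) [h _]; exact: h. Qed.
Let cF u v z : A z -> {for z, continuous ('D_u ('D_v F))}.
Proof. by case: C2F => _ /(_ v) [_ /(_ u)]; exact. Qed.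

Lemma derive_expand z u : A z -> 'D_u F z = \sum_i c i u * 'D_(b i) F z.
Proof.
move=> Az; rewrite deriveE; last exact: dF.
rewrite {1}(bE u) linear_sum; apply: eq_bigr => i _.
by rewrite linearZ deriveE//; exact: dF.
Qed.

(** [Ck] gives continuity of second derivatives for fixed directions only. The expansion in a basis
    is bilinear in the directions, so bounds and joint continuity in point and direction reduce to
    finitely many functions of the point. *)
Lemma hessian_expand z u v : A z ->
  'D_u ('D_v F) z = \sum_i \sum_j c i u * c j v * 'D_(b i) ('D_(b j) F) z.
Proof.
move=> Az; rewrite deriveE; last exact: ddF.
rewrite {1}(bE u) linear_sum; apply: eq_bigr => i _.
rewrite linearZ -deriveE; last exact: ddF.
have -> : 'D_(b i) ('D_v F) z = \sum_j c j v * 'D_(b i) ('D_(b j) F) z.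
  rewrite (@near_eq_derive _ _ _ _ (\sum_j (c j v *: 'D_(b j) F))).
    have : is_derive z (b i) (\sum_j (c j v *: 'D_(b j) F)) (\sum_j c j v *: 'D_(b i) ('D_(b j) F) z).
      elim/big_ind2 : _ => [|? ? ? ?|j _]; first exact: is_derive_cst.
        exact: is_deriveD.
      apply: is_deriveZ; apply: DeriveDef => //; exact/diff_derivable/ddF.
    by move=> h; rewrite derive_val.
  have := open_nbhs_nbhs (conj oA Az); apply: filterS => y Ay.
  by rewrite derive_expand// fct_sumE; apply: eq_bigr.
rewrite -[LHS]/(c i u * _) mulr_sumr; apply: eq_bigr => j _; rewrite mulrA//.
Qed.

Lemma hessian_bound (K : set V) : compact K -> K `<=` A ->
  exists2 M : R, 0 <= M & forall z u v, K z -> `|'D_u ('D_v F) z| <= M * `|u| * `|v|.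
Proof.
move=> cK KA.
have /choice[M hM] (ij : I * I) : exists M : R, 0 <= M /\
    forall z, K z -> `|'D_(b ij.1) ('D_(b ij.2) F) z| <= M.
  have [|M M0 hM] := @compact_norm_le _ _ K ('D_(b ij.1) ('D_(b ij.2) F)) cK.
    by move=> z /KA; exact: cF.
  by exists M.
exists (\sum_i \sum_j M (i, j)).
  by apply: sumr_ge0 => i _; apply: sumr_ge0 => j _; have [] := hM (i, j).
move=> z u v Kz; rewrite hessian_expand; last exact: KA.
rewrite !mulr_suml; apply: le_trans (ler_norm_sum _ _ _) _; apply: ler_sum => i _.
rewrite !mulr_suml; apply: le_trans (ler_norm_sum _ _ _) _; apply: ler_sum => j _.
have [M0 /(_ z Kz) /= h] := hM (i, j).
rewrite !normrM mulrC -mulrA; apply: ler_pM => //; last exact: ler_pM.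
Qed.

Lemma gradient_bound (K : set V) : compact K -> K `<=` A ->
  exists2 M : R, 0 <= M & forall z u, K z -> `|'D_u F z| <= M * `|u|.
Proof.
move=> cK KA.
have /choice[M hM] (i : I) : exists M : R, 0 <= M /\ forall z, K z -> `|'D_(b i) F z| <= M.
  have [|M M0 hM] := @compact_norm_le _ _ K ('D_(b i) F) cK.
    by move=> z /KA Az; apply: differentiable_continuous; exact: ddF.
  by exists M.
exists (\sum_i M i); first by apply: sumr_ge0 => i _; have [] := hM i.
move=> z u Kz; rewrite derive_expand; last exact: KA.
rewrite mulr_suml; apply: le_trans (ler_norm_sum _ _ _) _; apply: ler_sum => i _.
have [M0 /(_ z Kz) /= h] := hM i.
by rewrite normrM mulrC; apply: ler_pM.
Qed.

Lemma hessian_coercive (S : set V) (K : set V) : compact S -> compact K -> K `<=` A ->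
  (forall i, continuous (c i)) ->
  (forall z u, K z -> S u -> 0 < 'D_u ('D_u F) z) ->
  exists2 m : R, 0 < m & forall z u, K z -> S u -> m <= 'D_u ('D_u F) z.
Proof.
move=> cS cK KA cc pos.
have [|x [/=]|m m0 hm] := @compact_ge_pos _ _ (K `*` S)
  (fun x => \sum_i \sum_j c i x.2 * c j x.2 * 'D_(b i) ('D_(b j) F) x.1) (compact_setX cK cS).
- move=> x [/= Kx Sx].
  apply: continuous_at_sum => i; apply: continuous_at_sum => j; apply: cvgM; first apply: cvgM.
  + by apply: continuous_comp; [exact: cvg_snd | exact: cc].
  + by apply: continuous_comp; [exact: cvg_snd | exact: cc].
  + by apply: (@continuous_at_fst _ _ _ ('D_(b i) ('D_(b j) F)) x); apply: cF; exact: KA.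
- by move=> Kx Sx; rewrite -hessian_expand; [exact: pos | exact: KA].
exists m => // z u Kz Su; rewrite hessian_expand; last exact: KA.
exact: (hm (z, u)).
Qed.

End second_order.

Lemma closed_ball_compact (R : realType) (n : nat) (x : 'rV[R]_n) (r : R) :
  compact [set y | `|y - x| <= r].
Proof.
apply: bounded_closed_compact.
  exists (r + `|x|); split; first exact: num_real.
  move=> M rM y /= yr; rewrite -(subrK x y); apply: le_trans (ler_normD _ _) _.
  by apply: le_trans (ltW rM); rewrite lerD2r.
have -> : [set y | `|y - x| <= r] = closed_ball_ (fun z : 'rV[R]_n => `|z|) x r.
  by apply/seteqP; split => y /=; rewrite distrC.
exact: closed_closed_ball_.
Qed.

Lemma continuous_pair (T U W : topologicalType) (f : T -> U) (g : T -> W) (x : T) :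
  {for x, continuous f} -> {for x, continuous g} -> {for x, continuous (fun y => (f y, g y))}.
Proof. by move=> cf cg; exact: (cvg_pair cf cg). Qed.

Lemma pairing_continuous (R : realType) (n : nat) (v : 'rV[R]_n) :
  continuous (fun P : 'rV[R]_n => pairing P v).
Proof.
have -> : (fun P : 'rV[R]_n => pairing P v) = (fun P : 'rV[R]_n => \sum_i (P 0 i * v 0 i) : R).
  by apply/funext => P; rewrite pairingE.
move=> P; apply: continuous_at_sum => i.
have ci := @coord_continuous _ _ _ 0 i P.
exact: (cvgM ci (cvg_cst _)).
Qed.

(** [a], [b], [c], [d] are the four blocks of a Hessian in the directions [h] and [o]. Completing
    the square absorbs the mixed blocks into half of the coercive one. *)
Lemma hessian_split_le (R : realFieldType) (m M h o a b c d : R) : 0 < m ->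
  m * o ^+ 2 <= d -> `|c| <= M * o * h -> `|b| <= M * h * o -> `|a| <= M * h * h ->
  m / 2 * o ^+ 2 - (M + 2 * M ^+ 2 / m) * h ^+ 2 <= a + b + c + d.
Proof.
move=> m0; rewrite !ler_norml => k1 /andP[k2 _] /andP[k3 _] /andP[k4 _].
have : 0 <= (m * o - 2 * M * h) ^+ 2 / (2 * m).
  by rewrite divr_ge0 ?sqr_ge0// mulr_ge0// ltW.
have -> : (m * o - 2 * M * h) ^+ 2 / (2 * m) =
    m / 2 * o ^+ 2 - 2 * M * h * o + 2 * M ^+ 2 / m * h ^+ 2.
  by field; rewrite gt_eqF.
move=> sq; lra.
Qed.

(** The Taylor bound leaves [m / 4 * o ^+ 2], which absorbs the pairing of [o] with the velocity
    increment [w] by a second completion of the square. *)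
Lemma supporting_quadratic_le (R : realFieldType) (m M N h o w f0 f1 ah ov ow Pv Pw : R) :
  0 < m -> 0 <= h -> 0 <= w -> 0 <= M ->
  f0 + (ah + ov) + (m / 2 * o ^+ 2 - (M + 2 * M ^+ 2 / m) * h ^+ 2) / 2 <= f1 ->
  ow <= N * o * w ->
  ov + ow + (Pv + Pw) - f1 <=
  Pv - f0 + Pw - ah + (M + 2 * M ^+ 2 / m + N ^+ 2 / m) * (h ^+ 2 + w ^+ 2).
Proof.
move=> m0 h0 w0 M0 taylor oww.
have : 0 <= (m * o - 2 * N * w) ^+ 2 / (4 * m) by rewrite divr_ge0 ?sqr_ge0// mulr_ge0// ltW.
have -> : (m * o - 2 * N * w) ^+ 2 / (4 * m) =
    m / 4 * o ^+ 2 - N * o * w + N ^+ 2 / m * w ^+ 2.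
  by field; rewrite gt_eqF.
have k0 : 0 <= (M + 2 * M ^+ 2 / m) * h ^+ 2.
  by rewrite mulr_ge0 ?sqr_ge0// addr_ge0// divr_ge0 ?mulr_ge0 ?sqr_ge0// ltW.
have k1 : 0 <= (M + 2 * M ^+ 2 / m) * w ^+ 2.
  by rewrite mulr_ge0 ?sqr_ge0// addr_ge0// divr_ge0 ?mulr_ge0 ?sqr_ge0// ltW.
have k2 : 0 <= N ^+ 2 / m * h ^+ 2 by rewrite mulr_ge0 ?sqr_ge0// divr_ge0 ?sqr_ge0// ltW.
move=> sq; lra.
Qed.

Lemma row_basisE (R : realType) (n : nat) (v : 'rV[R]_n) :
  v = \sum_i v 0 i *: delta_mx 0 i.
Proof. by rewrite [LHS]matrix_sum_delta big_ord1. Qed.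

Lemma row_subE (R : realType) (n : nat) (v w : 'rV[R]_n) i : (v - w) 0 i = v 0 i - w 0 i.
Proof. by rewrite !mxE. Qed.

Lemma sphere_compact (R : realType) (n : nat) : compact [set w : 'rV[R]_n | `|w| = 1].
Proof.
apply: bounded_closed_compact.
  exists 1; split; first exact: num_real.
  by move=> r r1 w /= ->; exact: ltW.
have -> : [set w : 'rV[R]_n | `|w| = 1] = (fun w : 'rV[R]_n => `|w|) @^-1` [set 1] by [].
apply: closed_comp; last exact: closed_eq.
by move=> w _; exact: norm_continuous.
Qed.

Section tonelli_bounds.
Variables (R : realType) (n : nat).
Let V : normedModType R := 'rV[R]_n.
Variables (F : V * V -> R^o) (O : set V) (q0 : V) (rho : R).
Hypothesis oO : open O.
Hypothesis rho0 : 0 < rho.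
Hypothesis BO : forall q : V, `|q - q0| <= rho -> O q.
Hypothesis C2F : Ck 2 (O `*` setT) F.
Hypothesis F_convex : forall q P w : V, O q -> w != 0 -> 0 < 'D_(0, w) ('D_(0, w) F) (q, P).
Hypothesis F_superlinear : forall K : R, exists C : R, forall q P : V,
  `|q - q0| <= rho -> K * `|P| - C <= F (q, P).

Definition phase_basis (i : 'I_n + 'I_n) : V * V :=
  match i with inl j => (delta_mx 0 j, 0) | inr j => (0, delta_mx 0 j) end.

Definition phase_coord (i : 'I_n + 'I_n) (u : V * V) : R :=
  match i with inl j => u.1 0 j | inr j => u.2 0 j end.

Lemma phase_basisE (u : V * V) : u = \sum_i phase_coord i u *: phase_basis i.
Proof.
rewrite big_sumType /=; case: u => h w /=.
have -> : \sum_i h 0 i *: ((delta_mx 0 i, 0) : V * V) = (h, 0).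
  rewrite [in RHS](row_basisE h).
  elim/big_rec2 : _ => // i y1 y2 _ ->.
  by rewrite -[LHS]/(_, _) /= scaler0 add0r.
have -> : \sum_i w 0 i *: ((0, delta_mx 0 i) : V * V) = (0, w).
  rewrite [in RHS](row_basisE w).
  elim/big_rec2 : _ => // i y1 y2 _ ->.
  by rewrite -[LHS]/(_, _) /= scaler0 add0r.
by rewrite -[RHS]/(_, _) /= addr0 add0r.
Qed.

Lemma phase_coord_le i (u : V * V) : `|phase_coord i u| <= `|u|.
Proof.
rewrite prod_normE; case: i => i /=; apply: le_trans (coord_le_norm _ i) _;
by rewrite le_max lexx ?orbT.
Qed.

Lemma phase_coord_continuous i : continuous (phase_coord i).
Proof.
case: i => i u.
  by apply: (@continuous_at_fst _ _ _ (fun v : V => v 0 i)); exact: coord_continuous.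
by apply: (@continuous_at_snd _ _ _ (fun v : V => v 0 i)); exact: coord_continuous.
Qed.

Let oA : open (O `*` [set: V]).
Proof.
have -> : O `*` setT = @fst V V @^-1` O by apply/seteqP; split => [z []|z].
by apply: open_comp => // z _; exact: cvg_fst.
Qed.

Let box (A : R) : set (V * V) := [set q | `|q - q0| <= rho] `*` [set P | `|P| <= A].

Let cbox A : compact (box A).
Proof.
apply: compact_setX; first exact: closed_ball_compact.
have -> : [set P : V | `|P| <= A] = [set P : V | `|P - 0| <= A].
  by apply/seteqP; split => P /=; rewrite subr0.
exact: closed_ball_compact.
Qed.

Let boxA A : box A `<=` O `*` setT.
Proof. by move=> z [/= /BO]. Qed.

Let box_segment A (z u : V * V) (s : R) : box A z -> box A (z + u) -> 0 <= s <= 1 ->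
  box A (z + s *: u).
Proof.
move=> [/= h1 h2] [/= h3 h4] /andP[s0 s1].
have conv (a b : V) (r : R) : `|a| <= r -> `|a + b| <= r -> `|a + s *: b| <= r.
  move=> ar br; have -> : a + s *: b = (1 - s) *: a + s *: (a + b).
    by apply/rowP => i; rewrite !mxE; ring.
  apply: le_trans (ler_normD _ _) _; rewrite !normrZ !ger0_norm ?subr_ge0//.
  have e1 : (1 - s) * `|a| <= (1 - s) * r by rewrite ler_wpM2l ?subr_ge0.
  have e2 : s * `|a + b| <= s * r by rewrite ler_wpM2l.
  lra.
split => /=; last exact: conv.
by rewrite addrAC; apply: conv => //; rewrite addrAC.
Qed.

Let derF A (z u : V * V) : box A z -> derivable F z u.
Proof. by move=> /boxA Az; apply: diff_derivable; case: C2F => h _; exact: h. Qed.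

Let derdF A (z u v : V * V) : box A z -> derivable ('D_v F) z u.
Proof.
by move=> /boxA Az; apply: diff_derivable; case: C2F => _ /(_ v) [h _]; exact: h.
Qed.

Let hyp_bnd (K : R) : exists2 B : R, 0 <= B &
    forall q P : V, `|q - q0| < rho -> `|P| <= K -> `|F (q, P)| <= B.
Proof.
have [|B B0 hB] := @compact_norm_le _ _ (box K) F (@cbox K).
  move=> z /boxA Az; apply: differentiable_continuous; case: C2F => h _; exact: h.
by exists B => // q P /ltW hq hP; apply: hB.
Qed.

Let hyp_lip (K : R) : exists2 C : R, 0 <= C &
    forall q q' P : V, `|q - q0| < rho -> `|q' - q0| < rho -> `|P| <= K ->
      `|F (q, P) - F (q', P)| <= C * `|q - q'|.
Proof.
have [C C0 hC] := gradient_bound phase_basisE phase_coord_le C2F (@cbox K) (@boxA K).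
exists C => // q q' P /ltW hq /ltW hq' hP; rewrite distrC.
have h1 : box K (q, P) by [].
have E : (q, P) + (q' - q, 0) = (q', P) by rewrite -[LHS]/(_, _) /= addr0 addrCA subrr addr0.
have h2 : box K ((q, P) + (q' - q, 0)) by rewrite E.
have [s s01|s /andP[s0 s1]] := @mvt_line _ _ F (q, P) (q' - q, 0).
  by apply: (@derF K) => //; exact: box_segment.
rewrite E => ->; apply: le_trans (hC _ _ _) _.
  by apply: box_segment => //; rewrite !ltW.
by rewrite ler_wpM2l// prod_normE /= normr0 ge_max normr_ge0 distrC lexx.
Qed.

(** Two regimes for [Q]. If [Q] is large, superlinearity puts the left side below the right. If
    [|Q| <= R1], uniform convexity on a compact box gives a Taylor lower bound of [F] at [(q, P)];
    its first order part is [<a, h> + <Q - P, v>] because [P] is critical, and its quadratic part in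
    [Q - P] absorbs the mixed terms. *)
Lemma tonelli_ham_bounds : ham_bounds (fun q P => F (q, P)) q0 rho.
Proof.
split => // V0.
(* Bounds every velocity [v + w] with [|v| <= V0] and [|w| <= 1]; the slope [n%:R * W + 1] then
   leaves [- |Q|] after the pairing is subtracted. *)
pose W := `|V0| + 1.
have W0 : 0 < W by rewrite ltr_wpDl.
have [CK hCK] := F_superlinear (n%:R * W + 1).
have [B0 B00 hB0] := hyp_bnd 0.
(* For [|Q| > A1] one has [G Q <= - B0 <= G 0], so a maximum over the ball of radius [A1] is a
   global one. *)
pose A1 := `|CK + B0|.
have [M M0 hM] := gradient_bound phase_basisE phase_coord_le C2F (@cbox A1) (@boxA A1).
pose A := Num.max A1 M.
have A1A : A1 <= A by rewrite le_max lexx.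
have MA : M <= A by rewrite le_max lexx orbT.
have A0 : 0 <= A by apply: le_trans A1A; exact: normr_ge0.
(* Bounds [|<P, w>| + |<a, h>|] for all admissible [h] and [w], since two points of the ball differ
   by at most [2 * rho]. Beyond [R1 = A1 + X] superlinearity therefore beats the linear terms. *)
pose X := n%:R * A + n%:R * A * (2 * rho).
have X0 : 0 <= X by rewrite addr_ge0// !mulr_ge0// ltW.
pose R1 := A1 + X.
have A1R1 : A1 <= R1 by rewrite lerDl.
have [M2 M20 hM2] := hessian_bound phase_basisE phase_coord_le oA C2F (@cbox R1) (@boxA R1).
have cS : compact [set u : V * V | u.1 = 0 /\ `|u.2| = 1].
  have -> : [set u : V * V | u.1 = 0 /\ `|u.2| = 1] = [set 0] `*` [set w : V | `|w| = 1] by [].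
  by apply: compact_setX; [exact: compact_set1 | exact: sphere_compact].
have [|m m0 hm] := hessian_coercive phase_basisE oA C2F cS (@cbox R1) (@boxA R1) phase_coord_continuous.
  move=> [q P] [u1 u2] [/= hq _] [/= -> u21]; apply: F_convex; first exact: BO.
  by rewrite -normr_gt0 u21.
have coer z (w : V) : box R1 z -> m * `|w| ^+ 2 <= 'D_(0, w) ('D_(0, w) F) z.
  move=> bz; have [->|w0] := eqVneq w 0.
    rewrite normr0 expr0n mulr0 (hessian_expand phase_basisE oA C2F); last exact: boxA bz.
    by rewrite big1// => i _; rewrite big1// => j _; case: i => i; rewrite /= mxE !mul0r.
  have nw : 0 < `|w| by rewrite normr_gt0.
  have := hm z (0, `|w|^-1 *: w) bz; rewrite /= normrZ normfV normr_id mulVf ?gt_eqF//.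
  move=> /(_ (conj erefl erefl)).
  rewrite !(hessian_expand phase_basisE oA C2F); [|exact: boxA bz|exact: boxA bz].
  set S := (X in m <= X -> _); set S' := (X in _ -> _ <= X).
  have -> : S' = `|w| ^+ 2 * S.
    rewrite /S /S' mulr_sumr; apply: eq_bigr => i _; rewrite mulr_sumr; apply: eq_bigr => j _.
    case: i => i; case: j => j; rewrite /= !mxE ?mul0r ?mulr0 ?mul0r ?mulr0//.
    by field; rewrite gt_eqF.
  by rewrite mulrC ler_pM2l// exprn_gt0.
pose C2 := M2 + 2 * M2 ^+ 2 / m + n%:R ^+ 2 / m.
have C20 : 0 <= C2.
  by rewrite /C2 !addr_ge0// divr_ge0 ?mulr_ge0 ?sqr_ge0// ltW.
exists A, C2; split => // q v /[dup] hq /ltW hq' hv.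
have vW : `|v| + 1 <= W by rewrite lerD2r (le_trans hv)// ler_norm.
pose G (Q : V) : R := pairing Q v - F (q, Q).
have Oq : O q by exact: BO.
have dF z u : O z.1 -> derivable F z u.
  by move=> Oz; apply: diff_derivable; case: C2F => h _; apply: h; split.
have far q' v' Q : `|q' - q0| <= rho -> `|v'| <= W -> pairing Q v' - F (q', Q) <= - `|Q| + CK.
  move=> hq1 hv1; have h1 := hCK q' Q hq1.
  have h2 : pairing Q v' <= n%:R * W * `|Q|.
    by apply: le_trans (pairing_le _ _) _; rewrite -!mulrA ler_wpM2l// mulrC ler_pM.
  lra.
have FB0 : F (q, 0) <= B0.
  by apply: le_trans (ler_norm _) _; apply: hB0 => //; rewrite normr0.
have [P [PA1 Pmax]] : exists P, `|P| <= A1 /\ forall Q, G Q <= G P.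
  have ne : [set Q : V | `|Q - 0| <= A1] !=set0.
    by exists 0; rewrite /= subrr normr0 normr_ge0.
  have [|P /set_mem PA hP] := compact_EVT_max ne (@closed_ball_compact _ _ 0 A1) (f := G).
    apply: continuous_in_subspaceT => Q _.
    have c1 := @pairing_continuous R n v Q.
    have c2 : {for Q, continuous (fun Q' : V => F (q, Q'))}.
      apply: (@continuous_comp _ _ _ (fun Q : V => (q, Q)) F).
        by apply: continuous_pair; [exact: cst_continuous | exact: cvg_id].
      by apply: differentiable_continuous; case: C2F => h _; apply: h; split.
    exact: (cvgB c1 c2).
  rewrite /= subr0 in PA; exists P; split => // Q.
  have [QA|QA] := leP `|Q| A1; first by apply: hP; rewrite inE /= subr0.
  apply: (@le_trans _ _ (G 0)); last by apply: hP; rewrite inE /= subr0 normr0 normr_ge0.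
  have vW' : `|v| <= W by lra.
  have := far q v Q hq' vW'; rewrite /G pairing0l.
  have : CK + B0 <= A1 by exact: ler_norm.
  by lra.
have GP : - B0 <= G P by have := Pmax 0; rewrite {1}/G pairing0l; lra.
have DP w : 'D_(0, w) F (q, P) = pairing w v.
  pose g := (fun s : R => s * pairing w v - F ((q, P) + s *: (0, w))) : R^o -> R^o.
  have lineE (s : R) : (q, P) + s *: ((0, w) : V * V) = (q, P + s *: w).
    by rewrite -[LHS]/(_, _) /= scaler0 addr0.
  have dg (s : R) : is_derive s (1 : R^o) g (pairing w v - 'D_(0, w) F ((q, P) + s *: (0, w))).
    apply: is_deriveB; last first.
      by apply: is_derive_line; apply: dF; rewrite lineE.
    have -> : (fun s : R^o => s * pairing w v : R^o) = pairing w v \*: (id : R^o -> R^o).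
      by apply/funext => t; rewrite mulrC.
    have did : is_derive s (1 : R^o) (id : R^o -> R^o) (1 : R^o) by exact: is_derive_id.
    by have := is_deriveZ (pairing w v) did; rewrite -[_ *: (1 : R^o)]/(_ * _) mulr1.
  have h0 : is_derive (0 : R) (1 : R^o) g 0.
    apply: (@derive1_at_max _ g (-1) 1); first by lra.
    - by move=> s _; exact: ex_derive.
    - by rewrite in_itv /=; lra.
    move=> s _; rewrite /g !lineE scale0r addr0 mul0r.
    have := Pmax (P + s *: w); rewrite /G pairingDl pairingZl; lra.
  have [_ e1] := dg 0; have [_ e2] := h0.
  by move: e1; rewrite e2 scale0r addr0 => /esym/eqP; rewrite subr_eq0 => /eqP ->.
pose a : V := \row_i 'D_(delta_mx 0 i, 0) F (q, P).
have Da h : 'D_(h, 0) F (q, P) = pairing a h.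
  rewrite (derive_expand phase_basisE C2F); last by split.
  rewrite big_sumType /= [X in _ + X]big1 ?addr0; last by move=> i _; rewrite mxE mul0r.
  by rewrite pairingE; apply: eq_bigr => i _; rewrite mxE mulrC.
have boxP : box A1 (q, P) by split.
have aA : `|a| <= A.
  apply: norm_le_coord => // i; rewrite mxE; apply: le_trans (hM _ _ boxP) _.
  rewrite -[leRHS]mulr1; apply: ler_pM => //.
  rewrite prod_normE /= normr0 ge_max ler01 andbT.
  by apply: norm_le_coord => // j; rewrite mxE eqxx /=; case: eqP; rewrite ?normr1 ?normr0.
exists P, a; split => //; first exact: le_trans A1A.
move=> h w Q /ltW hh hw.
have hrho : `|h| <= 2 * rho.
  rewrite (_ : h = (q + h - q0) - (q - q0)); last by apply/rowP => i; rewrite !mxE; ring.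
  by apply: le_trans (ler_normB _ _) _; lra.
have Pw : `|pairing P w| <= n%:R * A.
  apply: le_trans (norm_pairing _ _) _; rewrite -mulrA ler_wpM2l// -[leRHS]mulr1.
  by apply: ler_pM => //; exact: le_trans A1A.
have ah : `|pairing a h| <= n%:R * A * (2 * rho).
  by apply: le_trans (norm_pairing _ _) _; rewrite -!mulrA ler_wpM2l//; apply: ler_pM.
have hC0 : 0 <= C2 * (`|h| ^+ 2 + `|w| ^+ 2) by rewrite mulr_ge0// addr_ge0 ?sqr_ge0.
have [QR|QR] := leP `|Q| R1; last first.
  have vwW : `|v + w| <= W by apply: le_trans (ler_normD _ _) _; apply: le_trans vW; rewrite lerD2l.
  have := far (q + h) (v + w) Q hh vwW.
  have := Pmax 0; rewrite {1}/G pairing0l /G.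
  have : CK + B0 <= A1 by exact: ler_norm.
  move: Pw ah; rewrite !ler_norml => /andP[Pw _] /andP[_ ah].
  by rewrite /R1 /X in QR *; lra.
pose om := Q - P.
have u1 : box R1 (q, P) by split => //=; exact: le_trans A1R1.
have zE : (q, P) + (h, om) = (q + h, Q) by rewrite -[LHS]/(_, _) /= addrCA subrr addr0.
have u2 : box R1 ((q, P) + (h, om)) by rewrite zE; split.
(* The expansion splits the Hessian into four blocks; the block in [om] is coercive, the other three
   are bounded through [M2]. *)
have hess z : box R1 z -> m / 2 * `|om| ^+ 2 - (M2 + 2 * M2 ^+ 2 / m) * `|h| ^+ 2 <=
    'D_(h, om) ('D_(h, om) F) z.
  move=> bz; have Az := boxA bz.
  pose H (u v : V * V) := 'D_u ('D_v F) z.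
  have HE u1' u2' : H u1' u2' = \sum_i \sum_j phase_coord i u1' * phase_coord j u2' *
       'D_(phase_basis i) ('D_(phase_basis j) F) z.
    exact: (hessian_expand phase_basisE oA C2F).
  have -> : 'D_(h, om) ('D_(h, om) F) z = H (h, 0) (h, 0) + H (h, 0) (0, om) + H (0, om) (h, 0) + H (0, om) (0, om).
    rewrite -/(H _ _) !HE -!big_split /=; apply: eq_bigr => i _.
    rewrite -!big_split /=; apply: eq_bigr => j _; rewrite -!mulrDl; congr (_ * _).
    by case: i => i; case: j => j; rewrite /= !mxE; ring.
  have nh : `|((h, 0) : V * V)| = `|h| by rewrite prod_normE /= normr0; apply/max_idPl.
  have no : `|((0, om) : V * V)| = `|om| by rewrite prod_normE /= normr0; apply/max_idPr.
  have := hM2 z (h, 0) (h, 0) bz; have := hM2 z (h, 0) (0, om) bz; have := hM2 z (0, om) (h, 0) bz.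
  have := coer z om bz; rewrite -/(H _ _) nh no.
  rewrite -!/(H _ _); exact: hessian_split_le.
have := @taylor2_ge _ _ F (q, P) (h, om) (m / 2 * `|om| ^+ 2 - (M2 + 2 * M2 ^+ 2 / m) * `|h| ^+ 2).
rewrite zE.
have -> : 'D_(h, om) F (q, P) = pairing a h + pairing om v.
  rewrite -Da -DP !(derive_expand phase_basisE C2F); [|by split..].
  rewrite -big_split /=; apply: eq_bigr => i _; rewrite -mulrDl; congr (_ * _).
  by case: i => i /=; rewrite /om !mxE; ring.
have seg (s : R) : 0 <= s <= 1 -> box R1 ((q, P) + s *: (h, om)) by exact: box_segment.
have s1 (s : R) : 0 <= s <= 1 -> derivable F ((q, P) + s *: (h, om)) (h, om).
  by move=> /seg; exact: derF.
have s2 (s : R) : 0 <= s <= 1 -> derivable ('D_(h, om) F) ((q, P) + s *: (h, om)) (h, om).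
  by move=> /seg; exact: derdF.
move=> taylor; have {}taylor := taylor s1 s2 (fun s hs => hess _ (seg s hs)).
have ow : pairing om w <= n%:R * `|om| * `|w| by exact: pairing_le.
have QE : Q = om + P by rewrite subrK.
have -> : pairing Q (v + w) = pairing om v + pairing om w + (pairing P v + pairing P w).
  by rewrite QE pairingDl !pairingDr.
exact: (supporting_quadratic_le _ _ m0 (normr_ge0 h) (normr_ge0 w) M20 taylor ow).
Qed.

End tonelli_bounds.

(** * Changes of charts *)

Section differentiability.
Variables (R : realType) (V W : normedModType R).
Implicit Types (f g : V -> W).

Lemma differentiable_littleo f x (L : {linear V -> W}) : continuous L ->
  (forall e : R, 0 < e -> \forall h \near (0 : V), `|f (h + x) - f x - L h| <= e * `|h|) ->
  differentiable f x /\ 'd f x = L :> (V -> W).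
Proof.
move=> cL fL.
have E : f \o shift x = cst (f x) + L +o_ (0 : V) id.
  apply/eqaddoP => e e0; have := fL e e0; apply: filterS => h.
  by rewrite /= -[(_ - _) h]/(f (h + x) - (f x + L h)) opprD addrA.
have dL := diff_unique cL E.
by split => //; apply/diff_locallyP; rewrite dL.
Qed.

Lemma near_eq_differentiable f g x : (\forall y \near x, f y = g y) ->
  differentiable g x -> differentiable f x /\ 'd f x = 'd g x :> (V -> W).
Proof.
move=> fg dg; apply: differentiable_littleo; first exact: diff_continuous.
move=> e e0; have /diff_locally/eqaddoP/(_ e e0) := dg.
have fg0 : \forall h \near (0 : V), f (h + x) = g (h + x).
  suff key y : y = 0 + x -> (fun h : V => h + x) @ (0 : V) --> y.
    exact: (key x (esym (add0r x)) _ fg).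
  by move=> ->; apply: cvgD; [exact: cvg_id | exact: cvg_cst].
apply: filterS2 fg0 => h E.
rewrite -[(_ - _) h]/(g (h + x) - (g x + 'd g x h)) opprD addrA E.
by rewrite (nbhs_singleton fg).
Qed.

End differentiability.

Lemma derive_comp_near (R : realType) (U V W : normedModType R) (f : U -> V) (g : V -> W)
    (h : U -> W) x y : (\forall z \near x, h z = g (f z)) -> y = f x ->
  differentiable f x -> differentiable g y ->
  differentiable h x /\ forall v, 'D_v h x = 'D_('D_v f x) g y.
Proof.
move=> E -> df dg; have [dh dE] := near_eq_differentiable (g := g \o f) E (differentiable_comp df dg).
split => // v; rewrite (deriveE v df) (deriveE _ dg) (deriveE v dh) dE.
by rewrite (diff_comp df dg).
Qed.

Lemma derive_near (R : realType) (V W : normedModType R) (f g : V -> W) x :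
  (\forall y \near x, f y = g y) -> differentiable g x ->
  differentiable f x /\ forall v, 'D_v f x = 'D_v g x.
Proof.
move=> E dg; have [df dE] := near_eq_differentiable E dg; split => // v.
by rewrite (deriveE v df) (deriveE v dg) dE.
Qed.

Section charts.
Variables (R : realType) (n : nat) (T : topologicalType).
Implicit Types (c : chart R n T) (x : T).

Lemma cimg_cmap c x : cdom c x -> cimg c (cmap c x).
Proof. by exists x. Qed.

Lemma cinvP c q : cimg c q -> cdom c (cinv c q) /\ cmap c (cinv c q) = q.
Proof. by move=> [x cx <-]; rewrite cmapK. Qed.

Lemma near_cinv c (A : set T) x : cdom c x -> nbhs x A ->
  \forall q \near cmap c x, cimg c q /\ A (cinv c q).
Proof.
move=> cx xA; have Ix := cimg_cmap cx; apply: filterI.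
  by apply: open_nbhs_nbhs; split => //; exact: cimg_open.
by apply: (cinv_continuous Ix); rewrite cmapK.
Qed.

Lemma near_cdom c x : cdom c x -> nbhs x (cdom c).
Proof. by move=> cx; apply: open_nbhs_nbhs; split => //; exact: cdom_open. Qed.

Lemma transition_differentiable c c' x : smooth_transition c c' -> cdom c x -> cdom c' x ->
  differentiable (cmap c' \o cinv c) (cmap c x).
Proof. by move=> /(_ 1%N) [h _] cx cx'; apply: h; exists x. Qed.

Lemma trans_derive c c' x v : smooth_transition c c' -> cdom c x -> cdom c' x ->
  'D_v (cmap c' \o cinv c) (cmap c x) = v *m trans c c' x.
Proof. by move=> s cx cx'; exact: deriveEjacobian (transition_differentiable s cx cx'). Qed.

Lemma change_of_chart (W : normedModType R) (f : T -> W) c c' x :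
  smooth_transition c c' -> cdom c x -> cdom c' x ->
  differentiable (f \o cinv c') (cmap c' x) ->
  differentiable (f \o cinv c) (cmap c x) /\
  forall v, 'D_v (f \o cinv c) (cmap c x) = 'D_(v *m trans c c' x) (f \o cinv c') (cmap c' x).
Proof.
move=> cc' cx cx' df; have dt := transition_differentiable cc' cx cx'.
have E : \forall q \near cmap c x, (f \o cinv c) q = (f \o cinv c') ((cmap c' \o cinv c) q).
  have := near_cinv cx (near_cdom cx'); apply: filterS => q [_ h] /=.
  by rewrite cmapK.
have tx : cmap c' x = (cmap c' \o cinv c) (cmap c x) by rewrite /= cmapK.
have [dh hE] := derive_comp_near E tx dt df; split => // v.
apply: (etrans (hE v)); exact: (congr1 (fun w => 'D_w (f \o cinv c') (cmap c' x)) (trans_derive v cc' cx cx')).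
Qed.

Lemma mulmx_row_inj (A B : 'M[R]_n) : (forall v : 'rV_n, v *m A = v *m B) -> A = B.
Proof. by move=> h; apply/row_matrixP => i; rewrite !rowE. Qed.

Lemma trans_comp c c' c'' x : smooth_transition c c' -> smooth_transition c' c'' ->
  cdom c x -> cdom c' x -> cdom c'' x ->
  trans c c'' x = trans c c' x *m trans c' c'' x.
Proof.
move=> s1 s2 cx cx' cx''; have d2 := transition_differentiable s2 cx' cx''.
have [d h] := change_of_chart (f := cmap c'') s1 cx cx' d2.
apply: mulmx_row_inj => v; rewrite mulmxA.
exact: etrans (esym (deriveEjacobian v d)) (etrans (h v) (trans_derive _ s2 cx' cx'')).
Qed.

Lemma trans_id c x : cdom c x -> trans c c x = 1%:M.
Proof.
move=> cx; have di : differentiable (id : 'rV[R]_n -> 'rV[R]_n) (cmap c x) by [].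
have [|d dE] := derive_near (f := cmap c \o cinv c) _ di.
  by have := near_cinv cx (near_cdom cx); apply: filterS => q [/cinvP[]].
apply: mulmx_row_inj => v; rewrite mulmx1.
exact: etrans (esym (deriveEjacobian v d)) (etrans (dE v) (derive_id _ _)).
Qed.

Lemma transK c c' x : compatible c c' -> cdom c x -> cdom c' x ->
  trans c c' x *m trans c' c x = 1%:M.
Proof. by move=> [s s'] cx cx'; rewrite -trans_comp// trans_id. Qed.

Lemma curve_change_of_chart c c' (gamma : R -> T) (s : R) (w : 'rV[R]_n) :
  smooth_transition c c' -> {for s, continuous gamma} ->
  cdom c (gamma s) -> cdom c' (gamma s) ->
  is_derive s (1 : R^o) (cmap c \o gamma : R^o -> 'rV[R]_n) w ->
  is_derive s (1 : R^o) (cmap c' \o gamma : R^o -> 'rV[R]_n) (w *m trans c c' (gamma s)).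
Proof.
move=> cc' cg cs cs' [dw ew].
have dt := transition_differentiable cc' cs cs'.
have /derivable1_diffP dg := dw.
have E : \forall u \near (s : R^o), (cmap c' \o gamma) u =
    (cmap c' \o cinv c) ((cmap c \o gamma : R^o -> 'rV[R]_n) u).
  have : \forall u \near s, cdom c (gamma u) by apply: cg; exact: near_cdom.
  by apply: filterS => u cu; rewrite /= cmapK.
have [d dE] := derive_comp_near (U := R^o) E (erefl _) dg dt.
apply: DeriveDef; first exact/derivable1_diffP.
apply: (etrans (dE 1)); rewrite ew; exact: trans_derive.
Qed.

End charts.

(** Near [a] each partial derivative stays below its norm at [a] plus [1]. The mean value theorem
    needs real values, hence is applied coordinate by coordinate, which suits the maximum norm. *)
Lemma C1_lipschitz (R : realType) (n m : nat) (A : set 'rV[R]_n) (f : 'rV[R]_n -> 'rV[R]_m) a :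
  open A -> Ck 1 A f -> A a ->
  exists r C : R, [/\ 0 < r, 0 <= C, (forall x, `|x - a| < r -> A x) &
    forall x y, `|x - a| < r -> `|y - a| < r -> `|f y - f x| <= C * `|y - x|].
Proof.
move=> oA [df cf] Aa.
pose M i := `|'D_(delta_mx 0 i) f a| + 1.
pose C := \sum_i M i.
have M0 i : 0 <= M i by rewrite addr_ge0.
have near1 : \forall z \near a, A z /\ forall i, `|'D_(delta_mx 0 i) f z| <= M i.
  apply: filterI; first exact: open_nbhs_nbhs.
  apply: (@filter_forall _ _ (fun i z => `|'D_(delta_mx 0 i) f z| <= M i) (nbhs a) (nbhs_filter a)) => i.
  have ci : {for a, continuous ('D_(delta_mx 0 i) f)} by exact: cf.
  have := @cvgr_norm_le _ _ _ _ _ _ _ ci (M i); apply.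
  by rewrite /M ltrDl.
have [r /= r0 hr] := (nbhs_normP _ _).1 near1.
have {}hr z : `|z - a| < r -> A z /\ forall i, `|'D_(delta_mx 0 i) f z| <= M i.
  by move=> za; apply: hr; rewrite /= distrC.
exists r, C; split => //; first exact: sumr_ge0.
  by move=> x /hr[].
have Du z u : `|z - a| < r -> `|'D_u f z| <= C * `|u|.
  move=> /[dup] /hr[Az hz] za.
  rewrite (deriveE u (df z Az)) (row_basisE u) linear_sum mulr_suml.
  apply: le_trans (ler_norm_sum _ _ _) _; apply: ler_sum => i _.
  rewrite linearZ normrZ mulrC -row_basisE; apply: ler_pM => //; last exact: coord_le_norm.
  by rewrite -(deriveE _ (df z Az)).
move=> x y xa ya; apply: norm_le_coord => [|j]; first by rewrite mulr_ge0// sumr_ge0.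
pose g := (fun z => f z 0 j) : 'rV[R]_n -> R^o.
have seg (s : R) : 0 <= s <= 1 -> `|x + s *: (y - x) - a| < r by exact: ball_segment.
have dg z : `|z - a| < r -> derivable f z (y - x).
  by move=> /hr[Az _]; apply: diff_derivable; exact: df.
have [s /seg /dg /derivable_mxP|s /andP[s0 s1]] := @mvt_line _ _ g x (y - x); first exact.
rewrite /g addrCA subrr addr0 mxE mxE => ->.
have sx : `|x + s *: (y - x) - a| < r by apply: seg; rewrite !ltW.
have -> : 'D_(y - x) g (x + s *: (y - x)) = ('D_(y - x) f (x + s *: (y - x))) 0 j.
  by rewrite (derive_mx (dg _ sx)) mxE.
by apply: le_trans (coord_le_norm _ _) _; exact: Du.
Qed.

Lemma open_overlap (R : realType) (n : nat) (T : topologicalType) (c c' : chart R n T) :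
  open (cmap c @` (cdom c `&` cdom c')).
Proof.
rewrite openE => _ [x [cx cx'] <-]; rewrite /interior.
have := near_cinv cx (near_cdom cx'); apply: filterS => q [/cinvP[h1 h2] h3].
by exists (cinv c q).
Qed.

Lemma trans_row (R : realType) (n : nat) (T : topologicalType) (c c' : chart R n T) x (P : 'rV[R]_n) i :
  smooth_transition c c' -> cdom c x -> cdom c' x ->
  (P *m (trans c c' x)^T) 0 i = pairing P ('D_(delta_mx 0 i) (cmap c' \o cinv c) (cmap c x)).
Proof.
move=> s cx cx'; rewrite (trans_derive _ s cx cx') -rowE pairingE mxE.
by apply: eq_bigr => j _; rewrite !mxE.
Qed.

(** The matrix is the Jacobian of [cmap c \o cinv e] at [cmap e x], while points are measured in
    [c]. So a Lipschitz bound for the derivatives of this transition is composed with one for the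
    opposite transition. *)
Lemma trans_lipschitz (R : realType) (n : nat) (T : topologicalType) (c e : chart R n T) x0 :
  compatible c e -> cdom c x0 -> cdom e x0 ->
  exists r K : R, [/\ 0 < r, 0 <= K,
    (forall x, cdom c x -> `|cmap c x - cmap c x0| < r -> cdom e x),
    (forall x (P : 'rV[R]_n), cdom c x -> `|cmap c x - cmap c x0| < r ->
       `|P *m (trans e c x)^T| <= K * `|P|) &
    forall x y (P : 'rV[R]_n), cdom c x -> `|cmap c x - cmap c x0| < r ->
       cdom c y -> `|cmap c y - cmap c x0| < r ->
       `|P *m (trans e c y)^T - P *m (trans e c x)^T| <= K * `|P| * `|cmap c y - cmap c x|].
Proof.
move=> [ce ec] cx ex.
have [r1 [K1 [r10 K10 h1 l1]]] : exists r C : R, [/\ 0 < r, 0 <= C,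
    (forall q, `|q - cmap c x0| < r -> (cmap c @` (cdom c `&` cdom e)) q) &
    forall x y, `|x - cmap c x0| < r -> `|y - cmap c x0| < r ->
      `|(cmap e \o cinv c) y - (cmap e \o cinv c) x| <= C * `|y - x|].
  by apply: C1_lipschitz; [exact: open_overlap | exact: (ce 1%N) | exists x0].
have /choice[rC hrC] (i : 'I_n) : exists rC : R * R, [/\ 0 < rC.1, 0 <= rC.2 &
    forall x y, `|x - cmap e x0| < rC.1 -> `|y - cmap e x0| < rC.1 ->
      `|'D_(delta_mx 0 i) (cmap c \o cinv e) y - 'D_(delta_mx 0 i) (cmap c \o cinv e) x|
        <= rC.2 * `|y - x|].
  have [||r [C [r0 C0 _ l]]] := @C1_lipschitz _ _ _ _ ('D_(delta_mx 0 i) (cmap c \o cinv e))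
    (cmap e x0) (@open_overlap _ _ _ e c).
  - by have [_] := ec 2%N; exact.
  - by exists x0.
  - by exists (r, C).
pose r2 := \big[Num.min/1]_i (rC i).1.
have r20 : 0 < r2 by rewrite /r2; elim/big_ind : _ => // [x y x0' y0|i _]; [rewrite lt_min x0' | have [] := hrC i].
have r2i i : r2 <= (rC i).1 by exact: bigmin_le_cond.
(* The second term makes [K1 * r < r2], so the ball of radius [r] in [c] is sent into the ball of
   radius [r2] in [e]. *)
pose r := Num.min r1 (r2 / (K1 + 1)).
have r0 : 0 < r by rewrite lt_min r10 divr_gt0// ltr_wpDl.
have rr1 : r <= r1 by rewrite ge_min lexx.
have rr2 : K1 * r < r2.
  have : r * (K1 + 1) <= r2 by rewrite -ler_pdivlMr ?ltr_wpDl// ge_min lexx orbT.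
  lra.
have dom x : cdom c x -> `|cmap c x - cmap c x0| < r -> cdom e x.
  move=> cx1 xr; have [|y [cy ey] E] := h1 (cmap c x); first exact: lt_le_trans rr1.
  by rewrite -(cmapK cx1) -E cmapK.
have emap x y : cdom c x -> `|cmap c x - cmap c x0| < r -> cdom c y -> `|cmap c y - cmap c x0| < r ->
    `|cmap e y - cmap e x| <= K1 * `|cmap c y - cmap c x|.
  move=> cx1 xr cy1 yr; have := l1 (cmap c x) (cmap c y); rewrite /= !cmapK//; apply.
    exact: lt_le_trans rr1.
  exact: lt_le_trans rr1.
have ex0 x : cdom c x -> `|cmap c x - cmap c x0| < r -> `|cmap e x - cmap e x0| < r2.
  move=> cx1 xr; apply: le_lt_trans (emap x0 x _ _ _ _) _ => //; first by rewrite subrr normr0.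
  by apply: le_lt_trans rr2; rewrite ler_wpM2l// ltW.
pose Cm := \sum_i (rC i).2.
have Cmi i : (rC i).2 <= Cm.
  by rewrite /Cm (bigD1 i)//= lerDl; apply: sumr_ge0 => j _; have [] := hrC j.
have Cm0 : 0 <= Cm by apply: sumr_ge0 => j _; have [] := hrC j.
pose D i := 'D_(delta_mx 0 i) (cmap c \o cinv e).
pose Dm := \sum_i `|D i (cmap e x0)|.
have Dmi i : `|D i (cmap e x0)| <= Dm by rewrite /Dm (bigD1 i)//= lerDl sumr_ge0.
have Dm0 : 0 <= Dm by exact: sumr_ge0.
have lD i x y : cdom c x -> `|cmap c x - cmap c x0| < r -> cdom c y -> `|cmap c y - cmap c x0| < r ->
    `|D i (cmap e y) - D i (cmap e x)| <= Cm * K1 * `|cmap c y - cmap c x|.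
  move=> cx1 xr cy1 yr; have [ri Ci hi] := hrC i.
  apply: le_trans (hi _ _ _ _) _.
  - by apply: lt_le_trans (r2i i); exact: ex0.
  - by apply: lt_le_trans (r2i i); exact: ex0.
  - by rewrite -mulrA; apply: ler_pM => //; exact: emap.
have bD i x : cdom c x -> `|cmap c x - cmap c x0| < r -> `|D i (cmap e x)| <= Dm + Cm * K1 * r.
  move=> cx1 xr; rewrite -(subrK (D i (cmap e x0)) (D i (cmap e x))).
  apply: le_trans (ler_normD _ _) _; rewrite addrC; apply: lerD => //.
  apply: le_trans (lD _ x0 _ _ _ _ _) _ => //; first by rewrite subrr normr0.
  by rewrite ler_wpM2l ?mulr_ge0// ltW.
have E0 : 0 <= Dm + Cm * K1 * r by rewrite addr_ge0// !mulr_ge0// ltW.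
exists r, (n%:R * (Dm + Cm * K1 * r) + n%:R * (Cm * K1)); split => //.
- by rewrite addr_ge0// !mulr_ge0.
- move=> x P cx1 xr; apply: norm_le_coord => [|i]; first by rewrite mulr_ge0// addr_ge0// !mulr_ge0.
  rewrite trans_row//; last exact: dom.
  apply: le_trans (norm_pairing _ _) _.
  have h := ler_wpM2l (mulr_ge0 (ler0n R n) (normr_ge0 P)) (bD i x cx1 xr).
  apply: le_trans h _.
  have -> : n%:R * `|P| * (Dm + Cm * K1 * r) = (n%:R * (Dm + Cm * K1 * r)) * `|P| by ring.
  by rewrite ler_wpM2r// lerDl !mulr_ge0.
- move=> x y P cx1 xr cy1 yr.
  apply: norm_le_coord => [|i]; first by rewrite !mulr_ge0// addr_ge0// !mulr_ge0.
  have [Ex Ey] := (trans_row P i ec (dom x cx1 xr) cx1, trans_row P i ec (dom y cy1 yr) cy1).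
  rewrite row_subE [X in X - _]Ey [X in _ - X]Ex.
  rewrite -pairingBr; apply: le_trans (norm_pairing _ _) _.
  have h := ler_wpM2l (mulr_ge0 (ler0n R n) (normr_ge0 P)) (lD i x y cx1 xr cy1 yr).
  apply: le_trans h _.
  have -> : n%:R * `|P| * (Cm * K1 * `|cmap c y - cmap c x|) =
    n%:R * (Cm * K1) * `|P| * `|cmap c y - cmap c x| by ring.
  by rewrite ler_wpM2r// ler_wpM2r// lerDr mulr_ge0.
Qed.

(** * Absolutely continuous curves in a chart *)

(** Connectedness of a segment: the supremum of the times up to which [P] holds throughout is
    reached by the last hypothesis and passed by the middle one. It carries the continuation
    arguments along curves. *)
Lemma real_induction (R : realType) (a b : R) (P : R -> Prop) : a <= b -> P a ->
  (forall s, a <= s < b -> P s -> exists2 d, 0 < d & forall u, s <= u -> u <= s + d -> u <= b -> P u) ->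
  (forall s, a < s <= b -> (forall u, a <= u < s -> P u) -> P s) ->
  forall s, a <= s <= b -> P s.
Proof.
move=> ab Pa Pr Pl.
pose E := [set s | a <= s <= b /\ forall u, a <= u <= s -> P u].
have Ea : E a by split => [|u]; rewrite ?lexx// -eq_le => /eqP <-.
have Eb : has_sup E by split; [exists a | exists b => s [/andP[]]].
have aE : a <= sup E by apply: ub_le_sup => //; exact: Eb.2.
have Eb' : sup E <= b by apply: ge_sup => [|s [/andP[]]//]; exists a.
have ltE u : a <= u -> u < sup E -> P u.
  move=> au uE; have [|s [_ hs] us] := @sup_adherent _ E (sup E - u) _ Eb; first by rewrite subr_gt0.
  by apply: hs; rewrite au ltW//; move: us; rewrite opprB addrCA subrr addr0.
have PE : P (sup E).
  have [E0|aE'] := eqVneq (sup E) a; first by rewrite E0.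
  by apply: Pl => [|u /andP[]]; [rewrite Eb' lt_neqAle eq_sym aE' aE | exact: ltE].
have [Es|Es] := ltP (sup E) b.
  have aEb : a <= sup E < b by rewrite aE Es.
  have [d d0 hd] := Pr _ aEb PE.
  pose v := Num.min b (sup E + d).
  suff : E v.
    move=> /(ub_le_sup Eb.2); have : sup E < v by rewrite lt_min Es ltrDl.
    by move=> h1 /(lt_le_trans h1); rewrite ltxx.
  split; first by rewrite le_min ge_min lexx (le_trans aE Eb') (le_trans aE)// lerDl ltW.
  move=> u /andP[au]; rewrite le_min => /andP[ub ud].
  by have [uE|uE] := ltP u (sup E); [exact: ltE | exact: hd].
have -> : b = sup E by apply/eqP; rewrite eq_le Es Eb'.
move=> s /andP[as_]; rewrite le_eqVlt => /orP[/eqP ->//|]; exact: ltE.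
Qed.

Lemma ae_neq (R : realType) (a : R) : {ae @lebesgue_measure R, forall x, x != a}.
Proof.
exists [set a]; split; [exact: measurable_set1 | exact: lebesgue_measure_set1|].
by move=> x /= /negP; rewrite negbK => /eqP.
Qed.

Definition ac_on (R : realType) (n : nat) (f : R -> 'rV[R]_n) (a b : R) : Prop :=
  forall e : R, 0 < e -> exists2 d : R, 0 < d & forall s : seq (R * R),
    all (fun x => [&& a <= x.1, x.1 <= x.2 & x.2 <= b]) s -> pairwise (@sep_itv R) s ->
    \sum_(x <- s) (x.2 - x.1) < d -> \sum_(x <- s) `|f x.2 - f x.1| <= e.

Lemma lipschitz_ac_on (R : realType) (n : nat) (f : R -> 'rV[R]_n) (a b K : R) : 0 <= K ->
  (forall x y, a <= x -> x <= y -> y <= b -> `|f y - f x| <= K * (y - x)) -> ac_on f a b.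
Proof.
move=> K0 lf e e0; exists (e / (K + 1)); first by rewrite divr_gt0// ltr_wpDl.
move=> s /allP als _ ls; apply: (@le_trans _ _ ((K + 1) * \sum_(x <- s) (x.2 - x.1))).
  rewrite mulr_sumr big_seq [leRHS]big_seq; apply: ler_sum => x /als /and3P[h1 h2 h3].
  by apply: le_trans (lf _ _ h1 h2 h3) _; rewrite ler_wpM2r ?subr_ge0// lerDl.
by rewrite mulrC -ler_pdivlMr ?ltr_wpDl// ltW.
Qed.

(** Pairing with constant covectors reduces integrals of vectors to integrals of real functions. *)
Definition curve_density (R : realType) (n : nat) (f h : R -> 'rV[R]_n) (a b : R) : Prop :=
  [/\ (forall P, lebesgue_measure.-integrable setT (EFin \o (fun t => pairing P (h t)))),
    (forall i, measurable_fun setT (fun t => h t 0 i)),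
    (forall P x y, a <= x -> x <= y -> y <= b ->
      pairing P (f y - f x) = \int[lebesgue_measure]_(t in `[x, y]) pairing P (h t)) &
    {ae lebesgue_measure, forall x, a < x < b ->
      is_derive x (1 : R^o) (f : R^o -> 'rV[R]_n) (h x)}].

Lemma is_derive_row (R : realType) (n : nat) (f : R -> 'rV[R]_n) (w : 'rV[R]_n) (x : R) :
  (forall i, is_derive x (1 : R^o) ((fun t => f t 0 i) : R^o -> R^o) (w 0 i)) ->
  is_derive x (1 : R^o) (f : R^o -> 'rV[R]_n) w.
Proof.
move=> hd; have df : derivable (f : R^o -> 'rV[R]_n) x 1.
  by apply/derivable_mxP => i j; rewrite ord1; have [] := hd j.
apply: DeriveDef => //; rewrite derive_mx//; apply/rowP => j; rewrite mxE.
by have [] := hd j.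
Qed.

Lemma near_itv_open (R : realType) (a b x : R) : a < x < b -> \forall y \near x, a < y < b.
Proof.
move=> axb; have : `]a, b[%classic x by rewrite /= in_itv.
move=> /(conj (@itv_open _ R a b)) /open_nbhs_nbhs.
by apply: filterS => y /=; rewrite in_itv.
Qed.

Lemma ac_on_density (R : realType) (n : nat) (f : R -> 'rV[R]_n) (a b : R) : a < b ->
  ac_on f a b -> exists h, curve_density f h a b.
Proof.
move=> ab acf.
have /choice[h hh] (i : 'I_n) : exists h, ftc_density ((fun t => f t 0 i) \o clamp a b) h a b.
  apply: abs_cont_ftc => // e e0; have [d d0 hd] := acf e e0; exists d => // s als ps ls.
  have [h1 h2 h3] := clamp_seq (ltW ab) als ps.
  apply: le_trans (hd [seq (clamp a b x.1, clamp a b x.2) | x <- s] _ h2 (le_lt_trans h3 ls)).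
    rewrite big_map; apply: ler_sum => x _ /=; rewrite -row_subE; exact: coord_le_norm.
  apply/allP => y ys; have /= := allP h1 _ ys; move: ys => /mapP[x _ ->] /= ->.
  by have /andP[-> _] := clamp_itv x.1 (ltW ab); have /andP[_ ->] := clamp_itv x.2 (ltW ab).
pose H t : 'rV[R]_n := \row_i h i t.
have PE (P : 'rV[R]_n) : (fun t => pairing P (H t)) = (fun t => \sum_i P 0 i * h i t).
  by apply/funext => t; rewrite pairingE; apply: eq_bigr => i _; rewrite mxE.
have ih i : lebesgue_measure.-integrable setT (EFin \o h i) by have [] := hh i.
have iPh (P : 'rV[R]_n) i : lebesgue_measure.-integrable setT (EFin \o (fun t => P 0 i * h i t)).
  exact: (integrableZl measurableT (P 0 i) (ih i)).
exists H; split.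
- move=> P; rewrite PE.
  have -> : EFin \o (fun t => \sum_i P 0 i * h i t) =
      (fun t => \sum_(i <- index_enum 'I_n) ((P ord0 i * h i t)%R)%:E)%E.
    by apply/funext => t /=; rewrite sumEFin.
  by apply: integrable_sum => // i _; exact: iPh.
- move=> i; have -> : (fun t => H t 0 i) = h i by apply/funext => t; rewrite mxE.
  by apply/measurable_EFinP; exact: measurable_int (ih i).
- move=> P x y ax xy yb; rewrite PE.
  have sub i : lebesgue_measure.-integrable `[x, y] (EFin \o (fun t => P 0 i * h i t)).
    by apply: integrableS (iPh P i).
  have -> : \int[lebesgue_measure]_(t in `[x, y]) (\sum_i P 0 i * h i t) =
      \sum_i \int[lebesgue_measure]_(t in `[x, y]) (P 0 i * h i t).
    rewrite /Rintegral.
    have -> : (fun t => (\sum_i P 0 i * h i t)%:E) =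
        (fun t => \sum_(i <- index_enum 'I_n) ((P ord0 i * h i t)%R)%:E)%E.
      by apply/funext => t /=; rewrite sumEFin.
    rewrite integral_sum// -EFin_sum_fine// => i _; exact: integrable_fin_num (sub i).
  rewrite pairingE; apply: eq_bigr => i _; rewrite row_subE.
  rewrite RintegralZl//; last by apply: integrableS (ih i).
  congr (_ * _); have [_ /(_ x y ax xy yb) <- _] := hh i.
  by rewrite /= !clamp_id// ?ax ?yb ?(le_trans ax xy) ?(le_trans xy yb).
- have : {ae lebesgue_measure, forall x, forall i, a < x < b ->
      is_derive x (1 : R^o) (((fun t => f t 0 i) \o clamp a b) : R^o -> R^o) (h i x)}.
    apply: (@filter_forall _ _ _ _ (ae_filter_ringOfSetsType _)) => i.
    by have [_ _] := hh i.
  apply: (@filterS _ _ (ae_filter_ringOfSetsType _)) => x hx axb.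
  apply: is_derive_row => i; rewrite mxE; have := hx i axb.
  apply: near_eq_is_derive; have := near_itv_open axb; apply: filterS => y /andP[ay yb].
  by rewrite /= clamp_id// !ltW.
Qed.

(** * Length and Riemannian distance in a chart *)

(** Serves to make local constants uniform. The parameter is followed along the filter [+oo], to
    which the near-covering form of compactness applies. *)
Lemma compact_eventually (R : realType) (T : topologicalType) (K : set T) (P : R -> T -> Prop) :
  compact K ->
  (forall x, K x -> exists B, \forall y \near x, forall b, B <= b -> K y -> P b y) ->
  exists B, forall b x, B <= b -> K x -> P b x.
Proof.
move=> /compact_near_coveringP cK h.
have [|B [_ hB]] := cK R +oo (fun b x => forall b', b <= b' -> K x -> P b' x) _.
  move=> x Kx; have [B hB] := h x Kx.
  exists ([set y | forall b, B <= b -> K y -> P b y], [set b | B <= b]) => /=.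
    by split => //; apply: nbhs_pinfty_ge; exact: num_real.
  by move=> [y b] [/= hy Bb] b' bb' Ky; apply: hy => //; exact: le_trans bb'.
(* A neighbourhood of [+oo] contains the numbers strictly above [B], hence [B + 1]. *)
exists (B + 1) => b x Bb Kx; apply: (hB (B + 1)) => //; by rewrite ltrDl.
Qed.

Lemma continuous_near_eq (T U : topologicalType) (f h : T -> U) (x : T) :
  (\forall y \near x, f y = h y) -> {for x, continuous h} -> {for x, continuous f}.
Proof.
move=> fh ch A; rewrite (nbhs_singleton fh) => /ch hA.
apply: (@filterS2 _ (nbhs x) (nbhs_filter x) _ _ _ _ fh hA) => y fhy; by rewrite /= fhy.
Qed.

Definition qform (R : realType) (n : nat) (A : 'M[R]_n) (w : 'rV[R]_n) : R :=
  (w *m A *m w^T) 0 0.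

Lemma qformE (R : realType) (n : nat) (A : 'M[R]_n) (w : 'rV[R]_n) :
  qform A w = \sum_i \sum_j w 0 i * w 0 j * A i j.
Proof.
rewrite /qform mxE exchange_big; apply: eq_bigr => j _; rewrite !mxE mulr_suml.
by apply: eq_bigr => i _; rewrite mulrAC.
Qed.

Lemma qformZ (R : realType) (n : nat) (A : 'M[R]_n) (w : 'rV[R]_n) a :
  qform A (a *: w) = a ^+ 2 * qform A w.
Proof. by rewrite /qform linearZ /= -scalemxAl -scalemxAl -scalemxAr scalerA !mxE expr2. Qed.

Lemma qform_bounds (R : realType) (n : nat) (K : set 'rV[R]_n) (A : 'rV[R]_n -> 'M[R]_n) :
  compact K -> (forall q i j, K q -> {for q, continuous (fun q => A q i j)}) ->
  (forall q w, K q -> w != 0 -> 0 < qform (A q) w) ->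
  exists m B : R, [/\ 0 < m, 0 <= B & forall q w, K q ->
    m * `|w| <= Num.sqrt (qform (A q) w) <= B * `|w|].
Proof.
move=> cK cA A0.
have cKS := compact_setX cK (@sphere_compact R n).
pose F (x : 'rV[R]_n * 'rV[R]_n) : R := \sum_i \sum_j x.2 0 i * x.2 0 j * A x.1 i j.
have cF x : (K `*` [set w : 'rV[R]_n | `|w| = 1]) x -> {for x, continuous F}.
  move=> [/= Kx _]; apply: continuous_at_sum => i; apply: continuous_at_sum => j.
  apply: cvgM; first apply: cvgM.
  + by apply: (@continuous_at_snd _ _ _ (fun w : 'rV[R]_n => w 0 i)); exact: coord_continuous.
  + by apply: (@continuous_at_snd _ _ _ (fun w : 'rV[R]_n => w 0 j)); exact: coord_continuous.
  + by apply: (@continuous_at_fst _ _ _ (fun q => A q i j)); exact: cA.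
have FE x : F x = qform (A x.1) x.2 by rewrite qformE.
have [x [/= Kx x1]|m m0 hm] := compact_ge_pos cKS cF.
  by rewrite FE; apply: A0 => //; rewrite -normr_gt0 x1.
have [B B0 hB] := compact_norm_le cKS cF.
exists (Num.sqrt m), (Num.sqrt B); split; rewrite ?sqrtr_gt0 ?sqrtr_ge0// => q w Kq.
have [->|w0] := eqVneq w 0.
  by rewrite normr0 !mulr0 /qform !mul0mx mxE sqrtr0 lexx.
have nw : 0 < `|w| by rewrite normr_gt0.
pose u := `|w|^-1 *: w.
have u1 : (K `*` [set w : 'rV[R]_n | `|w| = 1]) (q, u).
  by split => //=; rewrite normrZ normfV normr_id mulVf// gt_eqF.
have -> : w = `|w| *: u by rewrite scalerA mulfV ?gt_eqF// scale1r.
rewrite qformZ normrZ normr_id (u1.2 : `|u| = 1) mulr1 sqrtrM ?sqr_ge0// sqrtr_sqr normr_id.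
have := hm _ u1; have := hB _ u1; rewrite FE /= => h1 h2.
rewrite ![_ * `|w|]mulrC !ler_pM2l// !ler_wsqrtr//.
by apply: le_trans h1; exact: ler_norm.
Qed.

Section metric.
Variables (R : realType) (n : nat) (M : manifold R n) (g : riemannian_metric M).
Implicit Types (c : chart R n M) (gamma : R -> M).

Lemma smooth_chart_at x : smooth_chart (chart_at x : chart R n M).
Proof. move=> y; exact: chart_at_compatible. Qed.

Lemma velocity_in c gamma s (w : 'rV[R]_n) : smooth_chart c -> {for s, continuous gamma} ->
  cdom c (gamma s) -> is_derive s (1 : R^o) (cmap c \o gamma : R^o -> 'rV[R]_n) w ->
  velocity gamma s = w *m trans c (chart_at (gamma s)) (gamma s).
Proof.
move=> sc cg cs dw; have [sc1 _] := sc (gamma s).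
by have [_ <-] := curve_change_of_chart sc1 cg cs (chart_at_dom _) dw.
Qed.

Lemma tnorm_in c x (w : 'rV[R]_n) : cdom c x ->
  tnorm g x (w *m trans c (chart_at x) x) = Num.sqrt (qform (gram_in g c (cmap c x)) w).
Proof. by move=> cx; rewrite /tnorm /gram_in cmapK// /qform trmx_mul !mulmxA. Qed.

Lemma gram_in_pos c x (w : 'rV[R]_n) : smooth_chart c -> cdom c x -> w != 0 ->
  0 < qform (gram_in g c (cmap c x)) w.
Proof.
move=> sc cx w0.
have -> : qform (gram_in g c (cmap c x)) w =
    qform (g x) (w *m trans c (chart_at x) x).
  by rewrite /gram_in cmapK// /qform trmx_mul !mulmxA.
apply: gram_pos; apply: contra_neq w0 => h.
by rewrite -(mulmx1 w) -(transK (sc x) cx (chart_at_dom x)) mulmxA h mul0mx.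
Qed.

Lemma gram_bounds z rho : (forall q, `|q - cmap (chart_at z) z| <= rho -> cimg (chart_at z) q) ->
  exists m B : R, [/\ 0 < m, 0 <= B & forall q (w : 'rV[R]_n), `|q - cmap (chart_at z) z| <= rho ->
    m * `|w| <= Num.sqrt (qform (gram_in g (chart_at z) q) w) <= B * `|w|].
Proof.
move=> hz; apply: (qform_bounds (@closed_ball_compact R n (cmap (chart_at z) z) rho)) => [q i j /hz|q w /hz [x cx <-]].
  by have := gram_smooth g 0 z i j; apply.
exact: gram_in_pos (smooth_chart_at z) cx.
Qed.

Lemma C1_curve_derivable t gamma s c : C1_curve t gamma -> 0 <= s <= t -> smooth_chart c ->
  cdom c (gamma s) -> derivable (cmap c \o gamma : R^o -> 'rV[R]_n) s 1.
Proof.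
move=> C1 st sc cs; have [cg /nbhs_singleton dg _] := C1 s st.
have [_ sc1] := sc (gamma s).
by have [] := curve_change_of_chart sc1 cg (chart_at_dom _) cs (DeriveDef dg (erefl _)).
Qed.

Lemma speed_in c gamma s : smooth_chart c -> {for s, continuous gamma} -> cdom c (gamma s) ->
  derivable (cmap c \o gamma : R^o -> 'rV[R]_n) s 1 ->
  tnorm g (gamma s) (velocity gamma s) =
  Num.sqrt (qform (gram_in g c (cmap c (gamma s))) ('D_1 (cmap c \o gamma : R^o -> 'rV[R]_n) s)).
Proof.
by move=> sc cg cs dg; rewrite (velocity_in sc cg cs (DeriveDef dg (erefl _))) tnorm_in.
Qed.

Lemma chart_ball z : exists2 rho : R, 0 < rho &
  forall q, `|q - cmap (chart_at z) z| <= rho -> cimg (chart_at z : chart R n M) q.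
Proof.
have oI := @cimg_open _ _ _ (chart_at z : chart R n M).
have Iz := cimg_cmap (chart_at_dom z : cdom (chart_at z : chart R n M) z).
have /nbhs_normP[r /= r0 hr] := open_nbhs_nbhs (conj oI Iz).
exists (r / 2) => [|q qr]; first by rewrite divr_gt0.
by apply: hr; rewrite /= distrC; apply: le_lt_trans qr _; lra.
Qed.

Lemma near_chart_ball c x (r : R) : 0 < r -> cdom c x ->
  \forall y \near x, cdom c y /\ `|cmap c y - cmap c x| < r.
Proof.
move=> r0 cx; apply: filterI; first exact: near_cdom.
have : \forall q \near cmap c x, `|q - cmap c x| < r.
  by apply/nbhs_normP; exists r => //= q; rewrite distrC.
exact: cmap_continuous.
Qed.

Lemma speed_bounded t gamma : C1_curve t gamma ->
  exists2 B : R, 0 <= B & forall s, 0 <= s <= t -> tnorm g (gamma s) (velocity gamma s) <= B.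
Proof.
move=> C1; have [|B hB] := @compact_eventually R R `[0, t]%classic
   (fun b s => tnorm g (gamma s) (velocity gamma s) <= b) (@segment_compact R 0 t).
  move=> s; rewrite /= in_itv /= => st; have [cg dg cD] := C1 s st.
  pose c := chart_at (gamma s).
  have [rho rho0 hrho] := chart_ball (gamma s).
  have [m [B [m0 B0 hB]]] := gram_bounds hrho.
  exists (B * (`|'D_1 (cmap c \o gamma : R^o -> 'rV[R]_n) s| + 1)).
  have near1 : \forall u \near s, cdom c (gamma u) /\ `|cmap c (gamma u) - cmap c (gamma s)| < rho.
    by have nb := near_chart_ball rho0 (chart_at_dom (gamma s)); exact: (cg _ nb).
  have near2 := @cvgr_norm_le _ _ _ _ _ _ _ cD (`|'D_1 (cmap c \o gamma : R^o -> 'rV[R]_n) s| + 1).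
  have {}near2 := near2 (nbhs_filter s) (ltr_pwDr ltr01 (lexx _)).
  apply: (@filterS3 _ (nbhs s) (nbhs_filter s) _ _ _ _ _ dg near1 near2) => u du [cu ru] Du b hb.
  rewrite in_itv /= => ut; apply: le_trans hb; have [cgu _ _] := C1 u ut.
  rewrite (speed_in (smooth_chart_at _) cgu cu du).
  have /andP[_ h] := hB _ ('D_1 (cmap c \o gamma : R^o -> 'rV[R]_n) u) (ltW ru).
  by apply: le_trans h _; rewrite ler_wpM2l.
exists (Num.max 0 B); first by rewrite le_max lexx.
move=> s st; apply: hB; first by rewrite le_max lexx orbT.
by rewrite /= in_itv.
Qed.

Definition segment_curve c (a b : 'rV[R]_n) (s : R) : M := cinv c (a + s *: (b - a)).

Lemma line_continuous (a v : 'rV[R]_n) : continuous (fun s : R => a + s *: v).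
Proof.
by move=> s; apply: cvgD; [exact: cvg_cst | apply: cvgZr_tmp; exact: cvg_id].
Qed.

Lemma segment_curve_derive c c' (a b : 'rV[R]_n) (s : R) : smooth_transition c c' ->
  cimg c (a + s *: (b - a)) -> cdom c' (segment_curve c a b s) ->
  is_derive s (1 : R^o) (cmap c' \o segment_curve c a b : R^o -> 'rV[R]_n)
    ('D_(b - a) (cmap c' \o cinv c) (a + s *: (b - a))).
Proof.
move=> cc' Is ds; apply: (is_derive_line (F := cmap c' \o cinv c)).
have [d1 d2] := cinvP Is.
by have := transition_differentiable cc' d1 ds; rewrite d2 => h; exact: diff_derivable.
Qed.

Lemma segment_curve_continuous c (a b : 'rV[R]_n) (s : R) :
  cimg c (a + s *: (b - a)) -> {for s, continuous (segment_curve c a b)}.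
Proof.
move=> Is; apply: (@continuous_comp _ _ _ (fun s : R => a + s *: (b - a)) (cinv c)).
  exact: line_continuous.
exact: cinv_continuous.
Qed.

Lemma segment_curve_C1 c (a b : 'rV[R]_n) t : smooth_chart c ->
  (forall s, 0 <= s <= t -> cimg c (a + s *: (b - a))) -> C1_curve t (segment_curve c a b).
Proof.
move=> sc Is s st; set c' := chart_at (segment_curve c a b s); move=> f.
have cs := segment_curve_continuous (Is s st).
have [cc' _] := sc (segment_curve c a b s).
have near1 : \forall u \near s, cimg c (a + u *: (b - a)) /\ cdom c' (segment_curve c a b u).
  apply: filterI.
    have nI : nbhs (a + s *: (b - a)) (cimg c).
      by apply: open_nbhs_nbhs; split; [exact: cimg_open | exact: Is].
    exact: (@line_continuous a (b - a) s _ nI).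
  have nb := near_cdom (chart_at_dom (segment_curve c a b s)); exact: (cs _ nb).
split => //.
  move: near1; apply: filterS => u [Iu du].
  by have [] := segment_curve_derive cc' Iu du.
have E : \forall u \near s, 'D_1 f u = 'D_(b - a) (cmap c' \o cinv c) (a + u *: (b - a)).
  move: near1; apply: filterS => u [Iu du].
  by have [] := segment_curve_derive cc' Iu du.
have [_ /(_ (b - a)) /= ck] := cc' 1%N.
have ckl : {for (a + s *: (b - a)), continuous ('D_(b - a) (cmap c' \o cinv c))}.
  apply: ck; have [Iu du] := nbhs_singleton near1; have [d1 d2] := cinvP Iu.
  by exists (segment_curve c a b s).
have cD := @continuous_comp _ _ _ (fun s : R => a + s *: (b - a)) _ s (@line_continuous a (b - a) s) ckl.
exact: continuous_near_eq E cD.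
Qed.

Definition curve_length gamma : R :=
  \int[lebesgue_measure]_(s in `[0, 1]) tnorm g (gamma s) (velocity gamma s).

Lemma tnorm_ge0 x (v : 'rV[R]_n) : 0 <= tnorm g x v.
Proof. exact: sqrtr_ge0. Qed.

Lemma curve_length_ge0 gamma : 0 <= curve_length gamma.
Proof. by apply: Rintegral_ge0 => s _; exact: tnorm_ge0. Qed.

Lemma integral_unit_cst (B : R) : (\int[@lebesgue_measure R]_(s in `[0%R, 1%R]) B%:E = B%:E)%E.
Proof.
by rewrite (integral_cst _ _ B%:E)//= lebesgue_measure_itv /= lte_fin ltr01 oppr0 adde0 mule1.
Qed.

(** [curve_length] is the real part of an extended integral, hence carries information only once
    that integral is finite. A bound on the speed gives this without measurability. *)
Lemma curve_lengthE gamma (B : R) : (forall s, 0 <= s <= 1 -> tnorm g (gamma s) (velocity gamma s) <= B) ->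
  (\int[lebesgue_measure]_(s in `[0%R, 1%R]) (tnorm g (gamma s) (velocity gamma s))%:E =
     (curve_length gamma)%:E)%E /\ curve_length gamma <= B.
Proof.
move=> hB; rewrite /curve_length /Rintegral.
set I := (\int[_]_(_ in _) _)%E.
have I0 : (0 <= I)%E by apply: integral_ge0 => s _; rewrite lee_fin tnorm_ge0.
have IB : (I <= B%:E)%E.
  rewrite -(integral_unit_cst B); apply: ge0_le_integral_ae.
  - by move=> s _; rewrite lee_fin tnorm_ge0.
  - move=> s; rewrite /= in_itv /= => /hB h; rewrite lee_fin; exact: le_trans (tnorm_ge0 _ _) h.
  - by apply: aeW => s; rewrite /= in_itv /= => /hB; rewrite lee_fin.
have fI : I \is a fin_num by rewrite ge0_fin_numE//; apply: le_lt_trans IB _; exact: ltry.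
by rewrite fineK//; split => //; rewrite -lee_fin fineK.
Qed.

Lemma rdist_le gamma : C1_curve 1 gamma -> rdist g (gamma 0) (gamma 1) <= curve_length gamma.
Proof.
move=> C1; apply: ge_inf; last by exists gamma.
by exists 0 => _ [gamma' _ <-]; exact: curve_length_ge0.
Qed.

Lemma rdist_ge0 x y : 0 <= rdist g x y.
Proof.
have [E0|/set0P ne] := eqVneq [set gamma : R -> M | [/\ C1_curve 1 gamma, gamma 0 = x & gamma 1 = y]] set0.
  by rewrite /rdist E0 image_set0 inf0.
apply: lb_le_inf; first by have [gamma h] := ne; exists (curve_length gamma), gamma.
by move=> _ [gamma _ <-]; exact: curve_length_ge0.
Qed.

(* [gamma] is Lipschitz in the chart, hence the integral of its derivative; this
   avoids the continuity of the derivative in a single chart. *)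
Lemma curve_displacement c gamma (s0 kappa : R) : C1_curve 1 gamma -> smooth_chart c ->
  0 < kappa -> 0 <= s0 <= 1 ->
  (forall s, 0 <= s <= s0 -> cdom c (gamma s) /\ forall w : 'rV[R]_n,
     kappa * `|w| <= Num.sqrt (qform (gram_in g c (cmap c (gamma s))) w)) ->
  kappa / n.+1%:R * `|cmap c (gamma s0) - cmap c (gamma 0)| <= curve_length gamma.
Proof.
move=> C1 sc k0 /andP[s00 s01] hs.
have [B B0 hB] := speed_bounded C1.
have [LE _] := curve_lengthE hB.
move: s00; rewrite le_eqVlt => /orP[/eqP <-|s00].
  by rewrite subrr normr0 mulr0 curve_length_ge0.
pose f := cmap c \o gamma : R^o -> 'rV[R]_n.
have in01 s : 0 <= s <= s0 -> 0 <= s <= 1 by move=> /andP[-> /le_trans ->].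
have df s : 0 <= s <= s0 -> derivable f s 1.
  by move=> ss; have [cs _] := hs s ss; apply: C1_curve_derivable C1 (in01 s ss) sc cs.
have spd s : 0 <= s <= s0 -> kappa * `|'D_1 f s| <= tnorm g (gamma s) (velocity gamma s).
  move=> ss; have [cs hw] := hs s ss; have [cg _ _] := C1 s (in01 s ss).
  by rewrite (speed_in sc cg cs (df s ss)).
have acf : ac_on f 0 s0.
  apply: (@lipschitz_ac_on _ _ _ _ _ (kappa^-1 * B)); first by rewrite mulr_ge0// invr_ge0 ltW.
  move=> x y x0 xy ys; apply: norm_le_coord => [|i].
    by rewrite mulr_ge0 ?subr_ge0// mulr_ge0// invr_ge0 ltW.
  move: xy; rewrite le_eqVlt => /orP[/eqP ->|xy]; first by rewrite !subrr mxE normr0 mulr0.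
  rewrite row_subE.
  have din s : x <= s <= y -> is_derive s (1 : R^o) ((fun u => f u 0 i) : R^o -> R^o) (('D_1 f s) 0 i).
    move=> /andP[xs sy]; have dfs := df s; rewrite (le_trans x0 xs) (le_trans sy ys) in dfs.
    have {}dfs := dfs isT; have /derivable_mxP di := dfs.
    by apply: DeriveDef => //; rewrite derive_mx// mxE.
  have [s||s /andP[xs sy] E] := @MVT R (fun u => f u 0 i) (fun s => ('D_1 f s) 0 i) x y xy.
  - by rewrite in_itv /= => /andP[xs sy]; apply: din; rewrite !ltW.
  - apply: continuous_in_subspaceT => s; rewrite inE /= in_itv /= => /din ds.
    by apply: differentiable_continuous; apply/derivable1_diffP; exact: ex_derive.
  rewrite E normrM (gtr0_norm (_ : 0 < y - x)) ?subr_gt0// ler_wpM2r ?subr_ge0 ?(ltW xy)//.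
  apply: le_trans (coord_le_norm _ _) _; rewrite ler_pdivlMl//.
  have ss : 0 <= s <= s0 by rewrite (le_trans x0 (ltW xs)) (le_trans (ltW sy) ys).
  by apply: le_trans (spd s ss) _; apply: hB; exact: in01.
have [h [ih _ hE hd]] := ac_on_density s00 acf.
have [P P1 PE] := norming_covector (f s0 - f 0).
(* The pairing is bounded with the factor [n]; its successor is used to divide, so that dimension
   [0] is included. *)
have n0 : 0 < n.+1%:R :> R by rewrite ltr0n.
rewrite -[`|_|]PE (hE _ _ _ (lexx _) (ltW s00) (lexx _)) -RintegralZl//; last first.
  by apply: integrableS (ih P).
set k := fun t => _ * pairing P (h t).
have ik : lebesgue_measure.-integrable setT (EFin \o k).
  exact: (integrableZl measurableT (kappa / n.+1%:R) (ih P)).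
have iks : lebesgue_measure.-integrable `[0, s0] (EFin \o k) by apply: integrableS ik.
rewrite -lee_fin /Rintegral fineK; last exact: integrable_fin_num iks.
rewrite -LE integral_mkcond [leRHS]integral_mkcond; apply: le_integral_ae.
have ae0 := @ae_neq R 0; have aes0 := @ae_neq R s0; move: hd ae0 aes0.
apply: (@filterS3 _ _ (ae_filter_ringOfSetsType _)) => s hds sn0 sns0 _.
rewrite /patch; case: ifPn => [|_]; last by case: ifPn => // _; rewrite lee_fin tnorm_ge0.
rewrite inE /= in_itv /= => /andP[h1 h2].
rewrite ifT; last by rewrite inE /= in_itv /= h1 (le_trans h2 s01).
rewrite lee_fin.
have ss : 0 <= s <= s0 by rewrite h1.
apply: le_trans (spd s ss); rewrite /k.
have -> : 'D_1 f s = h s.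
  have s0s : 0 < s < s0 by rewrite !lt_neqAle [0 == s]eq_sym sn0 sns0 h1 h2.
  by have [] := hds s0s.
rewrite -mulrA ler_wpM2l// ?(ltW k0)// ler_pdivrMl//.
apply: le_trans (pairing_le _ _) _; rewrite ler_wpM2r//.
apply: (@le_trans _ _ (n%:R * 1)); first by rewrite ler_wpM2l.
by rewrite mulr1 ler_nat.
Qed.

End metric.

Section local_metric.
Variables (R : realType) (n : nat) (M : manifold R n) (g : riemannian_metric M).
Variable (U : ball_atlas g).
Implicit Types (c : chart R n M) (gamma : R -> M).

(** As long as the curve stays in the ball, its displacement is at most [r' < r], the length divided
    by the metric constant. This margin lets the continuation argument reach time [1]. *)
Lemma length_exit c gamma (a : 'rV[R]_n) (r kappa : R) : C1_curve 1 gamma -> smooth_chart c ->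
  0 < kappa -> 0 < r ->
  (forall q : 'rV[R]_n, `|q - a| <= r -> cimg c q /\ forall w : 'rV[R]_n,
     kappa * `|w| <= Num.sqrt (qform (gram_in g c q) w)) ->
  gamma 0 = cinv c a -> curve_length g gamma < kappa / n.+1%:R * r ->
  cdom c (gamma 1) /\ `|cmap c (gamma 1) - a| < r.
Proof.
move=> C1 sc k0 r0 hq g0 lr.
have [Ia _] : cimg c a /\ forall w : 'rV[R]_n, kappa * `|w| <= Num.sqrt (qform (gram_in g c a) w).
  by apply: hq; rewrite subrr normr0 ltW.
have [da ea] := cinvP Ia.
have k'0 : 0 < kappa / n.+1%:R by rewrite divr_gt0// ltr0n.
pose r' := (kappa / n.+1%:R)^-1 * curve_length g gamma.
have r'0 : 0 <= r' by rewrite mulr_ge0 ?curve_length_ge0// invr_ge0 ltW.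
have r'r : r' < r by rewrite ltr_pdivrMl.
suff : forall s, 0 <= s <= 1 -> cdom c (gamma s) /\ `|cmap c (gamma s) - a| < r.
  by apply; rewrite ler01 lexx.
apply: real_induction => //.
- by rewrite g0 ea subrr normr0.
- move=> s /andP[s0 s1] [cs rs]; have [|cg _ _] := C1 s; first by rewrite s0 ltW.
  have rs' : 0 < r - `|cmap c (gamma s) - a| by rewrite subr_gt0.
  have /nbhs_normP[d /= d0 hd] := cg _ (near_chart_ball rs' cs).
  exists (d / 2); first by rewrite divr_gt0.
  move=> u su ud u1; have [|cu ru] := hd u.
    by rewrite /= distrC ger0_norm ?subr_ge0//; lra.
  split => //; rewrite -(subrK (cmap c (gamma s)) (cmap c (gamma u))) -addrA.
  apply: le_lt_trans (ler_normD _ _) _; lra.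
- move=> s /andP[s0 s1] hs.
  have disp u : 0 <= u < s -> `|cmap c (gamma u) - a| <= r'.
    move=> /andP[u0 us]; rewrite ler_pdivlMl//.
    have -> : a = cmap c (gamma 0) by rewrite g0.
    apply: curve_displacement => //; first by rewrite u0 (le_trans (ltW us)).
    move=> v /andP[v0 vu]; have [|cv rv] := hs v; first by rewrite v0 (le_lt_trans vu).
    by split => // w; apply: (hq _ (ltW rv)).2.
  (* The closed ball of radius [r'] has a compact, hence closed, image in the Hausdorff manifold, so
     the limit point [gamma s] cannot jump out of the chart. *)
  pose K := cinv c @` [set q | `|q - a| <= r'].
  have cK : compact K.
    apply: continuous_compact; last exact: closed_ball_compact.
    apply: continuous_in_subspaceT => q /set_mem /= qr; apply: cinv_continuous.
    by apply: (hq _ _).1; apply: le_trans qr (ltW _).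
  have clK := compact_closed (@carrier_hausdorff _ _ M) cK.
  suff [q qr qE] : K (gamma s).
    have [Iq _] := hq q (le_trans qr (ltW r'r)); have [dq eq_] := cinvP Iq.
    by rewrite -qE eq_; split => //; exact: le_lt_trans r'r.
  apply: contrapT => nK; have [|cg _ _] := C1 s; first by rewrite s1 ltW.
  have nbK : nbhs (gamma s) (~` K) by apply: open_nbhs_nbhs; split => //; exact: closed_openC.
  have /nbhs_normP[d /= d0 hd] := cg _ nbK.
  pose u := Num.max 0 (s - d / 2).
  have us : 0 <= u < s by rewrite le_max lexx gt_max s0 ltrBlDr ltrDl divr_gt0.
  have [|] := hd u.
    move: us => /andP[_ us]; rewrite /= ger0_norm ?subr_ge0 ?(ltW us)//.
    have : s - d / 2 <= u by rewrite le_max lexx orbT.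
    by lra.
  have [cu _] := hs u us.
  by exists (cmap c (gamma u)); [exact: disp | exact: cmapK].
Qed.

Lemma segment_velocity c (a b : 'rV[R]_n) (s : R) : cimg c (a + s *: (b - a)) ->
  is_derive s (1 : R^o) (cmap c \o segment_curve c a b : R^o -> 'rV[R]_n) (b - a).
Proof.
move=> Is.
have nI : \forall u \near s, cimg c (a + u *: (b - a)).
  have nI : nbhs (a + s *: (b - a)) (cimg c).
    by apply: open_nbhs_nbhs; split => //; exact: cimg_open.
  exact: (@line_continuous _ _ a (b - a) s _ nI).
have did : derivable (id : 'rV[R]_n -> 'rV[R]_n) (a + s *: (b - a)) (b - a) by exact: derivable_id.
have := is_derive_line did.
rewrite derive_id; apply: near_eq_is_derive.
by move: nI; apply: filterS => u Iu; have [_ h] := cinvP Iu; rewrite /= h.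
Qed.

Lemma enorm_ball_convex (q a b : 'rV[R]_n) (r s : R) : 0 < r -> 0 <= s <= 1 ->
  enorm (a - q) < r -> enorm (b - q) < r -> enorm (a + s *: (b - a) - q) < r.
Proof.
move=> r0 /andP[s0 s1].
have sq (v : 'rV[R]_n) : (enorm v < r) = (\sum_i v 0 i ^+ 2 < r ^+ 2).
  have ge0 : 0 <= \sum_i v 0 i ^+ 2 by apply: sumr_ge0 => i _; exact: sqr_ge0.
  by rewrite /enorm -[in LHS](gtr0_norm r0) -sqrtr_sqr ltr_sqrt// exprn_gt0.
rewrite !sq => ha hb.
apply: (@le_lt_trans _ _ ((1 - s) * (\sum_i (a - q) 0 i ^+ 2) + s * (\sum_i (b - q) 0 i ^+ 2))).
  rewrite !mulr_sumr -big_split; apply: ler_sum => i _ /=; rewrite !mxE.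
  have : 0 <= s * (1 - s) * (a 0 i - b 0 i) ^+ 2 by apply: mulr_ge0; [rewrite mulr_ge0 ?subr_ge0 | exact: sqr_ge0].
  lra.
have [->|sn] := eqVneq s 0; first by rewrite subr0 mul1r mul0r addr0.
have s_gt0 : 0 < s by rewrite lt_neqAle eq_sym sn.
have h1 : (1 - s) * (\sum_i (a - q) 0 i ^+ 2) <= (1 - s) * r ^+ 2 by rewrite ler_wpM2l ?subr_ge0// ltW.
have h2 : s * (\sum_i (b - q) 0 i ^+ 2) < s * r ^+ 2 by rewrite ltr_pM2l.
lra.
Qed.

(* Without such a curve [rdist g x y] would be the infimum of the empty set,
   that is [0], and [achart_nearby] would provide a common chart. *)
Lemma C1_curve_exists (x y : M) : exists gamma, [/\ C1_curve 1 gamma, gamma 0 = x & gamma 1 = y].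
Proof.
apply: contrapT => nex.
have E0 : [set gamma : R -> M | [/\ C1_curve 1 gamma, gamma 0 = x & gamma 1 = y]] = set0.
  by apply/seteqP; split => // gamma h; apply: nex; exists gamma.
have [delta d0 hd] := achart_nearby U.
have [|i [xi yi]] := hd x y; first by rewrite /rdist E0 image_set0 inf0.
have [q [r [r0 Ei]]] := achart_ball i.
have Iq z : cdom (achart i) z -> enorm (cmap (achart i) z - q) < r.
  by move=> zi; have := cimg_cmap zi; rewrite Ei.
apply: nex; exists (segment_curve (achart i) (cmap (achart i) x) (cmap (achart i) y)); split.
- apply: segment_curve_C1; first exact: achart_smooth.
  by move=> s s01; rewrite Ei /=; apply: enorm_ball_convex => //; exact: Iq.
- by rewrite /segment_curve scale0r addr0 cmapK.
- by rewrite /segment_curve scale1r addrCA subrr addr0 cmapK.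
Qed.

Lemma rdist_lt_curve (x y : M) e : rdist g x y < e ->
  exists gamma, [/\ C1_curve 1 gamma, gamma 0 = x, gamma 1 = y & curve_length g gamma < e].
Proof.
have [gamma0 h0] := C1_curve_exists x y.
move=> /inf_lt[|_ [gamma [h1 h2 h3] <-] h4]; last by exists gamma.
by exists (curve_length g gamma0), gamma0.
Qed.

(** A curve too short to exit a coordinate ball ends inside it, which gives [kappa]; the length of a
    chart segment gives [D]. *)
Lemma chart_metric z rho : 0 < rho ->
  (forall q : 'rV[R]_n, `|q - cmap (chart_at z) z| <= rho -> cimg (chart_at z : chart R n M) q) ->
  exists kappa D : R, [/\ 0 < kappa, 0 < D,
    (forall (a : 'rV[R]_n) r y, 0 < r -> `|a - cmap (chart_at z) z| + r <= rho ->
       rdist g (cinv (chart_at z) a) y < kappa * r ->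
       cdom (chart_at z) y /\ `|cmap (chart_at z) y - a| < r) &
    (forall a b : 'rV[R]_n, `|a - cmap (chart_at z) z| < rho -> `|b - cmap (chart_at z) z| < rho ->
       rdist g (cinv (chart_at z) a) (cinv (chart_at z) b) <= D * `|b - a|)].
Proof.
move=> rho0 hrho; have [m [B [m0 B0 hB]]] := gram_bounds g hrho.
exists (m / n.+1%:R), (B + 1); split.
- by rewrite divr_gt0// ltr0n.
- by rewrite ltr_wpDl.
- move=> a r y r0 ar /rdist_lt_curve[gamma [C1 g0 <- lg]].
  apply: (length_exit C1 (smooth_chart_at z) m0 r0 _ g0 lg) => q qa.
  have qr : `|q - cmap (chart_at z) z| <= rho.
    rewrite -(subrK a q) -addrA; apply: le_trans (ler_normD _ _) _; lra.
  by split; [exact: hrho | move=> w; have /andP[] := hB q w qr].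
- move=> a b ra rb.
  have rs (s : R) : 0 <= s <= 1 -> `|a + s *: (b - a) - cmap (chart_at z) z| < rho.
    exact: ball_segment.
  have Is (s : R) : 0 <= s <= 1 -> cimg (chart_at z) (a + s *: (b - a)).
    by move=> /rs /ltW; exact: hrho.
  have C1 := segment_curve_C1 (smooth_chart_at z) Is.
  have := rdist_le g C1; rewrite {1 2}/segment_curve scale0r addr0 scale1r [a + (b - a)]addrCA subrr addr0.
  move=> h; apply: le_trans h _.
  have [|_ h] := @curve_lengthE _ _ _ g (segment_curve (chart_at z) a b) (B * `|b - a|).
    move=> s s01; have [ds es] := cinvP (Is s s01).
    have sv := segment_velocity (Is s s01).
    rewrite (speed_in g (smooth_chart_at z) (segment_curve_continuous (Is s s01)) ds); last by case: sv.
    have [_ ->] := sv.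
    have -> : cmap (chart_at z) (segment_curve (chart_at z) a b s) = a + s *: (b - a) by [].
    by have /andP[_] := hB _ (b - a) (ltW (rs s s01)).
  by apply: le_trans h _; rewrite ler_wpM2r// lerDl.
Qed.

End local_metric.

(** * The Hamiltonian and the Lagrangian in a chart *)

Lemma derive_slice (R : realType) (n : nat) (f : 'rV[R]_n * 'rV[R]_n -> R^o)
    (k : 'rV[R]_n -> R^o) (A : 'M[R]_n) (q : 'rV[R]_n) :
  (forall P, f (q, P) = k (P *m A)) ->
  forall P w, 'D_(0, w) f (q, P) = 'D_(w *m A) k (P *m A).
Proof.
move=> fk P w.
suff E : (fun h : R => h^-1 *: ((f \o shift (q, P)) (h *: (0, w)) - f (q, P))) =
    (fun h : R => h^-1 *: ((k \o shift (P *m A)) (h *: (w *m A)) - k (P *m A))).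
  by rewrite /derive E.
apply/funext => h /=.
have -> : h *: ((0, w) : 'rV[R]_n * 'rV[R]_n) + (q, P) = (q, h *: w + P).
  by rewrite -[LHS]/(_, _) /= scaler0 add0r.
by rewrite !fk mulmxDl scalemxAl.
Qed.

Lemma posdef_unitmx (R : realType) (n : nat) (A : 'M[R]_n) :
  (forall v : 'rV[R]_n, v != 0 -> 0 < qform A v) -> A \in unitmx.
Proof.
move=> pos; rewrite -row_free_unit; apply: inj_row_free => v vA.
apply: contrapT => /eqP /pos; by rewrite /qform vA mul0mx mxE ltxx.
Qed.

Lemma qform_sub (R : realType) (n : nat) (A : 'M[R]_n) (v u : 'rV[R]_n) (a : R) : A^T = A ->
  qform A (v - a *: u) = qform A v - 2 * a * pairing (v *m A) u + a ^+ 2 * qform A u.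
Proof.
move=> sA; have sym : pairing (u *m A) v = pairing (v *m A) u.
  rewrite /pairing -[in RHS]sA.
  have -> : (v *m A^T *m u^T) = (u *m A *m v^T)^T by rewrite !trmx_mul trmxK mulmxA.
  by rewrite [RHS]mxE.
have qE x : qform A x = pairing (x *m A) x by [].
by rewrite !qE mulmxBl -scalemxAl pairingBl !pairingBr !pairingZl !pairingZr sym; ring.
Qed.

Section hamiltonian.
Variables (R : realType) (n : nat) (M : manifold R n) (g : riemannian_metric M).
Variables (H : hamiltonian M) (H_tonelli : tonelli g H).
Variables (z : M) (rho : R).
Let c : chart R n M := chart_at z.
Let q0 := cmap c z.
Hypothesis rho0 : 0 < rho.
Hypothesis hrho : forall q : 'rV[R]_n, `|q - q0| <= rho -> cimg c q.

Lemma ham_in_convex (q P w : 'rV[R]_n) : cimg c q -> w != 0 ->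
  0 < 'D_(0, w) ('D_(0, w) (ham_in H c)) (q, P).
Proof.
move=> Iq w0; have [dx ex] := cinvP Iq; set x := cinv c q in dx ex.
pose A := (trans (chart_at x) c x)^T.
have e1 (P' : 'rV[R]_n) : ham_in H c (q, P') = (H x : 'rV[R]_n -> R^o) (P' *m A) by [].
have e2 := fun P' => derive_slice e1 P' w.
have -> := @derive_slice _ _ ('D_(0, w) (ham_in H c)) ('D_(w *m A) (H x)) A q e2 P w.
have [_ cvx _] := H_tonelli; apply: cvx.
apply: contra_neq w0 => wA.
have tK := transK (chart_at_compatible z x) dx (chart_at_dom x).
rewrite -(mulmx1 w) -trmx1 -tK trmx_mul mulmxA.
by move: wA; rewrite /A => ->; rewrite mul0mx.
Qed.

(** Cauchy-Schwarz for the Gram matrix between [w], the vector dual to the covector [p], and [ux], a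
    vector of bounded length whose pairing with [p] is [|P|]. *)
Lemma conorm_chart_ge : exists2 m : R, 0 < m & forall q P : 'rV[R]_n, `|q - q0| <= rho ->
  m * `|P| <= conorm g (cinv c q) (cov_of c (cinv c q) P).
Proof.
have [m [B [m0 B0 hB]]] := gram_bounds g hrho.
have B1 : 0 < B + 1 by lra.
exists (B + 1)^-1; first by rewrite invr_gt0.
move=> q P hq; have [dx ex] := cinvP (hrho hq); set x := cinv c q in dx ex *.
pose G := g x; pose p := cov_of c x P.
have Gpos (v : 'rV[R]_n) : v != 0 -> 0 < qform G v by exact: gram_pos.
have Gu : G \in unitmx by exact: posdef_unitmx.
have sG : G^T = G by exact: gram_sym.
pose w := p *m invmx G.
have wG : w *m G = p by rewrite mulmxKV.
have wE : qform G w = (p *m invmx G *m p^T) 0 0.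
  by rewrite /qform wG /w trmx_mul trmx_inv sG mulmxA.
have [u u1 uE] := norming_covector P.
pose ux := u *m trans c (chart_at x) x.
have pu : pairing p ux = `|P|.
  have tK := transK (chart_at_compatible z x) dx (chart_at_dom x).
  have -> : pairing p ux = pairing P u.
    rewrite /pairing /p /ux /cov_of trmx_mul mulmxA -(mulmxA P) -trmx_mul.
    by rewrite [X in X^T]tK trmx1 mulmx1.
  by rewrite -uE !pairingE; apply: eq_bigr => i _; rewrite mulrC.
have Qu : qform G ux <= (B + 1) ^+ 2.
  have -> : qform G ux = qform (gram_in g c q) u.
    by rewrite /gram_in -/x /qform /ux trmx_mul !mulmxA.
  have /andP[_ h] := hB q u hq.
  have h' : Num.sqrt (qform (gram_in g c q) u) <= B + 1.
    apply: le_trans h _; apply: (@le_trans _ _ (B * 1)); first by rewrite ler_wpM2l.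
    by lra.
  have [neg|pos] := ltP (qform (gram_in g c q) u) 0; first by apply: le_trans (ltW neg) (sqr_ge0 _).
  rewrite -(sqr_sqrtr pos) ler_sqr ?nnegrE ?sqrtr_ge0//; exact: ltW.
(* The coefficient is the minimiser of the expanded square once [qform G ux] is replaced by its
   bound [(B + 1) ^+ 2]. *)
have key : 0 <= qform G (w - (`|P| / (B + 1) ^+ 2) *: ux).
  have [->|/Gpos/ltW//] := eqVneq (w - (`|P| / (B + 1) ^+ 2) *: ux) 0.
  by rewrite /qform !mul0mx mxE.
rewrite qform_sub// wG pu in key.
have N0 : 0 <= qform G w.
  by have [->|/Gpos/ltW//] := eqVneq w 0; rewrite /qform !mul0mx mxE.
rewrite /conorm -/p -wE.
have -> : (B + 1)^-1 * `|P| = Num.sqrt ((`|P| / (B + 1)) ^+ 2).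
  rewrite sqrtr_sqr ger0_norm; last by rewrite divr_ge0// ltW.
  by rewrite mulrC.
rewrite ler_wsqrtr//.
have h2 : (`|P| / (B + 1) ^+ 2) ^+ 2 * qform G ux <= (`|P| / (B + 1)) ^+ 2.
  apply: (@le_trans _ _ ((`|P| / (B + 1) ^+ 2) ^+ 2 * (B + 1) ^+ 2)); first by rewrite ler_wpM2l ?sqr_ge0.
  by rewrite le_eqVlt; apply/orP; left; apply/eqP; field; rewrite gt_eqF.
have e2 : 2 * (`|P| / (B + 1) ^+ 2) * `|P| = 2 * (`|P| / (B + 1)) ^+ 2.
  by field; rewrite gt_eqF.
rewrite e2 in key; lra.
Qed.

Lemma ham_in_superlinear (K : R) : exists C : R, forall q P : 'rV[R]_n,
  `|q - q0| <= rho -> K * `|P| - C <= ham_in H c (q, P).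
Proof.
have [m m0 hm] := conorm_chart_ge.
have [C2H _ /(_ (`|K| / m))[r hr]] := H_tonelli.
pose A := `|r| / m.
have cK : compact ([set q : 'rV[R]_n | `|q - q0| <= rho] `*` [set P : 'rV[R]_n | `|P - 0| <= A]).
  by apply: compact_setX; exact: closed_ball_compact.
have [|B B0 hB] := @compact_norm_le _ R _ (ham_in H c) cK.
  move=> y [/= /hrho Iy _]; apply: differentiable_continuous.
  by have [h _] := C2H z; apply: h; split.
exists (`|K| * A + B) => q P hq.
have KP : K * `|P| <= `|K| * `|P| by rewrite ler_wpM2r// ler_norm.
have [small|big] := leP `|P| A.
  have := hB (q, P); rewrite ler_norml => /(_ _)/andP[|h _]; first by split => //=; rewrite subr0.
  have : `|K| * `|P| <= `|K| * A by rewrite ler_wpM2l.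
  lra.
have h1 := hm q P hq.
have : `|r| < m * `|P| by rewrite mulrC -ltr_pdivrMr.
move=> rP; have := hr (cinv c q) (cov_of c (cinv c q) P).
move=> /(_ (le_trans (ler_norm r) (le_trans (ltW rP) h1))) h2.
have h3 : `|K| / m * (m * `|P|) <= `|K| / m * conorm g (cinv c q) (cov_of c (cinv c q) P).
  by rewrite ler_wpM2l// divr_ge0// ltW.
have e3 : `|K| / m * (m * `|P|) = `|K| * `|P| by field; rewrite gt_eqF.
have : 0 <= `|K| * A by rewrite mulr_ge0// divr_ge0// ltW.
rewrite -[ham_in H c (q, P)]/(H (cinv c q) (cov_of c (cinv c q) P)); lra.
Qed.

Lemma ham_in_bounds : ham_bounds (fun q P => ham_in H c (q, P)) q0 rho.
Proof.
have [C2H _ _] := H_tonelli.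
apply: (@tonelli_ham_bounds _ _ _ (cimg c)) => //.
- exact: cimg_open.
- exact: C2H.
- by move=> q P w Iq w0; exact: ham_in_convex.
- exact: ham_in_superlinear.
Qed.

Lemma cov_ofK (q p : 'rV[R]_n) : cimg c q ->
  cov_of c (cinv c q) (cov_in c (cinv c q) p) = p.
Proof.
move=> /cinvP[dx _]; rewrite /cov_of /cov_in -mulmxA -trmx_mul.
by rewrite (transK (chart_at_compatible _ z) (chart_at_dom _) dx) trmx1 mulmx1.
Qed.

Lemma pairing_cov_in (q p w : 'rV[R]_n) :
  pairing p (w *m trans c (chart_at (cinv c q)) (cinv c q)) =
  pairing (cov_in c (cinv c q) p) w.
Proof. by rewrite /pairing /cov_in trmx_mul mulmxA. Qed.

(** [sup] is an upper bound only for sets that are bounded above; superlinearity with slope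
    [n%:R * |w|] provides this. *)
Lemma lagrangian_ge (q P w : 'rV[R]_n) : `|q - q0| <= rho ->
  pairing P w - ham_in H c (q, P) <=
  lagrangian H (cinv c q) (w *m trans c (chart_at (cinv c q)) (cinv c q)).
Proof.
move=> hq; have Iq := hrho hq; have [dx _] := cinvP Iq.
have [C hC] := ham_in_superlinear (n%:R * `|w|).
apply: ub_le_sup.
  exists C => _ [p _ <-]; rewrite pairing_cov_in -{2}(cov_ofK p Iq).
  have := hC q (cov_in c (cinv c q) p) hq.
  have := pairing_le (cov_in c (cinv c q) p) w.
  rewrite /ham_in /= mulrAC; lra.
exists (cov_of c (cinv c q) P) => //; rewrite pairing_cov_in; congr (pairing _ _ - _).
rewrite /cov_of /cov_in -mulmxA -trmx_mul.
by rewrite (transK (chart_at_compatible z _) dx (chart_at_dom _)) trmx1 mulmx1.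
Qed.

Lemma lagrangian_le (q w : 'rV[R]_n) (B : R) : `|q - q0| <= rho ->
  (forall P, pairing P w - ham_in H c (q, P) <= B) ->
  lagrangian H (cinv c q) (w *m trans c (chart_at (cinv c q)) (cinv c q)) <= B.
Proof.
move=> hq hB; apply: ge_sup; first by exists (pairing 0 (w *m trans c (chart_at (cinv c q)) (cinv c q)) - H (cinv c q) 0), 0.
move=> _ [p _ <-]; rewrite pairing_cov_in -{2}(cov_ofK p (hrho hq)).
exact: hB.
Qed.

End hamiltonian.

(** * Absolutely continuous curves on the manifold *)

Section ac_curves.
Variables (R : realType) (n : nat) (M : manifold R n) (g : riemannian_metric M).
Variable (U : ball_atlas g).
Hypothesis M_compact : compact [set: M].
Implicit Types (xi : R -> M).

(** One radius serves all [y] near [x]; this uniformity is what the compactness argument of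
    [rdist_to_nbhs] consumes. *)
Lemma rdist_from_nbhs (x : M) (N : set M) : nbhs x N ->
  exists2 e : R, 0 < e & \forall y \near x, forall y', rdist g y y' < e -> N y'.
Proof.
move=> xN; have [rho rho0 hrho] := chart_ball x.
pose c : chart R n M := chart_at x; have cx : cdom c x := chart_at_dom x.
have [kappa [D [k0 D0 near_ _]]] := chart_metric U rho0 hrho.
have /nbhs_normP[r0 /= r00 hr0] := near_cinv cx xN.
pose r := Num.min (r0 / 2) (rho / 2).
have r_gt0 : 0 < r by rewrite lt_min !divr_gt0.
have r1 : r <= r0 / 2 by rewrite ge_min lexx.
have r2 : r <= rho / 2 by rewrite ge_min lexx orbT.
exists (kappa * r); first by rewrite mulr_gt0.
have := near_chart_ball r_gt0 cx; apply: filterS => y [cy yr] y' hy'.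
have [||cy' y'r] := near_ (cmap c y) r y' r_gt0; first by rewrite -/c; lra.
  by rewrite cmapK.
have [] := hr0 (cmap c y'); last by rewrite cmapK.
rewrite /= distrC -(subrK (cmap c y) (cmap c y')) -addrA.
apply: le_lt_trans (ler_normD _ _) _; rewrite -/c in y'r; lra.
Qed.

(* The symmetry of [rdist] is not needed: compactness gives this half of it. *)
Lemma rdist_to_nbhs (x : M) (N : set M) : nbhs x N ->
  exists2 e : R, 0 < e & forall y, rdist g y x < e -> N y.
Proof.
move=> xN; have [|B hB] := @compact_eventually R M setT
    (fun b y => rdist g y x < (Num.max 1 b)^-1 -> N y) M_compact.
  move=> y _; have [->|yx] := eqVneq y x.
    by exists 0; move: xN; apply: filterS => y' Ny' b _ _ _.
  have yN : nbhs y (~` [set x]).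
    apply: open_nbhs_nbhs; split; last by apply/eqP.
    apply: closed_openC; apply: accessible_closed_set1.
    apply: hausdorff_accessible; exact: carrier_hausdorff.
  have [e e0 he] := rdist_from_nbhs yN.
  exists e^-1; move: he; apply: filterS => y' hy' b eb _ hd.
  exfalso; apply: (hy' x) => //; apply: lt_le_trans hd _.
  rewrite invf_ple ?posrE ?lt_max ?ltr01//.
  by rewrite le_max eb orbT.
exists (Num.max 1 B)^-1; first by rewrite invr_gt0 lt_max ltr01.
by move=> y hy; apply: (hB B y).
Qed.

Lemma ac_rdist t xi (e : R) : abs_continuous_curve g t xi -> 0 < e ->
  exists2 d : R, 0 < d & forall s s', 0 <= s -> s <= s' -> s' <= t -> s' - s < d ->
    rdist g (xi s) (xi s') < e.
Proof.
move=> acx e0; have [d d0 hd] := acx e e0; exists d => // s s' s0 ss' s't sd.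
have := hd 1%N (fun _ => s) (fun _ => s'); rewrite !big_ord1; apply => //.
by move=> j k; rewrite !ord1 eqxx.
Qed.

Lemma ac_continuous t xi s (N : set M) : abs_continuous_curve g t xi -> 0 <= s <= t ->
  nbhs (xi s) N ->
  exists2 d : R, 0 < d & forall u, 0 <= u <= t -> `|u - s| < d -> N (xi u).
Proof.
move=> acx /andP[s0 st] sN.
have [e1 e10 h1] := rdist_from_nbhs sN; have [e2 e20 h2] := rdist_to_nbhs sN.
have {}h1 := nbhs_singleton h1.
have [d1 d10 hd1] := ac_rdist acx e10; have [d2 d20 hd2] := ac_rdist acx e20.
exists (Num.min d1 d2); first by rewrite lt_min d10.
move=> u /andP[u0 ut]; rewrite lt_min => /andP[ud1 ud2].
(* Absolute continuity bounds the distance from the earlier to the later point, so the two sides of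
   [s] call for the two halves of the comparison. *)
have [su|us] := leP s u.
  by apply/h1/hd1 => //; rewrite -[X in X < _]ger0_norm ?subr_ge0.
apply/h2/hd2 => //; first exact: ltW.
by rewrite -[X in X < _]ger0_norm ?subr_ge0 ?ltW// distrC.
Qed.

Section in_chart.
Variables (z : M) (rho kappa : R).
Let c : chart R n M := chart_at z.
Let q0 := cmap c z.
Hypothesis rho0 : 0 < rho.
Hypothesis kappa0 : 0 < kappa.
Hypothesis hrho : forall q : 'rV[R]_n, `|q - q0| <= rho -> cimg c q.
Hypothesis chart_near : forall (a : 'rV[R]_n) r y, 0 < r -> `|a - q0| + r <= rho ->
  rdist g (cinv c a) y < kappa * r -> cdom c y /\ `|cmap c y - a| < r.

(** With radius [rho / 3], the ball around one point that reaches another still fits in the ball of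
    radius [rho]: [1 / 3 + 2 / 3 = 1]. *)
Definition in_ball (x : M) : Prop := cdom c x /\ `|cmap c x - q0| < rho / 3.

Lemma near_in_ball x : in_ball x -> nbhs x in_ball.
Proof.
move=> [cx rx]; have rx' : 0 < rho / 3 - `|cmap c x - q0| by rewrite subr_gt0.
have := near_chart_ball rx' cx; apply: filterS => y [cy ry]; split => //.
by rewrite -(subrK (cmap c x) (cmap c y)) -addrA; apply: le_lt_trans (ler_normD _ _) _; lra.
Qed.

(** Otherwise [chart_near] with radius the coordinate distance of [x] and [y] would make that
    distance smaller than itself. *)
Lemma chart_rdist_ge x y : in_ball x -> in_ball y ->
  kappa * `|cmap c y - cmap c x| <= rdist g x y.
Proof.
move=> [cx rx] [cy ry]; rewrite leNgt; apply/negP => h.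
have d0 : 0 < `|cmap c y - cmap c x|.
  rewrite lt_neqAle normr_ge0 andbT; apply/eqP => e0.
  by move: h; rewrite -e0 mulr0 ltNge rdist_ge0.
have [||_] := chart_near (a := cmap c x) (y := y) d0; last by rewrite ltxx.
  have : `|cmap c y - cmap c x| <= `|cmap c y - q0| + `|cmap c x - q0|.
    by rewrite -(subrK q0 (cmap c y)) -addrA [`|cmap c x - _|]distrC subrK; exact: ler_normD.
  lra.
by rewrite cmapK.
Qed.

Lemma ac_on_chart t xi a b : abs_continuous_curve g t xi -> 0 <= a -> b <= t ->
  (forall s, a <= s <= b -> in_ball (xi s)) -> ac_on (cmap c \o xi) a b.
Proof.
move=> acx a0 bt inb e e0; have ke : 0 < kappa * e by rewrite mulr_gt0.
have [d d0 hd] := acx _ ke; exists d => // s /allP als ps ls.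
pose A (k : 'I_(size s)) := (nth (0, 0) s k).1; pose B (k : 'I_(size s)) := (nth (0, 0) s k).2.
have AB k : [/\ a <= A k, A k <= B k & B k <= b].
  by have /and3P[] := als _ (mem_nth (0, 0) (ltn_ord k)).
have sumE (F : R * R -> R) : \sum_(x <- s) F x = \sum_(k < size s) F (nth (0, 0) s k).
  by rewrite (big_nth (0, 0)) big_mkord.
rewrite sumE -(ler_pM2l kappa0) mulr_sumr.
apply: (@le_trans _ _ (\sum_k rdist g (xi (A k)) (xi (B k)))); last first.
  apply/ltW/hd; last by rewrite -[X in X < d](sumE (fun x => x.2 - x.1)).
    by move=> k; have [h1 h2 h3] := AB k; split => //; [exact: le_trans h1 | exact: le_trans bt].
  move=> j k jk; have /(pairwiseP (0, 0)) pw := ps.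
  have : (j != k :> nat) by [].
  rewrite neq_ltn => /orP[jk'|kj].
    by have /orP[|] := pw j k (ltn_ord j) (ltn_ord k) jk'; [left | right].
  by have /orP[|] := pw k j (ltn_ord k) (ltn_ord j) kj; [right | left].
apply: ler_sum => k _; have [h1 h2 h3] := AB k; apply: chart_rdist_ge; apply: inb.
  by rewrite h1 (le_trans h2).
by rewrite h3 (le_trans h1).
Qed.

Lemma ac_continuous_at t xi s : abs_continuous_curve g t xi -> 0 < s < t -> {for s, continuous xi}.
Proof.
move=> acx /andP[s0 st] N xN; have [|d d0 hd] := ac_continuous acx _ xN; first by rewrite !ltW.
have s0t : \forall u \near s, 0 < u < t by apply: near_itv_open; rewrite s0.
have near2 : \forall u \near s, `|u - s| < d.
  by apply/nbhs_normP; exists d => //= u; rewrite distrC.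
apply: (@filterS2 _ (nbhs s) (nbhs_filter s) _ _ _ _ s0t near2) => u /andP[u0 ut]; apply: hd.
by rewrite !ltW.
Qed.

Lemma ac_velocity t xi a b : abs_continuous_curve g t xi -> 0 <= a -> a < b -> b <= t ->
  (forall s, a <= s <= b -> in_ball (xi s)) ->
  exists2 h : R -> 'rV[R]_n, curve_density (cmap c \o xi) h a b &
    {ae @lebesgue_measure R, forall s, a <= s <= b ->
      velocity xi s = h s *m trans c (chart_at (xi s)) (xi s)}.
Proof.
move=> acx a0 ab bt inb; have [h hh] := ac_on_density ab (ac_on_chart acx a0 bt inb).
exists h => //; have [_ _ _ hd] := hh; have na := @ae_neq R a; have nb := @ae_neq R b.
move: hd na nb; apply: (@filterS3 _ _ (ae_filter_ringOfSetsType _)) => s hs sa sb /andP[as_ sb'].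
have sab : a < s < b by rewrite !lt_neqAle [a == s]eq_sym sa as_ sb sb'.
have [cs _] : in_ball (xi s) by apply: inb; rewrite as_.
apply: (velocity_in (smooth_chart_at z) _ cs (hs sab)).
apply: (ac_continuous_at acx); move: sab => /andP[h1 h2].
by rewrite (le_lt_trans a0) ?(lt_le_trans h2).
Qed.

End in_chart.
End ac_curves.

(** An enumeration of the rational covectors; codes without a meaning give [0], which only repeats a
    term. *)
Definition rat_cov (R : realType) (n i : nat) : 'rV[R]_n :=
  if (unpickle i : option 'rV[rat]_n) is Some m then map_mx ratr m else 0.

Lemma rat_cov_dense (R : realType) (n : nat) (P : 'rV[R]_n) (e : R) : 0 < e ->
  exists i, `|rat_cov R n i - P| <= e.
Proof.
move=> e0; have /choice[f hf] (j : 'I_n) : exists q : rat, `|ratr q - P 0 j| <= e.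
  have [|q] := @rat_in_itvoo R (P 0 j - e) (P 0 j + e); first by lra.
  by rewrite in_itv /= => /andP[h1 h2]; exists q; rewrite ler_norml; apply/andP; split; lra.
exists (pickle (\row_j f j : 'rV[rat]_n)); rewrite /rat_cov pickleK.
by apply: norm_le_coord => [|j]; [exact: ltW | rewrite row_subE !mxE].
Qed.

Record good_chart (R : realType) (n : nat) (M : manifold R n) (g : riemannian_metric M)
    (z : M) (rho kappa D : R) : Prop := GoodChart {
  gc_rho : 0 < rho;
  gc_kappa : 0 < kappa;
  gc_D : 0 < D;
  gc_img : forall q : 'rV[R]_n, `|q - cmap (chart_at z) z| <= rho -> cimg (chart_at z) q;
  gc_near : forall (a : 'rV[R]_n) r y, 0 < r -> `|a - cmap (chart_at z) z| + r <= rho ->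
    rdist g (cinv (chart_at z) a) y < kappa * r ->
    cdom (chart_at z) y /\ `|cmap (chart_at z) y - a| < r;
  gc_far : forall a b : 'rV[R]_n, `|a - cmap (chart_at z) z| < rho -> `|b - cmap (chart_at z) z| < rho ->
    rdist g (cinv (chart_at z) a) (cinv (chart_at z) b) <= D * `|b - a|
}.

(** * Measurability and lower bound of the Lagrangian along curves *)

Section lagrangian_integral.
Variables (R : realType) (n : nat) (M : manifold R n) (g : riemannian_metric M).
Variable (U : ball_atlas g).
Hypothesis M_compact : compact [set: M].
Variables (H : hamiltonian M) (H_tonelli : tonelli g H).
Implicit Types (xi : R -> M).

Definition lag xi (s : R) : R := lagrangian H (xi s) (velocity xi s).

Lemma good_chart_exists z : exists rho kappa D, good_chart g z rho kappa D.
Proof.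
have [rho rho0 hrho] := chart_ball z; have [kappa [D [h1 h2 h3 h4]]] := chart_metric U rho0 hrho.
by exists rho, kappa, D; split.
Qed.

(* The Lagrangian is not known to be measurable along a curve; almost everywhere
   it is a supremum of measurable functions indexed by rational covectors. *)
Lemma lag_meas_chart z rho kappa D t xi a b : good_chart g z rho kappa D ->
  abs_continuous_curve g t xi -> 0 <= a -> a < b -> b <= t ->
  (forall s, a <= s <= b -> in_ball z rho (xi s)) -> ae_meas (lag xi) a b.
Proof.
move=> gc acx a0 ab bt inb; pose c : chart R n M := chart_at z.
have hrho := gc_img gc; have rho0 := gc_rho gc.
have [h hh hv] := ac_velocity U M_compact (gc_kappa gc) (gc_near gc) acx a0 ab bt inb.
have [ih mh _ _] := hh.
(* Clamping makes the coordinates continuous on the whole line and keeps them in the ball, so that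
   the functions [u i] are measurable and pointwise bounded above everywhere. *)
pose zeta s := cmap c (xi (clamp a b s)).
have zr s : `|zeta s - cmap c z| <= rho.
  have [_ h1] := inb (clamp a b s) (clamp_itv _ (ltW ab)).
  apply: le_trans (ltW h1) _; have := gc_rho gc; lra.
pose F := ham_in H c.
have cF (Q q : 'rV[R]_n) : `|q - cmap c z| <= rho -> {for q, continuous (fun q => F (q, Q))}.
  move=> /hrho Iq; apply: (@continuous_comp _ _ _ (fun q : 'rV[R]_n => (q, Q)) F).
    by apply: continuous_pair; [exact: cvg_id | exact: cst_continuous].
  have [C2 _ _] := H_tonelli; have [dF _] := C2 z.
  by apply: differentiable_continuous; apply: dF; split.
have cF2 (Q q : 'rV[R]_n) : `|q - cmap c z| <= rho -> {for Q, continuous (fun Q => F (q, Q))}.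
  move=> /hrho Iq; apply: (@continuous_comp _ _ _ (fun Q : 'rV[R]_n => (q, Q)) F).
    by apply: continuous_pair; [exact: cst_continuous | exact: cvg_id].
  have [C2 _ _] := H_tonelli; have [dF _] := C2 z.
  by apply: differentiable_continuous; apply: dF; split.
have czeta : continuous zeta.
  move=> s; apply/cvgrPdist_le => e e0.
  have [d d0 hd] := ac_on_chart (gc_kappa gc) (gc_near gc) acx a0 bt inb e0.
  apply/nbhs_normP; exists d => //= u us.
  wlog su : s u us / s <= u.
    move=> hw; have [su|us'] := leP s u; first exact: hw.
    by rewrite distrC; apply: hw; [rewrite /= distrC | exact: ltW].
  have := hd [:: (clamp a b s, clamp a b u)]; rewrite !big_seq1 /= andbT => hd'.
  rewrite distrC; apply: hd' => //.
    rewrite clamp_nd//.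
    by have /andP[-> _] := clamp_itv s (ltW ab); have /andP[_ ->] := clamp_itv u (ltW ab).
  apply: le_lt_trans (clamp_contract (ltW ab) su) _.
  by move: us; rewrite /ball_ /= distrC ger0_norm ?subr_ge0.
pose u i s := pairing (rat_cov R n i) (h s) - F (zeta s, rat_cov R n i).
have mu i : measurable_fun setT (u i).
  apply: measurable_funB.
    have -> : (fun s => pairing (rat_cov R n i) (h s)) = (fun s => \sum_j (rat_cov R n i) 0 j * h s 0 j).
      by apply/funext => s; rewrite pairingE.
    by apply: measurable_sum => j; apply: measurable_funM => //; exact: measurable_cst.
  apply: continuous_measurable_fun => s.
  apply: (@continuous_comp _ _ _ zeta (fun q => F (q, rat_cov R n i))); first exact: czeta.
  exact: cF.
have ub s : has_ubound (range (u ^~ s)).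
  have [C hC] := ham_in_superlinear H_tonelli hrho (n%:R * `|h s|).
  exists C => _ [i _ <-]; rewrite /u.
  have := hC _ (rat_cov R n i) (zr s); have := pairing_le (rat_cov R n i) (h s).
  by rewrite mulrAC -/F; lra.
exists (fun s => sup (range (u ^~ s))).
  have -> : (fun s => sup (range (u ^~ s))) = (fun s => sups (u ^~ s) 0).
    apply/funext => s; rewrite /sups /sdrop; congr sup.
    by apply/seteqP; split => _ [i _ <-]; exists i.
  by apply: measurable_fun_sups => // s _; exact: ub.
move: hv; apply: (@filterS _ _ (ae_filter_ringOfSetsType _)) => s hv sab.
have [cs rs] := inb s sab.
have zE : zeta s = cmap c (xi s) by rewrite /zeta clamp_id.
have xE : xi s = cinv c (zeta s) by rewrite zE cmapK.
rewrite /lag (hv sab) xE; apply/eqP; rewrite eq_le; apply/andP; split.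
  (* Density of the rational covectors and continuity in [P] show that the countable supremum
     dominates the value at every [P]. *)
  apply: (lagrangian_le hrho) => // P; apply/ler_addgt0Pr => e e0.
  have cP : {for P, continuous (fun Q => pairing Q (h s) - F (zeta s, Q) : R)}.
    exact: (cvgB (@pairing_continuous R n (h s) P) (cF2 P (zeta s) (zr s))).
  have /cvgrPdist_le /(_ e e0) /nbhs_normP[d /= d0 hd] := cP.
  have [i hi] := rat_cov_dense P (divr_gt0 d0 (ltr0Sn R 1)).
  have : u i s <= sup (range (u ^~ s)) by apply: ub_le_sup; [exact: ub | exists i].
  have := hd (rat_cov R n i); rewrite /= distrC => hd'.
  have d2 : d / 2 < d by lra.
  have := hd' (le_lt_trans hi d2); rewrite ler_norml => /andP[_]; rewrite /u -/F; lra.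
apply: ge_sup; first by exists (u 0%N s), 0%N.
by move=> _ [i _ <-]; exact: (lagrangian_ge H_tonelli hrho).
Qed.

(** Near each time the curve stays in one chart; [ae_meas_cat] glues the pieces and [real_induction]
    reaches [t]. *)
Lemma lag_meas t xi : 0 <= t -> abs_continuous_curve g t xi -> ae_meas (lag xi) 0 t.
Proof.
move=> t0 acx.
have triv a : ae_meas (lag xi) a a.
  exists (cst (lag xi a)); first exact: measurable_cst.
  by apply: aeW => s; rewrite -eq_le => /eqP ->.
have loc s : 0 <= s <= t -> exists2 d, 0 < d & forall a b, 0 <= a -> a <= b -> b <= t ->
    (forall u, a <= u <= b -> `|u - s| < d) -> ae_meas (lag xi) a b.
  move=> st; have [rho [kappa [D gc]]] := good_chart_exists (xi s).
  have ib : in_ball (xi s) rho (xi s).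
    split; first exact: chart_at_dom.
    by rewrite subrr normr0 divr_gt0// (gc_rho gc).
  have [d d0 hd] := ac_continuous U M_compact acx st (near_in_ball ib).
  exists d => // a b a0; rewrite le_eqVlt => /orP[/eqP -> //|ab] bt hab.
  apply: (lag_meas_chart gc acx a0 ab bt) => u ub; apply: hd; last exact: hab.
  by move: ub => /andP[au ub]; rewrite (le_trans a0 au) (le_trans ub bt).
suff : forall s, 0 <= s <= t -> ae_meas (lag xi) 0 s by apply; rewrite t0 lexx.
apply: real_induction => //.
- move=> s /andP[s0 st] ms; have [|d d0 hd] := loc s; first by rewrite s0 ltW.
  exists (d / 2) => [|u su ud ut]; first by rewrite divr_gt0.
  apply: (ae_meas_cat ms); apply: hd => // v /andP[sv vu].
  rewrite ger0_norm ?subr_ge0//; lra.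
- move=> s /andP[s0 st] ms; have [|d d0 hd] := loc s; first by rewrite st ltW.
  pose u := Num.max 0 (s - d / 2).
  have us : 0 <= u < s by rewrite le_max lexx gt_max s0 ltrBlDr ltrDl divr_gt0.
  have su : s - d / 2 <= u by rewrite le_max lexx orbT.
  apply: (ae_meas_cat (ms u us)); move: us => /andP[u0 us]; apply: hd => //; first exact: ltW.
  by move=> v /andP[uv vs]; rewrite distrC ger0_norm ?subr_ge0//; lra.
Qed.

(** The zero covector bounds the Lagrangian below by [- H x 0], which is bounded in each chart and,
    by compactness, on [M]. *)
Lemma lagrangian_bounded_below : exists B : R, forall x v, B <= lagrangian H x v.
Proof.
have [|B hB] := @compact_eventually R M setT
    (fun b x => forall v, - b <= lagrangian H x v) M_compact; last first.
  by exists (- B) => x v; exact: hB.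
move=> z _; have [rho [kappa [D gc]]] := good_chart_exists z.
have [B B0 hB] := ham_bnd (ham_in_bounds H_tonelli (gc_rho gc) (gc_img gc)) 0.
exists B; have := near_chart_ball (gc_rho gc) (chart_at_dom z).
apply: filterS => y [cy ry] b Bb _ v.
have sz : compatible (chart_at z : chart R n M) (chart_at y) by exact: chart_at_compatible.
have sy : compatible (chart_at y : chart R n M) (chart_at z) by exact: chart_at_compatible.
pose w := v *m trans (chart_at y) (chart_at z) y.
have vE : v = w *m trans (chart_at z) (chart_at y) y.
  by rewrite /w -mulmxA (transK sy (chart_at_dom y) cy) mulmx1.
have yE : y = cinv (chart_at z) (cmap (chart_at z) y) by rewrite cmapK.
have := lagrangian_ge H_tonelli (gc_img gc) 0 w (ltW ry); rewrite -yE -vE pairing0l sub0r.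
have := hB (cmap (chart_at z) y) 0 ry; rewrite normr0 lexx => /(_ isT).
rewrite ler_norml => /andP[_]; lra.
Qed.

End lagrangian_integral.

Lemma Rintegral_split (R : realType) (k : R -> R) (a b c : R) :
  lebesgue_measure.-integrable setT (EFin \o k) -> a <= b -> b <= c ->
  \int[lebesgue_measure]_(s in `[a, c]) k s =
  \int[lebesgue_measure]_(s in `[a, b]) k s + \int[lebesgue_measure]_(s in `[b, c]) k s.
Proof.
move=> ik ab bc; have sub (D : set R) : measurable D -> lebesgue_measure.-integrable D (EFin \o k).
  by move=> mD; apply: integrableS ik.
have := @Rintegral_itvB _ k (BLeft a) (BRight c) b.
rewrite !bnd_simp => /(_ (sub _ (measurable_itv _)) ab bc).
rewrite Rintegral_itv_obnd_cbnd; last exact: sub.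
by move=> <-; rewrite addrC subrK.
Qed.

(** * Near minimisers of the action of a weak KAM solution *)

Section weak_kam_curves.
Variables (R : realType) (n : nat) (M : manifold R n) (g : riemannian_metric M).
Variable (U : ball_atlas g).
Hypothesis M_compact : compact [set: M].
Variables (H : hamiltonian M) (H_tonelli : tonelli g H).
Variables (phi : M -> R) (kam : weak_kam g H phi).
Implicit Types (xi : R -> M).

Lemma weak_kam_le t xi : 0 < t -> abs_continuous_curve g t xi ->
  ((phi (xi t))%:E <= (phi (xi 0))%:E + action H t xi)%E.
Proof.
move=> t0 acx; rewrite (kam (xi t) t0).
apply: (@le_trans _ _ ((phi (xi 0%R))%:E + min_action g H t (xi 0%R) (xi t))%E).
  by apply: ereal_inf_lbound; exists (xi 0).
by apply: leeD2l; apply: ereal_inf_lbound; exists xi.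
Qed.

Lemma abs_continuous_shift t xi a b : abs_continuous_curve g t xi -> 0 <= a -> b <= t ->
  abs_continuous_curve g (b - a) (fun s => xi (s + a)).
Proof.
move=> acx a0 bt e e0; have [d d0 hd] := acx e e0; exists d => // m A B hAB sep ls.
apply: (hd m (fun k => A k + a) (fun k => B k + a)).
- move=> k; have [h1 h2 h3] := hAB k; split; [exact: addr_ge0 | by rewrite lerD2r | lra].
- by move=> j k jk; rewrite !lerD2r; exact: sep.
- by under eq_bigr do rewrite opprD addrACA subrr addr0.
Qed.

Lemma velocity_shift xi a s : velocity (fun u => xi (u + a)) s = velocity xi (s + a).
Proof.
have E (f : M -> 'rV[R]_n) :
    (fun h : R => h^-1 *: (((f \o (fun u => xi (u + a))) \o shift s) (h *: (1 : R^o)) - f (xi (s + a)))) =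
    (fun h : R => h^-1 *: (((f \o xi) \o shift (s + a)) (h *: (1 : R^o)) - f (xi (s + a)))).
  by apply/funext => h /=; rewrite addrA.
by rewrite /velocity /derive E.
Qed.

Lemma action_dominated t xi k a b : abs_continuous_curve g t xi ->
  lebesgue_measure.-integrable setT (EFin \o k) -> ae_rep (lag H xi) k 0 t ->
  0 <= a -> a <= b -> b <= t ->
  phi (xi b) - phi (xi a) <= \int[lebesgue_measure]_(s in `[a, b]) k s.
Proof.
move=> acx ik hk a0; rewrite le_eqVlt => /orP[/eqP <- bt|ab bt].
  by rewrite set_itv1 Rintegral_set1 subrr.
have ba0 : 0 < b - a by rewrite subr_gt0.
have := weak_kam_le ba0 (abs_continuous_shift acx a0 bt); rewrite subrK add0r.
have -> : action H (b - a) (fun s => xi (s + a)) =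
    (\int[@lebesgue_measure R]_(s in `[a, b]) (k s)%:E)%E.
  have -> : action H (b - a) (fun s => xi (s + a)) =
      (\int[@lebesgue_measure R]_(s in `[0%R, (b - a)%R]) (lag H xi (s + a)%R)%:E)%E.
    by apply: eq_integral => s _; rewrite /lag velocity_shift.
  rewrite (@ae_rep_integral R (fun s => lag H xi (s + a)) (fun s => k (s + a))); last first.
    have := ae_shift a hk; apply: (@filterS _ _ (ae_filter_ringOfSetsType _)) => s h /andP[s0 sb].
    by apply: h; apply/andP; split; lra.
  by rewrite integral_shift// add0r subrK.
have iab : lebesgue_measure.-integrable `[a, b] (EFin \o k) by apply: integrableS ik.
have E : (\int[@lebesgue_measure R]_(s in `[a, b]) (k s)%:E =
    (\int[lebesgue_measure]_(s in `[a, b]) k s)%:E)%E.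
  by rewrite /Rintegral fineK//; exact: integrable_fin_num iab.
by rewrite E -EFinD lee_fin lerBlDl.
Qed.

Definition near_minimiser xi t e : Prop :=
  abs_continuous_curve g t xi /\ ((phi (xi 0))%:E + action H t xi <= (phi (xi t) + e)%:E)%E.

(** The deficit on a subinterval is at most the total deficit [e], because [action_dominated]
    excludes a gain on the two complementary pieces. The upper bound on the action and the lower
    bound on the Lagrangian provide the integrable representative [k]. *)
Lemma near_minimiser_action xi t e : 0 <= t -> near_minimiser xi t e ->
  exists k, [/\ lebesgue_measure.-integrable setT (EFin \o k), ae_rep (lag H xi) k 0 t &
   forall a b, 0 <= a -> a <= b -> b <= t ->
    \int[lebesgue_measure]_(s in `[a, b]) k s - e <= phi (xi b) - phi (xi a)].
Proof.
move=> t0 [acx hx].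
have fin : (action H t xi < +oo)%E.
  rewrite ltNge; apply/negP => h; move: hx; rewrite (eqP (_ : action H t xi == +oo%E)) -?leye_eq//.
have [B hB] := lagrangian_bounded_below U M_compact H_tonelli.
have [k ik hk] := ae_meas_integrable (lag_meas U M_compact H_tonelli t0 acx)
  (fun s _ => hB (xi s) (velocity xi s)) fin.
exists k; split => // a' b' a0 ab bt.
have ia (x y : R) : lebesgue_measure.-integrable `[x, y] (EFin \o k) by apply: integrableS ik.
have E : (action H t xi = (\int[lebesgue_measure]_(s in `[0%R, t]) k s)%:E)%E.
  rewrite /action (ae_rep_integral hk) /Rintegral fineK//; exact: integrable_fin_num (ia 0 t).
move: hx; rewrite E -EFinD lee_fin.
rewrite (Rintegral_split ik a0 (le_trans ab bt)) (Rintegral_split ik ab bt).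
have := action_dominated acx ik hk (lexx 0) a0 (le_trans ab bt).
have := action_dominated acx ik hk (le_trans a0 ab) bt (lexx t).
lra.
Qed.

(** The Fenchel inequality with a constant covector, integrated: almost everywhere the Lagrangian is
    at least [<P, h s> - B], and the integral of [<P, h s>] is the pairing of [P] with the
    displacement. *)
Lemma near_minimiser_chart z rho kappa D xi t e : good_chart g z rho kappa D -> 0 <= t -> 0 <= e ->
  near_minimiser xi t e -> forall (a b B : R) (P : 'rV[R]_n), 0 <= a -> a <= b -> b <= t ->
  (forall s, a <= s <= b -> in_ball z rho (xi s)) ->
  (forall s, a <= s <= b -> ham_in H (chart_at z) (cmap (chart_at z) (xi s), P) <= B) ->
  pairing P (cmap (chart_at z) (xi b) - cmap (chart_at z) (xi a)) - B * (b - a) - e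
    <= phi (xi b) - phi (xi a).
Proof.
move=> gc t0 e0 nm a b B P a0 + bt inb hB; rewrite le_eqVlt => /orP[/eqP <-|ab].
  by rewrite !subrr pairing0r mulr0 !sub0r; lra.
have [k [ik hk hle]] := near_minimiser_action t0 nm.
have [acx _] := nm.
apply: le_trans (hle a b a0 (ltW ab) bt); rewrite lerD2r.
have [h hh hv] := ac_velocity U M_compact (gc_kappa gc) (gc_near gc) acx a0 ab bt inb.
have [ih _ hE _] := hh.
have := hE P a b (lexx _) (ltW ab) (lexx _); rewrite -![(_ \o xi) _]/(cmap (chart_at z) (xi _)) => ->.
have iP : lebesgue_measure.-integrable `[a, b] (EFin \o (fun s => pairing P (h s))) by apply: integrableS (ih P).
have iB : lebesgue_measure.-integrable `[a, b] (EFin \o (fun _ : R => B)).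
  apply: continuous_compact_integrable; first exact: segment_compact.
  by apply: continuous_subspaceT => s; exact: cst_continuous.
have ik' : lebesgue_measure.-integrable `[a, b] (EFin \o k) by apply: integrableS ik.
have -> : B * (b - a) = \int[lebesgue_measure]_(s in `[a, b]) B.
  by rewrite Rintegral_cst//= lebesgue_measure_itv /= lte_fin ab.
have iPB : lebesgue_measure.-integrable `[a, b] (EFin \o (fun s => pairing P (h s) - B)).
  have -> : EFin \o (fun s => pairing P (h s) - B) =
     ((EFin \o (fun s => pairing P (h s))) \- (EFin \o (fun _ => B)))%E by [].
  by apply: integrableB.
rewrite -RintegralB// -lee_fin /Rintegral !fineK; [|exact: integrable_fin_num ik'|]; last first.
  exact: integrable_fin_num iPB.
apply: le_integral_ae; move: hv hk; apply: (@filterS2 _ _ (ae_filter_ringOfSetsType _)) => s hv hk.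
rewrite /= in_itv /= => sab; rewrite lee_fin -hk; last first.
  by move: sab => /andP[as_ sb]; rewrite (le_trans a0 as_) (le_trans sb bt).
have [cs rs] := inb s sab.
have xE : xi s = cinv (chart_at z) (cmap (chart_at z) (xi s)) by rewrite cmapK.
have rs' : `|cmap (chart_at z) (xi s) - cmap (chart_at z) z| <= rho.
  by apply: le_trans (ltW rs) _; have := gc_rho gc; lra.
have := lagrangian_ge H_tonelli (gc_img gc) P (h s) rs'; rewrite -xE -(hv sab) => h1.
by apply: le_trans h1; rewrite lerD2l lerN2; exact: hB.
Qed.

Lemma near_minimiser_end t x e : 0 < t -> 0 < e ->
  exists2 xi, near_minimiser xi t e & xi t = x.
Proof.
move=> t0 e0; have h : (ereal_inf [set ((phi y)%:E + min_action g H t y x)%E | y in [set: M]] <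
    (phi x + e)%:E)%E by rewrite -(kam x t0) lte_fin ltrDl.
have [_ [y _ <-] hy] := ereal_inf_lt h.
have h' : (min_action g H t y x < (phi x + e - phi y)%:E)%E.
  by rewrite EFinB lteBrDl.
have [_ [xi [acx x0 xt] <-] hx] := ereal_inf_lt h'.
exists xi => //; split => //; rewrite x0 xt -leeBrDl// -EFinB; exact: ltW.
Qed.

Lemma near_minimiser_start t x y e : (phi y - phi x)%:E = min_action g H t x y -> 0 < e ->
  exists2 xi, near_minimiser xi t e & xi 0 = x.
Proof.
move=> E e0; have h' : (min_action g H t x y < (phi y - phi x + e)%:E)%E by rewrite -E lte_fin ltrDl.
have [_ [xi [acx x0 xt] <-] hx] := ereal_inf_lt h'.
exists xi => //; split => //; rewrite x0 xt -leeBrDl// -EFinB.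
apply: le_trans (ltW hx) _; rewrite lee_fin; lra.
Qed.

End weak_kam_curves.

(** * Estimates for weak KAM solutions in a chart *)

Section time_reversal.
Variables (R : realType) (n : nat).
Implicit Types (F : 'rV[R]_n -> 'rV[R]_n -> R) (f : 'rV[R]_n -> R).

(** Reversing time replaces [F q P] by [F q (- P)] and the function by its opposite. With this, a
    curve leaving a point becomes one ending there, and the upper estimate turns into a lower
    one. *)
Lemma ham_bounds_rev F q0 rho : ham_bounds F q0 rho -> ham_bounds (fun q P => F q (- P)) q0 rho.
Proof.
case=> hb hl hg; split.
- move=> K; have [B B0 h] := hb K; exists B => // q P hq hP; apply: h => //; by rewrite normrN.
- move=> K; have [B B0 h] := hl K; exists B => // q q' P hq hq' hP; apply: h => //; by rewrite normrN.
- move=> V0; have [A [C [A0 C0 h]]] := hg V0; exists A, C; split => // q v hq hv.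
  have [|P [a [PA aA hP]]] := h q (- v) hq; first by rewrite normrN.
  exists (- P), a; split => // [|k w Q hk hw]; first by rewrite normrN.
  have := hP k (- w) (- Q) hk; rewrite normrN => /(_ hw).
  by rewrite opprK -opprD !pairingNl !pairingNr opprK; lra.
Qed.

Lemma dominated_rev f F q0 rho : dominated f F q0 rho ->
  dominated (fun q => - f q) (fun q P => F q (- P)) q0 rho.
Proof.
move=> df a b d B ha hb d0 hB; rewrite opprK addrC; apply: df => // s Q /andP[s0 s1].
have := hB (1 - s) (- Q); rewrite opprK pairingNl => /(_ _).
have -> : a + (1 - s) *: (b - a) = b + s *: (a - b).
  by apply/rowP => i; rewrite !mxE; ring.
rewrite -(opprB a b) scalerN pairingNr opprK; apply.
by apply/andP; split; lra.
Qed.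

Lemma calibrated_rev f F z t e : calibrated f F z t e ->
  calibrated (fun q => - f q) (fun q P => F q (- P)) (fun s => z (t - s)) t e.
Proof.
move=> cz s1 s2 P B s10 s12 s2t hB.
have := cz (t - s2) (t - s1) (- P) B; rewrite subr_ge0 => /(_ s2t).
rewrite lerD2l lerN2 => /(_ s12); rewrite lerBlDr lerDl => /(_ s10).
have h s : t - s2 <= s <= t - s1 -> F (z s) (- P) <= B.
  move=> /andP[h1 h2]; rewrite (_ : s = t - (t - s)); last by lra.
  by apply: hB; apply/andP; split; lra.
move=> /(_ h); rewrite pairingNl -pairingNr opprB.
have -> : t - s1 - (t - s2) = s2 - s1 by lra.
lra.
Qed.

Lemma calibrated_le f F z t e e' : e <= e' -> calibrated f F z t e -> calibrated f F z t e'.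
Proof.
by move=> ee' cz s1 s2 P B h1 h2 h3 h4; apply: le_trans (cz _ _ _ _ h1 h2 h3 h4); rewrite lerD2l lerN2.
Qed.

Lemma upper_quadratic_le f y A K r A' K' r' : A <= A' -> K <= K' -> r' <= r ->
  upper_quadratic f y A K r -> upper_quadratic f y A' K' r'.
Proof.
move=> AA KK rr uq e e0; have [p pA hp] := uq e e0; exists p; first exact: le_trans AA.
move=> h hr; apply: le_trans (hp h (le_trans hr rr)) _.
by rewrite lerD2r lerD2l ler_wpM2r ?sqr_ge0.
Qed.

End time_reversal.

Section chart_estimates.
Variables (R : realType) (n : nat) (M : manifold R n) (g : riemannian_metric M).
Variable (U : ball_atlas g).
Hypothesis M_compact : compact [set: M].
Variables (H : hamiltonian M) (H_tonelli : tonelli g H).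
Variables (z : M) (rho kappa D : R).
Hypothesis gc : good_chart g z rho kappa D.
Implicit Types (xi : R -> M) (phi : M -> R).
Let c : chart R n M := chart_at z.
Let q0 := cmap c z.
Let F (q P : 'rV[R]_n) : R := ham_in H c (q, P).
Let rho0 : 0 < rho / 3. Proof. by rewrite divr_gt0// (gc_rho gc). Qed.
Let rho_le (r : R) : r < rho / 3 -> r <= rho.
Proof. by move=> h; have := gc_rho gc; lra. Qed.
Let img (q : 'rV[R]_n) : `|q - q0| <= rho / 3 -> cimg c q.
Proof. by move=> h; apply: (gc_img gc); apply: le_trans h _; have := gc_rho gc; lra. Qed.

Lemma chart_ham_bounds : ham_bounds F q0 (rho / 3).
Proof. exact: (ham_in_bounds H_tonelli rho0 img). Qed.

Lemma segment_ac (a v : 'rV[R]_n) t : 0 <= t ->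
  (forall s, 0 <= s <= t -> `|a + s *: v - q0| < rho / 3) ->
  abs_continuous_curve g t (segment_curve c a (a + v)).
Proof.
move=> t0 hs e e0.
have Dv : 0 < D * `|v| + 1 by rewrite ltr_wpDl// mulr_ge0// ltW// (gc_D gc).
have av : a + v - a = v by rewrite addrAC subrr add0r.
exists (e / (D * `|v| + 1)); first by rewrite divr_gt0.
move=> m A B hAB _ ls.
apply: (@le_lt_trans _ _ ((D * `|v| + 1) * \sum_k (B k - A k))); last first.
  by rewrite mulrC -ltr_pdivlMr.
rewrite mulr_sumr; apply: ler_sum => k _; have [h1 h2 h3] := hAB k.
have inb s : 0 <= s <= t -> `|a + s *: v - q0| < rho.
  by move=> /hs h; apply: lt_le_trans h _; have := gc_rho gc; lra.
rewrite /segment_curve av; apply: le_trans (gc_far gc _ _) _.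
- by apply: inb; rewrite h1 (le_trans h2).
- by apply: inb; rewrite h3 (le_trans h1).
have -> : a + B k *: v - (a + A k *: v) = (B k - A k) *: v.
  by apply/rowP => i; rewrite !mxE; ring.
rewrite normrZ ger0_norm ?subr_ge0//.
by rewrite mulrC -mulrA mulrC ler_wpM2r ?subr_ge0// mulrC lerDl.
Qed.

Lemma lag_le_chart xi s (q w : 'rV[R]_n) B : xi s = cinv c q ->
  velocity xi s = w *m trans c (chart_at (xi s)) (xi s) -> `|q - q0| <= rho ->
  (forall P, pairing P w - F q P <= B) -> lagrangian H (xi s) (velocity xi s) <= B.
Proof. by move=> xE ->; rewrite xE; exact: (lagrangian_le (gc_img gc)). Qed.

(** The chart segment run in time [d] competes in [min_action], and [B] bounds its Lagrangian at
    every time. *)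
Lemma chart_dominated phi : weak_kam g H phi -> dominated (phi \o cinv c) F q0 (rho / 3).
Proof.
move=> kam a b d B ha hb d0 hB.
pose v := d^-1 *: (b - a); pose xi := segment_curve c a (a + v).
have av : a + v - a = v by rewrite addrAC subrr add0r.
have seg s : 0 <= s <= d -> a + s *: v = a + (s / d) *: (b - a) /\ 0 <= s / d <= 1.
  move=> /andP[s0 sd]; split; first by rewrite scalerA.
  by rewrite divr_ge0 ?(ltW d0)//= ler_pdivrMr// mul1r.
have inb s : 0 <= s <= d -> `|a + s *: v - q0| < rho / 3.
  by move=> /seg[-> s01]; exact: ball_segment.
have acx := segment_ac (ltW d0) inb.
have xid : xi d = cinv c b.
  by rewrite /xi /segment_curve av /v scalerA mulfV ?gt_eqF// scale1r addrCA subrr addr0.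
have xi0 : xi 0 = cinv c a by rewrite /xi /segment_curve scale0r addr0.
have := weak_kam_le kam d0 acx; rewrite -/xi xid xi0 => h.
have hact : (action H d xi <= (d * B)%:E)%E.
  have -> : (d * B)%:E = (\int[@lebesgue_measure R]_(s in `[0%R, d]) B%:E)%E.
    by rewrite (integral_cst _ _ B%:E)//= lebesgue_measure_itv /= lte_fin d0 oppr0 adde0 -EFinM mulrC.
  apply: le_integral_ae; apply: aeW => s; rewrite /= in_itv /= => sd; rewrite lee_fin.
  have sb := inb s sd; have Is := img (ltW sb); have [d1 d2] := cinvP Is.
  have Is' : cimg c (a + s *: (a + v - a)) by rewrite av.
  have ds : cdom c (xi s) by rewrite /xi /segment_curve av.
  have vel := velocity_in (smooth_chart_at z) (segment_curve_continuous Is') ds (segment_velocity Is').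
  have xE : xi s = cinv c (a + s *: v) by rewrite /xi /segment_curve av.
  apply: (lag_le_chart xE vel (rho_le sb)) => P; rewrite av.
  by have [-> s01] := seg s sd; exact: hB.
have h2 := le_trans h (leeD2l (phi (cinv c a))%:E hact).
by move: h2; rewrite -EFinD lee_fin /=; lra.
Qed.

Lemma near_minimiser_calibrated phi xi t e a b : weak_kam g H phi -> 0 <= t -> 0 <= e ->
  near_minimiser g H phi xi t e -> 0 <= a -> a <= b -> b <= t ->
  (forall s, a <= s <= b -> in_ball z rho (xi s)) ->
  calibrated (phi \o cinv c) F (fun s => cmap c (xi (a + s))) (b - a) e.
Proof.
move=> kam t0 e0 nm a0 ab bt inb s1 s2 P B s10 s12 s2b hB.
have inb' s : s1 <= s <= s2 -> in_ball z rho (xi (a + s)).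
  by move=> /andP[h1 h2]; apply: inb; apply/andP; split; lra.
have [[d1 _] [d2 _]] : in_ball z rho (xi (a + s1)) /\ in_ball z rho (xi (a + s2)).
  by split; apply: inb'; rewrite ?lexx ?s12.
have := near_minimiser_chart U M_compact H_tonelli kam gc t0 e0 nm
  (a := a + s1) (b := a + s2) (B := B) (P := P).
rewrite /= !cmapK// [in X in _ -> X -> _]lerD2l opprD addrACA subrr add0r; apply => //.
- by rewrite addr_ge0.
- lra.
- by move=> s /andP[h1 h2]; apply: inb; apply/andP; split; lra.
- move=> s /andP[h1 h2]; have := hB (s - a); rewrite [a + (s - a)]addrCA subrr addr0; apply.
  by apply/andP; split; lra.
Qed.

(** A closed coordinate ball of radius [r < rho / 3] has a compact, hence closed, image in [M], so
    it also contains limits along the curve. *)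
Lemma limit_in_ball t xi s r : abs_continuous_curve g t xi -> 0 <= s <= t -> r < rho / 3 ->
  (forall d, 0 < d -> exists u, [/\ 0 <= u <= t, `|u - s| < d, cdom c (xi u) &
     `|cmap c (xi u) - q0| <= r]) -> in_ball z rho (xi s).
Proof.
move=> acx st rr hu; pose K := cinv c @` [set q | `|q - q0| <= r].
have Ir q : `|q - q0| <= r -> cimg c q by move=> h; apply: img; exact: le_trans h (ltW rr).
have cK : compact K.
  apply: continuous_compact; last exact: closed_ball_compact.
  by apply: continuous_in_subspaceT => q /set_mem /= qr; apply: cinv_continuous; exact: Ir.
have clK := compact_closed (@carrier_hausdorff _ _ M) cK.
suff [q qr <-] : K (xi s).
  by have [d1 d2] := cinvP (Ir q qr); split; rewrite // d2; exact: le_lt_trans rr.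
apply: contrapT => nK.
have nbK : nbhs (xi s) (~` K) by apply: open_nbhs_nbhs; split => //; exact: closed_openC.
have [d d0 hd] := ac_continuous U M_compact acx st nbK.
have [u [ut ud cu ru]] := hu d d0; apply: (hd u ut ud).
by exists (cmap c (xi u)); [exact: ru | exact: cmapK].
Qed.

(* [fw] selects the end of the curve at which it is known to lie in the chart. *)
Lemma near_minimiser_stays : exists2 V1 : R, 0 <= V1 & forall phi, weak_kam g H phi ->
  forall xi t e t' (fw : bool), near_minimiser g H phi xi t e -> 0 <= e -> 0 <= t' <= t ->
    let p u := if fw then u else t - u in
    cdom c (xi (p 0)) -> `|cmap c (xi (p 0)) - q0| + V1 * t' + e < rho / 3 ->
    forall u, 0 <= u <= t' -> in_ball z rho (xi (p u)).
Proof.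
have [V1 V10 hV] := calibrated_speed chart_ham_bounds; exists V1 => //.
move=> phi kam xi t e t' fw nm e0 /andP[t'0 t't] p dp lp.
have t0 : 0 <= t by exact: le_trans t't.
have [acx _] := nm.
have pin u : 0 <= u <= t' -> 0 <= p u <= t.
  by move=> /andP[h1 h2]; rewrite /p; case: (fw); apply/andP; split; lra.
have pdist u v : `|p u - p v| = `|u - v|.
  by rewrite /p; case: (fw) => //; rewrite -normrN; congr `|_|; lra.
have Vt (u : R) : 0 <= u <= t' -> V1 * u <= V1 * t' by move=> /andP[_ h]; rewrite ler_wpM2l.
(* [calibrated_speed] applies to the part of the curve already known to lie in the ball. The bound
   it gives is below [rho / 3] by a fixed margin, which keeps limit points inside. *)
have est u : 0 <= u <= t' -> (forall v, 0 <= v <= u -> in_ball z rho (xi (p v))) ->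
    `|cmap c (xi (p u)) - cmap c (xi (p 0))| <= V1 * u + e.
  move=> u0t hv; have /andP[u0 ut] := u0t.
  have main a b : 0 <= a -> a <= b -> b <= t -> (forall s, a <= s <= b -> in_ball z rho (xi s)) ->
      `|cmap c (xi b) - cmap c (xi a)| <= V1 * (b - a) + e.
    move=> a0 ab bt inb.
    have cal := near_minimiser_calibrated kam t0 e0 nm a0 ab bt inb.
    have := hV _ (chart_dominated kam) _ _ _ 0 (b - a) cal (lexx _).
    rewrite subr_ge0 subr0 addr0 [a + (b - a)]addrCA subrr addr0; apply => //.
    move=> s /andP[s0 sb]; have [|_ ] := inb (a + s); last by [].
    by apply/andP; split; lra.
  move: hv; rewrite /p; case: (fw) => hv.
    by have := main 0 u; rewrite subr0; apply => //; exact: le_trans t't.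
  rewrite distrC subr0; have := main (t - u) t; rewrite (_ : t - (t - u) = u); last by lra.
  apply => //; rewrite ?subr_ge0 ?(le_trans ut)//; first by lra.
  move=> s /andP[h1 h2]; have := hv (t - s); rewrite (_ : t - (t - s) = s); last by lra.
  by apply; apply/andP; split; lra.
have pc : in_ball z rho (xi (p 0)).
  split => //; apply: le_lt_trans lp; rewrite -addrA lerDl addr_ge0// mulr_ge0//.
apply: real_induction => //.
- move=> s /andP[s0 st'] Ps; have [|d d0 hd] := ac_continuous U M_compact acx (pin s _) (near_in_ball Ps).
    by rewrite s0 ltW.
  exists (d / 2) => [|u su ud ut]; first by rewrite divr_gt0.
  apply: hd; first by apply: pin; rewrite (le_trans s0 su).
  by rewrite pdist ger0_norm ?subr_ge0//; lra.
- move=> s /andP[s0 st'] hs.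
  apply: (@limit_in_ball t xi (p s) (`|cmap c (xi (p 0)) - q0| + V1 * t' + e)) => //.
    by apply: pin; rewrite ltW.
  move=> d d0; pose u := Num.max 0 (s - d / 2).
  have us : 0 <= u < s by rewrite le_max lexx gt_max s0 ltrBlDr ltrDl divr_gt0.
  have su : s - d / 2 <= u by rewrite le_max lexx orbT.
  have /andP[u0 us'] := us.
  have ut : 0 <= u <= t' by rewrite u0 (le_trans (ltW us')).
  have [du ru] := hs u us.
  exists (p u); split => //; first exact: pin.
    by rewrite pdist distrC ger0_norm ?subr_ge0 ?ltW//; lra.
  have hv v : 0 <= v <= u -> in_ball z rho (xi (p v)).
    by move=> /andP[v0 vu]; apply: hs; rewrite v0 (le_lt_trans vu).
  rewrite -(subrK (cmap c (xi (p 0))) (cmap c (xi (p u)))) -addrA.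
  apply: le_trans (ler_normD _ _) _; have := est u ut hv; have := Vt u ut; lra.
Qed.

Lemma chart_upper_quadratic : exists la T A K : R, [/\ 0 < la, 0 < T <= 1, 0 <= A, 0 < K &
  forall phi, weak_kam g H phi -> forall (y : 'rV[R]_n) t, `|y - q0| < rho / 6 -> 0 < t <= T ->
    upper_quadratic (phi \o cinv c) y A (K / t) (la * t)].
Proof.
have [V1 V10 hV] := near_minimiser_stays.
have [la [T [A [K [la0 /andP[T0 T1] A0 K0 hup]]]]] := calibrated_upper_quadratic rho0 chart_ham_bounds.
have r0 := gc_rho gc.
(* [rho / 6] for the position of [y], [rho / 24] for the distance run in time [T'] and [rho / 24]
   for the error of the near minimiser add up to less than [rho / 3], so the curve stays in the
   ball. *)
pose T' := Num.min T (rho / (24 * (V1 + 1))).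
have V24 : 0 < 24 * (V1 + 1) by lra.
have T'T : T' <= T by rewrite ge_min lexx.
have T'V : V1 * T' <= rho / 24.
  have h : T' * (24 * (V1 + 1)) <= rho by rewrite -ler_pdivlMr// ge_min lexx orbT.
  have T'0 : 0 <= T' by rewrite le_min ltW//= divr_ge0// ltW.
  lra.
exists la, T', A, K; split => //.
  by rewrite lt_min T0 divr_gt0//= (le_trans T'T).
move=> phi kam y t hy /andP[t0 tT]; apply: (hup _ (chart_dominated kam)).
- by apply: lt_le_trans hy _; lra.
- by rewrite t0 (le_trans tT).
move=> e e0; pose e' := Num.min e (rho / 24).
have e'0 : 0 < e' by rewrite lt_min e0 divr_gt0.
have [e'e e'r] : e' <= e /\ e' <= rho / 24 by rewrite !ge_min !lexx orbT.
have Iy : cimg c y by apply: img; lra.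
have [dy ey] := cinvP Iy.
have [xi nm xt] := near_minimiser_end kam (cinv c y) t0 e'0.
have tt : 0 <= t <= t by rewrite ltW/=.
have stay := hV phi kam xi t e' t false nm (ltW e'0) tt.
have Vt : V1 * t <= V1 * T' by rewrite ler_wpM2l.
have {}stay s : 0 <= s <= t -> in_ball z rho (xi s).
  move=> /andP[s0 st]; have := stay _ _ (t - s); rewrite /= subr0 xt ey (_ : t - (t - s) = s); last by lra.
  by apply => //; [lra | apply/andP; split; lra].
have cal := near_minimiser_calibrated kam (ltW t0) (ltW e'0) nm (lexx 0) (ltW t0) (lexx t) stay.
exists (fun s => cmap c (xi (0 + s))); split.
- by rewrite add0r xt.
- by move=> s /stay; rewrite add0r => -[].
- by rewrite subr0 in cal; exact: calibrated_le cal.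
Qed.

(** The supremum defining [cut_time] may not be attained, hence the loss of half of [t]. The
    equality with [min_action] at time [t'] turns nearly optimal curves into near minimisers leaving
    [x]. *)
Lemma cut_near_minimiser phi t x : 0 < t -> cut_set g H phi t x ->
  exists2 t', t / 2 < t' & forall e, 0 < e -> exists2 xi, near_minimiser g H phi xi t' e & xi 0 = x.
Proof.
move=> t0 cx; have h : ((t / 2)%:E < cut_time g H phi x)%E.
  by apply: lt_le_trans cx; rewrite lte_fin; lra.
have [_ [t' ht' <-]] := ereal_sup_gt h; rewrite lte_fin => tt'.
case: ht' => [t'0|[t'0 [gamma [_ _ E]]]]; first by lra.
by exists t' => // e e0; exact: near_minimiser_start E e0.
Qed.

Lemma chart_lower_quadratic : exists la T A K : R, [/\ 0 < la, 0 < T, 0 <= A, 0 < K &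
  forall phi, weak_kam g H phi -> forall (y : 'rV[R]_n) t, `|y - q0| < rho / 6 -> 0 < t <= T ->
    cut_set g H phi t (cinv c y) ->
    upper_quadratic (fun q => - (phi \o cinv c) q) y A (K / t) (la * t)].
Proof.
have [V1 V10 hV] := near_minimiser_stays.
have [la [T [A [K [la0 /andP[T0 T1] A0 K0 hup]]]]] :=
  calibrated_upper_quadratic rho0 (ham_bounds_rev chart_ham_bounds).
have r0 := gc_rho gc.
pose T' := Num.min T (rho / (24 * (V1 + 1))).
have V24 : 0 < 24 * (V1 + 1) by lra.
have T'T : T' <= T by rewrite ge_min lexx.
have T'0 : 0 < T' by rewrite lt_min T0 divr_gt0.
have T'V : V1 * T' <= rho / 24.
  have h : T' * (24 * (V1 + 1)) <= rho by rewrite -ler_pdivlMr// ge_min lexx orbT.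
  lra.
(* The argument is run on [[0, t / 2]], which halves the radius and doubles the opening. *)
exists (la / 2), T', A, (2 * K); split; rewrite ?divr_gt0 ?mulr_gt0//.
move=> phi kam y t hy /andP[t0 tT] cut.
have t20 : 0 < t / 2 by rewrite divr_gt0.
have -> : 2 * K / t = K / (t / 2) by field; rewrite gt_eqF.
have -> : la / 2 * t = la * (t / 2) by field.
apply: (hup _ (dominated_rev (chart_dominated kam))).
- by apply: lt_le_trans hy _; lra.
- by rewrite t20/=; lra.
move=> e e0; pose e' := Num.min e (rho / 24).
have e'0 : 0 < e' by rewrite lt_min e0 divr_gt0.
have [e'e e'r] : e' <= e /\ e' <= rho / 24 by rewrite !ge_min !lexx orbT.
have Iy : cimg c y by apply: img; lra.
have [dy ey] := cinvP Iy.
have [t' tt' ht'] := cut_near_minimiser t0 cut.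
have [xi nm x0] := ht' e' e'0.
have tt : 0 <= t / 2 <= t' by rewrite !ltW.
have stay := hV phi kam xi t' e' (t / 2) true nm (ltW e'0) tt.
have Vt : V1 * (t / 2) <= V1 * T' by rewrite ler_wpM2l//; lra.
have {}stay s : 0 <= s <= t / 2 -> in_ball z rho (xi s).
  by have := stay; rewrite /= x0 ey => h hs; apply: h => //; lra.
have t'0 : 0 <= t' by apply: le_trans (ltW tt'); exact: ltW.
have cal := near_minimiser_calibrated kam t'0 (ltW e'0) nm (lexx 0) (ltW t20) (ltW tt') stay.
rewrite subr0 in cal.
exists (fun s => cmap c (xi (0 + (t / 2 - s)))); split.
- by rewrite subrr addr0 x0.
- move=> s /andP[s0 st]; rewrite add0r; have [] // := stay (t / 2 - s).
  by apply/andP; split; lra.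
- exact: calibrated_le e'e (calibrated_rev cal).
Qed.

Lemma chart_gradient_estimate : exists la T A K : R, [/\ 0 < la, 0 < T <= 1, 0 <= A, 0 < K &
  forall phi, weak_kam g H phi -> forall (x : 'rV[R]_n) t, `|x - q0| < rho / 12 -> 0 < t <= T ->
    cut_set g H phi t (cinv c x) -> exists q : 'rV[R]_n, [/\ `|q| <= A,
      (forall h : 'rV[R]_n, `|h| <= la * t ->
         `|(phi \o cinv c) (x + h) - (phi \o cinv c) x - pairing q h| <= K / t * `|h| ^+ 2) &
      forall y p : 'rV[R]_n, `|y - x| <= la * t -> ray_supergradient (phi \o cinv c) y p ->
        `|p - q| <= K / t * `|y - x|]].
Proof.
have [l1 [T1 [A1 [K1 [l10 /andP[T10 T11] A10 K10 up]]]]] := chart_upper_quadratic.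
have [l2 [T2 [A2 [K2 [l20 T20 A20 K20 low]]]]] := chart_lower_quadratic.
have r0 := gc_rho gc.
(* [gradient_estimate] with [r = l * t] takes upper paraboloids of radius [2 * r] at all points
   within [2 * r] of [x] and a lower one of radius [r] at [x]. The bound [rho / 24] keeps these
   points within [rho / 12 + 2 * (rho / 24) = rho / 6] of the centre. *)
pose l := Num.min (Num.min (l1 / 2) l2) (rho / 24).
have l_gt0 : 0 < l by rewrite !lt_min l20 !divr_gt0.
have ll1 : 2 * l <= l1.
  have : l <= l1 / 2 by rewrite !ge_min lexx.
  by lra.
have ll2 : l <= l2 by rewrite !ge_min lexx orbT.
have lr : l <= rho / 24 by rewrite !ge_min lexx orbT.
pose T := Num.min T1 T2.
have [TT1 TT2] : T <= T1 /\ T <= T2 by rewrite !ge_min !lexx orbT.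
pose K := Num.max K1 K2.
have [KK1 KK2] : K1 <= K /\ K2 <= K by rewrite !le_max !lexx orbT.
have K0 : 0 < K by exact: lt_le_trans KK1.
pose A := Num.max A1 A2.
have [AA1 AA2] : A1 <= A /\ A2 <= A by rewrite !le_max !lexx orbT.
(* [gradient_estimate] covers supergradients within half of the radius [l * t], with factor [6]. *)
exists (l / 2), T, A, (6 * K); split.
- by rewrite divr_gt0.
- by rewrite lt_min T10 T20 (le_trans TT1).
- exact: le_trans AA1.
- by rewrite mulr_gt0.
move=> phi kam x t hx /andP[t0 tT] cut.
have lt0 : 0 < l * t by rewrite mulr_gt0.
have ltr : l * t <= rho / 24.
  have t1 : t <= 1 by exact: le_trans tT (le_trans TT1 T11).
  by apply: le_trans lr; rewrite ler_piMr// ltW.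
have Kt (k : R) : k <= K -> k / t <= K / t by move=> kK; rewrite ler_wpM2r// invr_ge0 ltW.
have K0t : 0 <= K / t by rewrite divr_ge0// ltW.
have up' (y : 'rV[R]_n) : `|y - x| <= 2 * (l * t) ->
    upper_quadratic (phi \o cinv c) y A (K / t) (2 * (l * t)).
  move=> hy; apply: (@upper_quadratic_le _ _ _ _ A1 (K1 / t) (l1 * t)) => //; first exact: Kt.
    by rewrite mulrA ler_wpM2r// ltW.
  apply: up => //; last by rewrite t0 (le_trans tT).
  rewrite -(subrK x y) -addrA; apply: le_lt_trans (ler_normD _ _) _; lra.
have low' : upper_quadratic (fun q => - (phi \o cinv c) q) x A (K / t) (l * t).
  apply: (@upper_quadratic_le _ _ _ _ A2 (K2 / t) (l2 * t)) => //; first exact: Kt.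
    by rewrite ler_wpM2r// ltW.
  apply: low => //; first by lra.
  by rewrite t0 (le_trans tT).
have [q [qA hq hp]] := gradient_estimate lt0 K0t up' low'.
have hl : l / 2 * t = l * t / 2 by rewrite mulrAC.
exists q; split => // [h hh|y p hy sp].
  apply: le_trans (hq h _) _; first by apply: (le_trans hh); rewrite hl; lra.
  by rewrite ler_wpM2r ?sqr_ge0// ler_wpM2r ?invr_ge0 ?(ltW t0)//; lra.
by rewrite -[6 * K / t]mulrA; apply: hp => //; rewrite -hl.
Qed.

End chart_estimates.

(** * Supergradients on the manifold *)

Section pairing_linear.
Variables (R : realType) (n : nat).

(** Bundled as a linear map below, so that it can serve as the differential in
    [differentiable_littleo]. *)
Definition pairing_map (p : 'rV[R]_n) (v : 'rV[R]_n) : R^o := pairing p v.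

Lemma pairing_map_linear p : linear (pairing_map p).
Proof. by move=> a u v; rewrite /pairing_map pairingDr pairingZr. Qed.

HB.instance Definition _ p :=
  GRing.isLinear.Build R 'rV[R]_n R^o _ (pairing_map p) (pairing_map_linear p).

Lemma pairingC (p v : 'rV[R]_n) : pairing p v = pairing v p.
Proof. by rewrite !pairingE; apply: eq_bigr => i _; rewrite mulrC. Qed.

Lemma pairing_map_continuous p : continuous (pairing_map p).
Proof.
have -> : pairing_map p = (fun v => pairing v p) by apply/funext => v; rewrite /pairing_map pairingC.
exact: pairing_continuous.
Qed.

Lemma derive_pairing (f : 'rV[R]_n -> R^o) a w : differentiable f a ->
  'D_w f a = pairing (\row_i 'D_(delta_mx 0 i) f a) w.
Proof.
move=> df; rewrite (deriveE w df) {1}(row_basisE w) linear_sum pairingE.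
apply: eq_bigr => i _; rewrite linearZ mxE (deriveE _ df) mulrC.
by [].
Qed.

Lemma pairing_delta (p : 'rV[R]_n) i : pairing p (delta_mx 0 i) = p 0 i.
Proof.
rewrite pairingE (bigD1 i)//= big1 ?addr0 => [|j ji]; rewrite mxE eqxx /=.
  by rewrite eqxx mulr1.
by rewrite (negbTE ji) mulr0.
Qed.

Lemma enorm_le (v : 'rV[R]_n) : enorm v <= n.+1%:R * `|v|.
Proof.
have n0 : 0 <= n.+1%:R * `|v| by rewrite mulr_ge0.
rewrite /enorm -[leRHS]ger0_norm// -sqrtr_sqr ler_wsqrtr//.
apply: (@le_trans _ _ (n%:R * `|v| ^+ 2)).
  rewrite -[n in n%:R]card_ord mulr_natl -sumr_const; apply: ler_sum => i _.
  by rewrite -[X in X <= _]ger0_norm ?sqr_ge0// normrX lerXn2r ?nnegrE// coord_le_norm.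
rewrite exprMn ler_wpM2r ?sqr_ge0// -natrX ler_nat.
by rewrite expnS expn1 (leq_trans (leqnSn n))// leq_pmulr.
Qed.

End pairing_linear.

Section covectors.
Variables (R : realType) (n : nat) (M : manifold R n).
Implicit Types (c e : chart R n M) (f : M -> R) (x : M).

Lemma Dfun_of_chart c f x (q : 'rV[R]_n) : smooth_chart c -> cdom c x ->
  differentiable (in_coords c f) (cmap c x) ->
  (forall v, 'D_v (in_coords c f) (cmap c x) = pairing q v) ->
  differentiable_at f x /\ cov_in c x (Dfun f x) = q.
Proof.
move=> sc cx df dE; have xx := chart_at_dom x; have [sc1 sc2] := sc x.
have [d dE'] := change_of_chart (W := R^o) (f := f) sc2 xx cx df.
split => //.
have -> : Dfun f x = q *m (trans (chart_at x) c x)^T.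
  apply/rowP => i; rewrite mxE; apply: (etrans (dE' _)); rewrite dE -pairing_delta.
  by rewrite /pairing trmx_mul mulmxA.
rewrite /cov_in -mulmxA -trmx_mul.
by rewrite (transK (sc x) cx xx) trmx1 mulmx1.
Qed.

Lemma Dfun_in_chart c f x : smooth_chart c -> cdom c x -> differentiable_at f x ->
  differentiable (in_coords c f) (cmap c x) /\
  forall v, 'D_v (in_coords c f) (cmap c x) = pairing (cov_in c x (Dfun f x)) v.
Proof.
move=> sc cx df; have xx := chart_at_dom x; have [sc1 sc2] := sc x.
have [d dE] := change_of_chart (W := R^o) (f := f) sc1 cx xx df.
split => // v; apply: (etrans (dE v)); apply: (etrans (derive_pairing _ df)).
by rewrite /cov_in /pairing trmx_mul mulmxA.
Qed.

Lemma cov_in_trans c e x (p : 'rV[R]_n) : smooth_transition e c -> smooth_chart c ->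
  cdom c x -> cdom e x -> cov_in e x p = cov_in c x p *m (trans e c x)^T.
Proof.
move=> ec sc cx ex; rewrite /cov_in -mulmxA -trmx_mul.
by rewrite (trans_comp ec (sc x).1 ex cx (chart_at_dom x)).
Qed.

Lemma cov_in_extension (i e : chart R n M) x (p : 'rV[R]_n) : smooth_chart e -> cdom i x ->
  (forall y, cdom i y -> cdom e y /\ cmap e y = cmap i y) -> cov_in i x p = cov_in e x p.
Proof.
move=> se ix ie; have [ex eE] := ie x ix.
suff E : trans i (chart_at x) x = trans e (chart_at x) x by rewrite /cov_in E.
have de := transition_differentiable (se x).1 ex (chart_at_dom x).
rewrite eE in de.
have [|d dE] := derive_near (f := cmap (chart_at x) \o cinv i) _ de.
  have := near_cinv ix (near_cdom ix); apply: filterS => q [/cinvP[h1 h2] _].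
  have [h3 h4] := ie _ h1; rewrite /=; congr (cmap _ _).
  by rewrite -{2}h2 -h4 cmapK.
apply: mulmx_row_inj => v; rewrite {2}/trans eE.
exact: etrans (esym (deriveEjacobian v d)) (etrans (dE v) (deriveEjacobian v de)).
Qed.

End covectors.

Lemma mulmx_split_le (R : realType) (n : nat) (P Q : 'rV[R]_n) (S T : 'M[R]_n) (a b : R) :
  `|(P - Q) *m S| <= a -> `|Q *m S - Q *m T| <= b -> `|P *m S - Q *m T| <= a + b.
Proof.
move=> ha hb; have -> : P *m S - Q *m T = (P - Q) *m S + (Q *m S - Q *m T).
  by rewrite mulmxBl addrA subrK.
by apply: le_trans (ler_normD _ _) _; exact: lerD.
Qed.

Section final.
Variables (R : realType) (n : nat) (M : manifold R n) (g : riemannian_metric M).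
Variable (U : ball_atlas g).
Implicit Types (phi : M -> R).

(** A short coordinate ray from [y] stays in the Riemannian ball where the test function lies above
    [phi], because [gc_far] bounds Riemannian by coordinate distance; the differential of the test
    function then gives the bound. *)
Lemma Dplus_ray z rho kappa D phi y (p : 'rV[R]_n) : good_chart g z rho kappa D ->
  in_ball z rho y -> Dplus g phi y p ->
  ray_supergradient (in_coords (chart_at z) phi) (cmap (chart_at z) y) (cov_in (chart_at z) y p).
Proof.
move=> gc [cy ry] [r [psi [r0 C1 le_psi psiy ->]]] h e e0.
set c := chart_at z in cy ry *; have rho0 := gc_rho gc.
have ry' : `|cmap c y - cmap c z| < rho by apply: lt_le_trans ry _; lra.
have yy : rball g y r y.
  rewrite /rball /= -(cmapK cy).
  by apply: le_lt_trans (gc_far gc ry' ry') _; rewrite subrr normr0 mulr0.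
have dpsi : differentiable_at psi y.
  have [d _] := C1 y; apply: d; exists y => //; split => //; exact: chart_at_dom.
have [dc dE] := Dfun_in_chart (smooth_chart_at z) cy dpsi.
have h1 : 0 < `|h| + 1 by rewrite ltr_wpDl.
have D0 := gc_D gc.
have e1 : 0 < e / (`|h| + 1) by rewrite divr_gt0.
have /diff_locally/eqaddoP/(_ _ e1)/nbhs_normP[d /= d0 hd] := dc.
(* Below [m] the first order expansion of [psi] holds, the ray stays in the chart ball, and its
   points stay in [rball g y r]. *)
pose m := Num.min d (Num.min (rho - `|cmap c y - cmap c z|) (r / D)).
have m0 : 0 < m by rewrite !lt_min d0 subr_gt0 ry' divr_gt0.
have [md mrho mr] : [/\ m <= d, m <= rho - `|cmap c y - cmap c z| & m <= r / D].
  by rewrite !ge_min !lexx !orbT.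
exists (m / (`|h| + 1)); first by rewrite divr_gt0.
move=> s /andP[s0]; rewrite ltr_pdivlMr// => sm.
have shn : `|s *: h| = s * `|h| by rewrite normrZ gtr0_norm.
have shm : `|s *: h| < m by rewrite shn; apply: le_lt_trans sm; rewrite ler_wpM2l ?(ltW s0)// lerDl.
have rq : `|cmap c y + s *: h - cmap c z| < rho.
  by rewrite addrAC; apply: le_lt_trans (ler_normD _ _) _; lra.
have inr : rball g y r (cinv c (cmap c y + s *: h)).
  rewrite /rball /= -{1}(cmapK cy); apply: le_lt_trans (gc_far gc ry' rq) _.
  rewrite addrAC subrr add0r mulrC -ltr_pdivlMr//; exact: lt_le_trans mr.
rewrite /in_coords /= cmapK// -psiy; apply: le_trans (le_psi _ inr) _.
have := hd (s *: h); rewrite /= sub0r normrN => /(_ (lt_le_trans shm md)).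
rewrite -[(_ - _) _]/(in_coords c psi (s *: h + cmap c y) - (in_coords c psi (cmap c y) + 'd (in_coords c psi) (cmap c y) (s *: h))).
rewrite -(deriveE _ dc) dE pairingZr addrC /in_coords /= cmapK// => hle.
have {hle} := le_trans (ler_norm _) hle; rewrite addrC [s *: h + _]addrC => hle.
have : e / (`|h| + 1) * `|s *: h| <= e * s.
  rewrite shn mulrAC ler_pdivrMr// mulrA ler_wpM2l ?mulr_ge0 ?(ltW e0) ?(ltW s0)// lerDl//.
lra.
Qed.

(** The constants must hold near [z] even when [z] lies on the boundary of the domain of the chart
    [i]. There the extension given by [achart_extends] still contains [z]; away from the closure the
    claim is void for small [r]. The second term on the right is the variation of the transition
    matrix between [x] and [y]. *)
Lemma achart_lipschitz z (i : aidx U) : exists r K : R, [/\ 0 < r, 0 <= K &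
  forall (x y : M) (p q : 'rV[R]_n), cdom (chart_at z) x -> cdom (chart_at z) y ->
    `|cmap (chart_at z) x - cmap (chart_at z) z| < r ->
    `|cmap (chart_at z) y - cmap (chart_at z) z| < r ->
    cdom (achart i) x -> cdom (achart i) y ->
    `|cov_in (achart i) y p - cov_in (achart i) x q| <=
      K * `|cov_in (chart_at z) y p - cov_in (chart_at z) x q| +
      K * `|cov_in (chart_at z) x q| * `|cmap (chart_at z) y - cmap (chart_at z) x|].
Proof.
have [e [se cle eE]] := achart_extends i.
pose c : chart R n M := chart_at z; have cz : cdom c z := chart_at_dom z.
have ie y : cdom (achart i) y -> cdom e y /\ cmap e y = cmap (achart i) y.
  by move=> iy; split; [apply: cle; exact: subset_closure | exact: eE].
have [zi|zi] := pselect (closure (cdom (achart i)) z); last first.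
  have nz : nbhs z (~` closure (cdom (achart i))).
    by apply: open_nbhs_nbhs; split => //; apply: closed_openC; exact: closed_closure.
  have /nbhs_normP[r /= r0 hr] := near_cinv cz nz.
  exists r, 0; split => // x y p q cx cy xr yr ix iy; exfalso.
  have [] := hr (cmap c x); first by rewrite /= distrC.
  by rewrite cmapK// => _; apply; exact: subset_closure.
have [r [K [r0 K0 hdom hK hL]]] := trans_lipschitz (conj (se z).2 (se z).1) cz (cle z zi).
exists r, K; split => // x y p q cx cy xr yr ix iy.
have [[ex _] [ey _]] := (ie x ix, ie y iy).
rewrite (cov_in_extension _ se ix ie) (cov_in_extension _ se iy ie).
rewrite (cov_in_trans p (se z).1 (smooth_chart_at z) cy ey).
rewrite (cov_in_trans q (se z).1 (smooth_chart_at z) cx ex).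
by apply: mulmx_split_le; [exact: hK | exact: hL].
Qed.

Lemma achart_lipschitz_unif z : exists r K : R, [/\ 0 < r, 0 <= K &
  forall (i : aidx U) (x y : M) (p q : 'rV[R]_n), cdom (chart_at z) x -> cdom (chart_at z) y ->
    `|cmap (chart_at z) x - cmap (chart_at z) z| < r ->
    `|cmap (chart_at z) y - cmap (chart_at z) z| < r ->
    cdom (achart i) x -> cdom (achart i) y ->
    `|cov_in (achart i) y p - cov_in (achart i) x q| <=
      K * `|cov_in (chart_at z) y p - cov_in (chart_at z) x q| +
      K * `|cov_in (chart_at z) x q| * `|cmap (chart_at z) y - cmap (chart_at z) x|].
Proof.
have /choice[rK hrK] (i : aidx U) : exists rK : R * R, [/\ 0 < rK.1, 0 <= rK.2 &
  forall (x y : M) (p q : 'rV[R]_n), cdom (chart_at z) x -> cdom (chart_at z) y ->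
    `|cmap (chart_at z) x - cmap (chart_at z) z| < rK.1 ->
    `|cmap (chart_at z) y - cmap (chart_at z) z| < rK.1 ->
    cdom (achart i) x -> cdom (achart i) y ->
    `|cov_in (achart i) y p - cov_in (achart i) x q| <=
      rK.2 * `|cov_in (chart_at z) y p - cov_in (chart_at z) x q| +
      rK.2 * `|cov_in (chart_at z) x q| * `|cmap (chart_at z) y - cmap (chart_at z) x|].
  by have [r [K [r0 K0 h]]] := achart_lipschitz z i; exists (r, K).
pose r := \big[Num.min/1]_i (rK i).1; pose K := \sum_i (rK i).2.
have ri i : r <= (rK i).1 by exact: bigmin_le_cond.
have Ki i : (rK i).2 <= K.
  by rewrite /K (bigD1 i)//= lerDl; apply: sumr_ge0 => j _; have [] := hrK j.
exists r, K; split.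
- by rewrite /r; elim/big_ind : _ => // [x y x0 y0|i _]; [rewrite lt_min x0 | have [] := hrK i].
- by apply: sumr_ge0 => j _; have [] := hrK j.
move=> i x y p q cx cy xr yr ix iy; have [_ _ h] := hrK i.
apply: le_trans (h x y p q cx cy (lt_le_trans xr (ri i)) (lt_le_trans yr (ri i)) ix iy) _.
by apply: lerD; rewrite -?mulrA; apply: ler_wpM2r => //; exact: mulr_ge0.
Qed.

Hypothesis M_compact : compact [set: M].
Variables (H : hamiltonian M) (H_tonelli : tonelli g H).

(* A single parameter [b] governs all constants ([lambda = T = b^-1], [C = b]),
   because the estimate persists when [b] grows, as compactness requires. *)
Definition estimate_at (b : R) (x : M) : Prop :=
  forall phi t, weak_kam g H phi -> 0 < t <= b^-1 -> cut_set g H phi t x ->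
    differentiable_at phi x /\
    forall (y : M) (p : 'rV[R]_n), rball g x (b^-1 * t) y -> Dplus g phi y p ->
      (exists i : aidx U, cdom (achart i) x /\ cdom (achart i) y) /\
      forall i : aidx U, cdom (achart i) x -> cdom (achart i) y ->
        enorm (cov_in (achart i) y p - cov_in (achart i) x (Dfun phi x)) <= b / t * rdist g x y.

Lemma local_estimate (z : M) : exists B, \forall x \near z, forall b, B <= b -> estimate_at b x.
Proof.
have [rho [kappa [D gc]]] := good_chart_exists U z.
have [la [T [A [K [la0 /andP[T0 T1] A0 K0 hest]]]]] := chart_gradient_estimate U M_compact H_tonelli gc.
have [r [L [r0 L0 hL]]] := achart_lipschitz_unif z.
have [delta d0 hdelta] := achart_nearby U.
have [rho0 k0] := (gc_rho gc, gc_kappa gc).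
pose c : chart R n M := chart_at z.
(* [x] will lie within [r1] of the centre and [y] within [r1] of [x], so both lie in the chart ball
   and in the ball of radius [r] where [hL] applies. *)
pose r1 := Num.min (rho / 12) (r / 2).
have r10 : 0 < r1 by rewrite lt_min !divr_gt0.
have [r1rho r1r] : r1 <= rho / 12 /\ r1 <= r / 2 by rewrite !ge_min !lexx orbT.
have [r1_r r2_r] : r1 <= r /\ 2 * r1 <= r by split; lra.
have [r1_3 r2_3 r2_rho] : [/\ r1 <= rho / 3, 2 * r1 <= rho / 3 & r1 + r1 <= rho] by split; lra.
(* Distance below [l] places [y] within [r1] of [x] in coordinates and both points in a common chart
   of the atlas; [la] takes care of the radius [la * t] of the gradient estimate. *)
pose l := Num.min (kappa * Num.min r1 la) delta.
have l0 : 0 < l by rewrite lt_min d0 andbT mulr_gt0// lt_min r10.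
(* [L * K / kappa] comes from the gradient estimate in the chart at [z] and [L * A / kappa] from the
   variation of the transition matrix acting on a covector of size at most [A]. The factor
   [kappa^-1] converts coordinate into Riemannian distance, and [n.+1%:R] the maximum norm into the
   Euclidean one. *)
pose C := n.+1%:R * (L * K / kappa + L * A / kappa).
have C0 : 0 <= C by rewrite mulr_ge0// addr_ge0// divr_ge0 ?mulr_ge0// ltW.
exists (Num.max (Num.max C T^-1) (Num.max l^-1 1)).
have := near_chart_ball r10 (chart_at_dom z : cdom c z).
apply: filterS => x [cx xr1] b bB phi t kam /andP[t0 tb] cut.
move: bB; rewrite !ge_max => /andP[/andP[bC bT] /andP[bl b1]].
have b0 : 0 < b by exact: lt_le_trans b1.
have ib1 : b^-1 <= 1 by rewrite invf_le1.
have tT : t <= T by apply: (le_trans tb); rewrite invf_ple ?posrE.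
have t1 : t <= 1 by exact: le_trans tb ib1.
have bl' : b^-1 <= l by rewrite invf_ple ?posrE.
have xE : cinv c (cmap c x) = x by rewrite cmapK.
have k1 : `|cmap c x - cmap c z| < rho / 12 by exact: lt_le_trans xr1 r1rho.
have k2 : 0 < t <= T by rewrite t0.
have k3 : cut_set g H phi t (cinv c (cmap c x)) by rewrite xE.
have [q [qA hq hp]] := hest phi kam (cmap c x) t k1 k2 k3.
have lat : 0 < la * t by rewrite mulr_gt0.
have [df dfE] : differentiable (in_coords c phi) (cmap c x) /\
    'd (in_coords c phi) (cmap c x) = pairing_map q :> ('rV[R]_n -> R^o).
  apply: differentiable_littleo; first exact: pairing_map_continuous.
  move=> e e0.
  have Kt : 0 < K / t by rewrite divr_gt0.
  have m0 : 0 < Num.min (la * t) (e / (K / t)) by rewrite lt_min lat divr_gt0.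
  apply/nbhs_normP; exists (Num.min (la * t) (e / (K / t))) => //= h.
  rewrite /ball_ /= sub0r normrN lt_min => /andP[h1 h2].
  have := hq h (ltW h1); rewrite [cmap c x + h]addrC => h3.
  apply: le_trans h3 _; rewrite expr2 mulrA ler_wpM2r//.
  by rewrite mulrC -ler_pdivlMr// ltW.
have [dx Dx] : differentiable_at phi x /\ cov_in c x (Dfun phi x) = q.
  by apply: Dfun_of_chart => //; [exact: smooth_chart_at | move=> v; rewrite deriveE// dfE].
split => // y p yb Dp.
have rd : rdist g x y < b^-1 * t by [].
have rdl : rdist g x y < l.
  by apply: (lt_le_trans rd); apply: le_trans bl'; rewrite ler_piMr// invr_ge0 ltW.
split; first by apply: hdelta; apply: lt_le_trans rdl _; rewrite ge_min lexx orbT.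
move=> i ix iy.
have m1 : Num.min r1 la <= r1 by rewrite ge_min lexx.
have [cy yr1] : cdom c y /\ `|cmap c y - cmap c x| < r1.
  apply: (gc_near gc) => //; first by apply: le_trans r2_rho; rewrite lerD2r ltW.
  rewrite -/c xE; apply: lt_le_trans rdl _.
  by rewrite ge_min (_ : kappa * Num.min r1 la <= kappa * r1)// ler_pM2l.
have yrho : `|cmap c y - cmap c z| < 2 * r1.
  rewrite -(subrK (cmap c x) (cmap c y)) -addrA; apply: le_lt_trans (ler_normD _ _) _.
  by rewrite mulr_natl mulr2n; exact: ltrD.
have inx : in_ball z rho x by split => //; exact: lt_le_trans xr1 r1_3.
have iny : in_ball z rho y by split => //; exact: lt_le_trans yrho r2_3.
have dxy := chart_rdist_ge (gc_near gc) inx iny; rewrite -/c in dxy.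
have dxy' : `|cmap c y - cmap c x| <= kappa^-1 * rdist g x y by rewrite ler_pdivlMl.
have ylat : `|cmap c y - cmap c x| <= la * t.
  apply: le_trans dxy' _; rewrite ler_pdivrMl//.
  apply: (le_trans (ltW rd)); rewrite mulrA ler_wpM2r ?(ltW t0)//.
  apply: (le_trans bl'); rewrite ge_min; apply/orP; left.
  by rewrite ler_pM2l// ge_min lexx orbT.
have ray := Dplus_ray gc iny Dp.
have est := hp (cmap c y) (cov_in c y p) ylat ray.
apply: le_trans (enorm_le _) _.
have xr := lt_le_trans xr1 r1_r.
have yr := lt_le_trans yrho r2_r.
have := hL i x y p (Dfun phi x) cx cy xr yr ix iy; rewrite -/c Dx => h.
have rd0 : 0 <= rdist g x y by exact: rdist_ge0.
have h1 : L * `|cov_in c y p - q| <= L * K / kappa / t * rdist g x y.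
  apply: (@le_trans _ _ (L * (K / t * (kappa^-1 * rdist g x y)))).
    rewrite ler_wpM2l//; apply: le_trans est _; rewrite ler_wpM2l// divr_ge0// ltW//.
  by rewrite le_eqVlt; apply/orP; left; apply/eqP; field; rewrite !gt_eqF.
have h2 : L * `|q| * `|cmap c y - cmap c x| <= L * A / kappa / t * rdist g x y.
  apply: (@le_trans _ _ (L * A * (kappa^-1 * rdist g x y))).
    by apply: ler_pM => //; [exact: mulr_ge0 | exact: ler_wpM2l].
  (* The variation of the transition matrix carries no factor [1 / t]; it may be inserted because
     [t <= 1]. *)
  rewrite mulrA ler_wpM2r// ler_peMr ?invf_ge1//.
  by rewrite divr_ge0 ?mulr_ge0// ltW.
apply: (@le_trans _ _ (C / t * rdist g x y)); last by rewrite ler_wpM2r// ler_wpM2r// invr_ge0 ltW.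
have -> : C / t * rdist g x y =
    n.+1%:R * (L * K / kappa / t * rdist g x y + L * A / kappa / t * rdist g x y).
  by rewrite /C; ring.
by rewrite ler_wpM2l//; apply: le_trans h (lerD h1 h2).
Qed.

End final.

Theorem theorem5p6 (R : realType) (n : nat) (M : manifold R n)
  (g : riemannian_metric M) (U : ball_atlas g) (H : hamiltonian M)
  (M_compact : compact [set: M]) (M_connected : connected [set: M])
  (H_tonelli : tonelli g H) (H_critical : mane_critical_value g H = 0%E) :
  exists lambda T C : R, [/\ 0 < lambda, 0 < T, 0 < C &
    forall phi : M -> R, weak_kam g H phi ->
    forall (t : R) (x : M), 0 < t <= T -> cut_set g H phi t x ->
      differentiable_at phi x /\
      forall (y : M) (p : 'rV[R]_n),
        rball g x (lambda * t) y -> Dplus g phi y p ->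
        (exists i : aidx U, cdom (achart i) x /\ cdom (achart i) y) /\
        forall i : aidx U, cdom (achart i) x -> cdom (achart i) y ->
          enorm (cov_in (achart i) y p - cov_in (achart i) x (Dfun phi x))
            <= C / t * rdist g x y].
Proof.
have [|B hB] := compact_eventually (P := estimate_at U H) M_compact.
  move=> z _; have [B hB] := local_estimate U M_compact H_tonelli z.
  by exists B; move: hB; apply: filterS => x hx b Bb _; exact: hx.
pose b := `|B| + 1.
have Bb : B <= b by apply: le_trans (ler_norm B) _; rewrite lerDl.
have b0 : 0 < b by rewrite ltr_wpDl.
exists b^-1, b^-1, b; split; rewrite ?invr_gt0// => phi kam t x tb cut.
exact: (hB b x Bb).
Qed.
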